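(* Let $G$ be a homogeneous group of homogeneous dimension $Q$, let $j\in\mathbb{R}$, and let $K\in\mathcal{S}'(G)$. Then $K\in\check{\mathcal{M}}^j(G)$ if and only if we may write $$K=\sum_{k=0}^\infty f_k \qquad (1)$$ with convergence in $\mathcal{S}'(G)$, where $$f_k=2^{(j+Q)k}\,\varphi_k\circ\delta_{2^k}, \qquad (2)$$ $\{\varphi_k\}_{k\ge0}\subseteq\mathcal{S}(G)$ is a bounded sequence, and $\varphi_k\in\mathcal{S}_o(G)$ for $k\ge1$. Further, given such a sequence $\{\varphi_k\}_k$, if $f_k$ is defined by (2), then the series $\sum_{k=0}^\infty f_k$ necessarily converges in $\mathcal{S}'(G)$ to an element of $\check{\mathcal{M}}^j(G)$. Moreover, $\check{\mathcal{M}}^j(G)\subseteq\mathcal{E}'+\mathcal{S}(G)$, and any $K\in\check{\mathcal{M}}^j(G)$ is smooth away from the origin. Further, if $K\in\check{\mathcal{M}}^j(G)$ is written as $K=\sum_{k=0}^\infty f_k$ with convergence in $\mathcal{S}'(G)$, where $f_k=2^{(j+Q)k}\,\varphi_k\circ\delta_{2^k}$, $\{\varphi_k\}_{k\ge0}\subseteq\mathcal{S}(G)$ is a bounded sequence, and $\varphi_k\in\mathcal{S}_o(G)$ for $k\ge1$, and if $\zeta\in C_c^\infty(G)$ equals $1$ in a neighborhood of $0$, then $$(1-\zeta)K=\sum_{k=0}^\infty(1-\zeta)f_k,$$ where the sum converges absolutely in $\mathcal{S}(G)$.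
   Context: A homogeneous group $G$ is a connected, simply connected nilpotent Lie group with underlying manifold $\mathbb{R}^n$ whose Lie algebra $\mathfrak{g}$ is endowed with a family of dilations $\{\delta_r\}_{r>0}$ (diagonalizable linear maps $\delta_r=\exp(A\log r)$, $A$ diagonalizable with positive eigenvalues) which are automorphisms of $\mathfrak{g}$. $G$ is identified with $\mathfrak{g}\cong\mathbb{R}^n$ by the exponential map, so that the group dilations are $\delta_r(x_1,\dots,x_n)=(r^{a_1}x_1,\dots,r^{a_n}x_n)$, with $1=a_1\le\dots\le a_n$. The homogeneous dimension is $Q=\sum_{i=1}^n a_i$. A homogeneous norm $|\cdot|:G\to[0,\infty)$ is fixed: it is continuous, smooth away from the origin, and satisfies $|x|=0$ iff $x$ is the identity, $|x^{-1}|=|x|$, and $|\delta_r(x)|=r|x|$ for $r>0$. For a multiindex $\alpha$, $|\alpha|=\sum_{i=1}^n a_i\alpha_i$ (weighted length). For $j\in\mathbb{R}$, $\mathcal{M}^j(G)$ is the space of $J\in C^\infty(G)$ such that for every multiindex $\alpha$ there is $C_\alpha>0$ with $|\partial^\alpha J(\xi)|\le C_\alpha(1+|\xi|)^{j-|\alpha|}$ for all $\xi$. $\check{\mathcal{M}}^j(G)=\{\check J:J\in\mathcal{M}^j(G)\}\subseteq\mathcal{S}'(G)$, where $\check{\ }$ is the Euclidean inverse Fourier transform on $\mathbb{R}^n$, $\check g(x)=\int e^{-2\pi i x\cdot\xi}g(\xi)\,d\xi$, extended to tempered distributions. $\mathcal{S}(G)$ is the usual Schwartz space on $G=\mathbb{R}^n$;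 ''bounded'' means bounded in every Schwartz norm; $\mathcal{S}_o(G)=\{f\in\mathcal{S}(G):\int x^\alpha f(x)\,dx=0\text{ for every multiindex }\alpha\}$. $\mathcal{E}'$ is the space of compactly supported distributions on $G$. Absolute convergence of a series in $\mathcal{S}(G)$ means that the series of its terms' norms converges for each Schwartz norm. *)

(* Defs.v *)
From HB Require Import structures.
From mathcomp Require Import all_boot all_order all_algebra.
From mathcomp Require Import complex.
From mathcomp Require Import all_classical all_reals all_analysis.
Set Implicit Arguments.
Unset Strict Implicit.
Unset Printing Implicit Defensive.
Import Order.TTheory GRing.Theory Num.Theory.
Import numFieldNormedType.Exports.
Local Open Scope classical_set_scope.
Local Open Scope ring_scope.
Local Open Scope complex_scope.

Notation normc := complex.ComplexField.Normc.normc.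

(* The library has no Lebesgue measure on R^n.  It is built on n.-tuple R, which
   carries the product sigma-algebra, as the image of the product of
   lebesgue_measure and the (n-1)-dimensional measure under (x, t) |-> x :: t;
   in dimension 0 it is the unit mass at the empty tuple. *)
Section lebesgue_cons.
Context (R : realType) (n : nat).
Notation mR := (measurableTypeR R).
Variable mu : {sigma_finite_measure set (n.-tuple mR) -> \bar R}.

Let tcons (p : mR * n.-tuple mR) : n.+1.-tuple mR := [tuple of p.1 :: p.2].

Let tuncons (t : n.+1.-tuple mR) : mR * n.-tuple mR :=
  (thead t, [tuple of behead t]).

Let measurable_tcons : measurable_fun setT tcons.
Proof. exact: measurable_cons. Qed.

Let measurable_tuncons : measurable_fun setT tuncons.
Proof.
apply/measurable_fun_pair; first exact: measurable_tnth.
exact: measurable_behead.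
Qed.

Definition lebesgue_cons : set (n.+1.-tuple mR) -> \bar R :=
  pushforward (lebesgue_measure \x mu)%E tcons.

Let prod : {measure set (mR * n.-tuple mR) -> \bar R} :=
  (lebesgue_measure \x mu)%E.

HB.instance Definition _ := Measure.copy lebesgue_cons
  (measure_function_pushforward__canonical__measure_function_Measure
     prod measurable_tcons).

Let lebesgue_cons_sigma_finite : sigma_finite setT lebesgue_cons.
Proof.
have /sigma_finiteP[F [TF ndF Foo]] :=
  sigma_finiteT (lebesgue_measure : {sigma_finite_measure set mR -> \bar R}).
have /sigma_finiteP[G [TG ndG Goo]] := sigma_finiteT mu.
exists (fun k => tuncons @^-1` (F k `*` G k)).
  apply/seteqP; split=> // t _.
  have : [set: mR] (tuncons t).1 by [].
  have : [set: n.-tuple mR] (tuncons t).2 by [].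
  rewrite TF TG => -[j _ Gj] [i _ Fi]; exists (maxn i j) => //; split.
    exact: (subsetPset _ _ (ndF _ _ (leq_maxl i j))).
  exact: (subsetPset _ _ (ndG _ _ (leq_maxr i j))).
move=> k; have [mF Fk] := Foo k; have [mG Gk] := Goo k; split.
  rewrite -[X in measurable X]setTI; apply: measurable_tuncons => //.
  exact: measurableX.
rewrite /lebesgue_cons /pushforward -comp_preimage.
have -> : tuncons \o tcons = id.
  by apply/funext => -[x t]; congr pair; exact/val_inj.
by rewrite preimage_id product_measure1E// lte_mul_pinfty// ge0_fin_numE.
Qed.

HB.instance Definition _ := Measure_isSigmaFinite.Build _ _ _ lebesgue_cons
  lebesgue_cons_sigma_finite.

End lebesgue_cons.

Fixpoint lebesgue_tuple (R : realType) (n : nat) :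
    {sigma_finite_measure set (n.-tuple (measurableTypeR R)) -> \bar R} :=
  if n is m.+1 then lebesgue_cons (lebesgue_tuple R m) else \d_[tuple].

Section analysis.
Context (R : realType) (d : nat).
Local Notation V := 'rV[R]_d.

Definition real_integral (f : V -> R) : R :=
  \int[lebesgue_tuple R d]_t f (\row_i tnth t i).

Definition integral_C (f : V -> R[i]) : R[i] :=
  real_integral (@complex.Re R \o f) +i* real_integral (@complex.Im R \o f).

Definition partial (i : 'I_d) (f : V -> R) : V -> R :=
  fun x => 'D_(delta_mx 0 i) f x.

Definition iter_partial (s : seq 'I_d) (f : V -> R) : V -> R :=
  foldr partial f s.

(* For open U: the iterated partial derivatives at a point of U depend only on
   f near that point, so the values of f outside U are irrelevant. *)
Definition smooth_on (U : set V) (f : V -> R) : Prop :=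
  forall (s : seq 'I_d) x, U x ->
    {for x, continuous (iter_partial s f)} /\
    forall i, derivable (iter_partial s f) x (delta_mx 0 i).

Definition smooth_on_C (U : set V) (f : V -> R[i]) : Prop :=
  smooth_on U (@complex.Re R \o f) /\ smooth_on U (@complex.Im R \o f).

Definition multiindex := {ffun 'I_d -> nat}.

Definition mpartial (al : multiindex) (f : V -> R) : V -> R :=
  iter_partial (flatten [seq nseq (al i) i | i <- enum 'I_d]) f.

Definition mpartial_C (al : multiindex) (f : V -> R[i]) : V -> R[i] :=
  fun x => mpartial al (@complex.Re R \o f) x +i* mpartial al (@complex.Im R \o f) x.

Definition monomial (al : multiindex) (x : V) : R :=
  \prod_(i < d) x 0 i ^+ al i.

(* An extended real, so that an unbounded set has supremum +oo. *)
Definition schwartz_norm (al be : multiindex) (f : V -> R[i]) : \bar R :=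
  ereal_sup (range (fun x => (`|monomial al x| * normc (mpartial_C be f x))%:E)).

Definition schwartz : set (V -> R[i]) :=
  [set f | smooth_on_C setT f /\
           forall al be, (schwartz_norm al be f < +oo)%E].

(* Schwartz functions with all moments zero. *)
Definition schwartz0 : set (V -> R[i]) :=
  [set f | schwartz f /\
           forall al, integral_C (fun x => (monomial al x)%:C * f x) = 0].

Definition schwartz_bounded (phi : nat -> V -> R[i]) : Prop :=
  (forall k, schwartz (phi k)) /\
  forall al be, exists M : R, forall k, (schwartz_norm al be (phi k) <= M%:E)%E.

Definition tsupport (f : V -> R[i]) : set V := closure [set x | f x != 0].

Definition test_function : set (V -> R[i]) :=
  [set f | smooth_on_C setT f /\ compact (tsupport f)].

(* A functional is a total function, but only its values on Schwartz functions
   are meaningful: equality in S' is eq_dist below, not Leibniz equality. *)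
Definition functional := (V -> R[i]) -> R[i].

Definition eq_dist (K L : functional) : Prop :=
  forall psi, schwartz psi -> K psi = L psi.

(* The second condition is continuity for the topology of the Schwartz norms. *)
Definition tempered : set functional :=
  [set K |
    (forall (c : R[i]) f g, schwartz f -> schwartz g ->
       K (fun x => c * f x + g x) = c * K f + K g) /\
    exists (C : R) (s : seq (multiindex * multiindex)),
      forall f, schwartz f ->
        ((normc (K f))%:E <= C%:E * \sum_(p <- s) schwartz_norm p.1 p.2 f)%E].

Definition dist_of (f : V -> R[i]) : functional :=
  fun psi => integral_C (fun x => f x * psi x).

Definition dist_mul (g : V -> R[i]) (K : functional) : functional :=
  fun psi => K (fun x => g x * psi x).

(* Pointwise (weak-star) convergence, which for sequences of tempered
   distributions is the same as strong convergence. *)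
Definition dist_cvg (T : nat -> functional) (K : functional) : Prop :=
  forall psi, schwartz psi ->
    (normc (T m psi - K psi) : R) @[m --> \oo] --> (0 : R).

Definition dist_series (f : nat -> V -> R[i]) (K : functional) : Prop :=
  dist_cvg (fun m psi => \sum_(k < m) dist_of (f k) psi) K.

(* The series of the h k converges absolutely in the Schwartz space and its sum,
   a Schwartz function, is the distribution T. *)
Definition schwartz_abs_series (h : nat -> V -> R[i]) (T : functional) : Prop :=
  [/\ forall k, schwartz (h k),
      forall al be, (\sum_(0 <= k <oo) schwartz_norm al be (h k) < +oo)%E &
      exists g, [/\ schwartz g,
        forall al be,
          schwartz_norm al be (fun x => \sum_(k < m) h k x - g x)
            @[m --> \oo] --> 0%E &
        eq_dist T (dist_of g)]].

Definition dist_support (K : functional) : set V :=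
  [set x | ~ exists U : set V, open_nbhs x U /\
     forall psi, test_function psi -> tsupport psi `<=` U -> K psi = 0].

(* Compactly supported distributions, regarded as elements of S'. *)
Definition compactly_supported : set functional :=
  [set E | tempered E /\ compact (dist_support E)].

(* K coincides with a smooth function on the complement of the origin. *)
Definition smooth_away_from_origin (K : functional) : Prop :=
  exists k : V -> R[i],
    smooth_on_C [set x | x != 0] k /\
    forall psi, test_function psi -> tsupport psi `<=` [set x | x != 0] ->
      K psi = dist_of k psi.

Definition dotp (x xi : V) : R := \sum_(i < d) x 0 i * xi 0 i.

(* exp(i t) *)
Definition cis (t : R) : R[i] := cos t +i* sin t.

Definition inv_fourier (g : V -> R[i]) : V -> R[i] :=
  fun x => integral_C (fun xi => cis (- (2 * pi * dotp x xi)) * g xi).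

Definition inv_fourier_dist (T : functional) : functional :=
  fun psi => T (inv_fourier psi).

Definition dilation (a : 'I_d -> R) (r : R) (x : V) : V :=
  \row_i (r `^ a i * x 0 i).

(* [x, y] = d/ds d/dt (exp(sx) exp(ty) exp(-sx)) at s = t = 0, when exp is the
   identity map. *)
Definition lie_bracket (mul : V -> V -> V) (inv : V -> V) (x y : V) : V :=
  derive1 (fun s : R =>
    derive1 (fun t : R => mul (mul (s *: x) (t *: y)) (inv (s *: x))) 0) 0.

End analysis.

Arguments schwartz {R d}.
Arguments schwartz0 {R d}.
Arguments test_function {R d}.
Arguments tempered {R d}.
Arguments compactly_supported {R d}.

(* The dimension is n.+1 because the first dilation exponent is normalized to 1.
   hg_mulZ says that the lines through 0 are the one-parameter subgroups, i.e.
   that the exponential map is the identity of R^(n.+1). *)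
Record homogeneous_group (R : realType) (n : nat) := HomogeneousGroup {
  hg_exponent : 'I_n.+1 -> R;
  hg_mul : 'rV[R]_n.+1 -> 'rV[R]_n.+1 -> 'rV[R]_n.+1;
  hg_inv : 'rV[R]_n.+1 -> 'rV[R]_n.+1;
  hg_exponent0 : hg_exponent ord0 = 1;
  hg_exponent_le : forall i k : 'I_n.+1, (i <= k)%N ->
    hg_exponent i <= hg_exponent k;
  hg_mulA : associative hg_mul;
  hg_mul0x : left_id 0 hg_mul;
  hg_mulVx : left_inverse 0 hg_inv hg_mul;
  hg_mul_smooth : forall i : 'I_n.+1, smooth_on setT
    (fun z : 'rV[R]_(n.+1 + n.+1) => hg_mul (lsubmx z) (rsubmx z) 0 i);
  hg_mulZ : forall (s t : R) x, hg_mul (s *: x) (t *: x) = (s + t) *: x;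
  hg_nilpotent : exists c : nat, forall x (s : seq 'rV[R]_n.+1), size s = c ->
    foldl (lie_bracket hg_mul hg_inv) x s = 0;
  hg_dilation_bracket : forall (r : R) x y, 0 < r ->
    dilation hg_exponent r (lie_bracket hg_mul hg_inv x y) =
    lie_bracket hg_mul hg_inv
      (dilation hg_exponent r x) (dilation hg_exponent r y)
}.

Section homogeneous.
Context (R : realType) (n : nat) (G : homogeneous_group R n).
Local Notation V := 'rV[R]_n.+1.

Definition delta (r : R) : V -> V := dilation (hg_exponent G) r.

Definition homogeneous_dim : R := \sum_(i < n.+1) hg_exponent G i.

Definition weighted_length (al : multiindex n.+1) : R :=
  \sum_(i < n.+1) hg_exponent G i * (al i)%:R.

Definition homogeneous_norm (N : V -> R) : Prop :=
  [/\ forall x, 0 <= N x,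
      continuous N /\ smooth_on [set x | x != 0] N,
      forall x, N x = 0 <-> x = 0,
      forall x, N (hg_inv G x) = N x &
      forall r x, 0 < r -> N (delta r x) = r * N x].

Definition multiplier (N : V -> R) (j : R) : set (V -> R[i]) :=
  [set J | smooth_on_C setT J /\
     forall al, exists2 C : R, 0 < C &
       forall xi, normc (mpartial_C al J xi) <=
                  C * (1 + N xi) `^ (j - weighted_length al)].

Definition multiplier_check (N : V -> R) (j : R) : set (functional R n.+1) :=
  [set K | tempered K /\ exists2 J, multiplier N j J &
     eq_dist K (inv_fourier_dist (dist_of J))].

Definition admissible (phi : nat -> V -> R[i]) : Prop :=
  schwartz_bounded phi /\ forall k, (1 <= k)%N -> schwartz0 (phi k).

Definition dyadic_piece (j : R) (phi : nat -> V -> R[i]) (k : nat) : V -> R[i] :=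
  fun x => (2 `^ ((j + homogeneous_dim) * k%:R))%:C * phi k (delta (2 ^+ k) x).

End homogeneous.

(* Main.v *)
(* Write K as the Fourier transform F J of its symbol.  With a cutoff chi, the functions
   Phi_0 = chi J and Phi_k = 2^(-jk) (chi - chi o delta_2) (J o delta_(2^k)) form a
   bounded sequence of Schwartz functions, those with k >= 1 vanish near 0, and
   J = sum_k 2^(jk) Phi_k o delta_(2^-k) because the cutoffs telescope.  Conversely such a
   sum is a symbol of order j as soon as the Phi_k are bounded in the Schwartz space and
   flat at 0 for k >= 1: with y = 2^-k N(xi), the k-th term is at most a constant times
   N(xi)^j y / (1 + y)^2, and these bounds have a bounded sum.  Fourier transformation
   turns flatness of Phi_k at 0 into vanishing of the moments of phi_k = F Phi_k, and
   2^(jk) Phi_k o delta_(2^-k) into f_k, which gives the characterization.  On the support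
   of 1 - zeta the rapid decay of phi_k at scale 2^-k beats every power of 2^k, so
   (1 - zeta) f_k is geometrically small in each Schwartz norm; the remaining claims
   follow from this by varying zeta.  Complex functions are treated through their real
   and imaginary parts, and F through the cosine and sine transforms. *)

Require Import Defs.
From mathcomp Require Import all_boot all_order all_algebra.
From mathcomp Require Import complex.
From mathcomp Require Import all_classical all_reals all_analysis.
From mathcomp Require Import ring lra.
From mathcomp Require Import measurable_realfun.
Import Order.TTheory GRing.Theory Num.Theory.
Import numFieldNormedType.Exports.
Set Implicit Arguments.
Unset Strict Implicit.
Unset Printing Implicit Defensive.
Local Open Scope classical_set_scope.
Local Open Scope ring_scope.

(** * Iterated partial derivatives *)

(** Smoothness is stated through iterated partial derivatives alone, so differentiation of series
    and integrals rests on one device: a remainder quadratic in the increment yields a directional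
    derivative ([is_derive_quad]), and quadratic remainders can be summed and integrated. Estimates
    are uniform over an index type, because boundedness of a sequence of Schwartz functions is both
    what is given and what is wanted; a single function is a family over [unit]. The anisotropic
    dilations leave only a crude comparison between the homogeneous norm and the sup norm
    ([norm_gauge]). It suffices because flatness at 0 and decay at infinity are available to every
    order. Fourier inversion is proved up to an unspecified factor. Dividing by it only requires
    that it is nonzero, which Parseval's identity shows, so no Gaussian integral is computed.
    Continuity of a functional on the Schwartz space is tested on bounded sequences ([temperedP]),
    so that it follows from the same uniform estimates. *)

Section lines.
Variables (R : realType) (V : normedModType R).
Implicit Types (f : V -> R) (x v : V).

Lemma line_growth_rate f x v t0 :
  (fun h : R => h^-1 *: (((fun t : R => f (x + t *: v)) \o shift t0) (h *: 1)
     - f (x + t0 *: v))) =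
  (fun h => h^-1 *: ((f \o shift (x + t0 *: v)) (h *: v) - f (x + t0 *: v))).
Proof.
apply/funext => h /=; congr (_ *: (f _ - _)).
by rewrite scalerDl -scalerA scale1r addrCA.
Qed.

(** Restriction to a line reduces directional derivatives to one variable, where the mean value
    theorem and the chain rule are available. *)
Lemma is_derive_line f x v (t0 l : R) :
  is_derive (x + t0 *: v) v f l <-> is_derive t0 1 (fun t => f (x + t *: v)) l.
Proof.
have E := line_growth_rate f x v t0.
by split => -[H1 H2]; split; move: H1 H2; rewrite /derivable /derive E.
Qed.

Lemma line_mvt f v x (t : R) : (forall y, derivable f y v) ->
  exists2 c, `|c| <= `|t| & f (x + t *: v) - f x = t * 'D_v f (x + c *: v).
Proof.
move=> df.
have D (u : R) : is_derive u 1 (fun t => f (x + t *: v)) ('D_v f (x + u *: v)).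
  exact/is_derive_line/derivableP.
have C : continuous (fun t : R => f (x + t *: v)).
  by move=> u; apply: differentiable_continuous; apply/derivable1_diffP; case: (D u).
have [t0|t0|->] := ltgtP t 0; last first.
- by exists 0; rewrite ?normr0// scale0r addr0 subrr mul0r.
- have [c /andP[c0 ct] E] := MVT t0 (fun u _ => D u) (continuous_subspaceT C).
  exists c; last by move: E; rewrite scale0r addr0 subr0 => ->; rewrite mulrC.
  by rewrite !gtr0_norm// ltW.
- have [c /andP[c0 ct] E] := MVT t0 (fun u _ => D u) (continuous_subspaceT C).
  exists c; first by rewrite !ltr0_norm// lerN2 ltW.
  by apply: oppr_inj; rewrite opprB -mulNr; move: E; rewrite scale0r addr0 sub0r => ->; rewrite mulrC.
Qed.

(** The difference quotient is within [C * |t|] of [l]. The derivatives of sums of series, of the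
    transforms [ft], and of [flat] at 0 are all obtained in this way, with no interchange of
    limits. *)
Lemma is_derive_quad f x v (l C dl : R) : 0 < dl ->
  (forall t, `|t| <= dl -> `|f (x + t *: v) - f x - t * l| <= C * t ^+ 2) ->
  is_derive x v f l.
Proof.
move=> dl0 H.
suff L : (fun h => h^-1 *: ((f \o shift x) (h *: v) - f x)) @ 0^' --> l.
  by split; [apply/cvg_ex; exists l|exact: cvg_lim].
apply/cvgrPdist_le => /= e e0.
have e'0 : 0 < e / (`|C| + 1) by rewrite divr_gt0// ltr_wpDl.
near=> h.
have h0 : h != 0 by near: h; exact: nbhs_dnbhs_neq.
have hd : `|h| <= dl.
  near: h; apply: dnbhs0_le; exact: dl0.
have := H _ hd; rewrite addrC => Hh.
rewrite distrC -[l](mulKf h0) -[_ *: _]/(_ * _) -mulrBr normrM normfV.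
rewrite ler_pdivrMl ?normr_gt0// addrC /=.
rewrite addrC in Hh; rewrite addrC [h *: v + x]addrC; apply: (le_trans Hh).
rewrite -[h ^+ 2]real_normK ?num_real// expr2 mulrCA ler_pM2l ?normr_gt0//.
apply: (le_trans (ler_norm _)); rewrite normrM normr_id.
have /(ler_wpM2l (normr_ge0 C)) : `|h| <= e / (`|C| + 1).
  by near: h; exact: dnbhs0_le.
by move=> /le_trans; apply; rewrite mulrA ler_pdivrMr ?ltr_wpDl// mulrC ler_wpM2l ?ltW// ltrDl.
Unshelve. all: by end_near. Qed.

End lines.

Section calculus.
Variables (R : realType) (d : nat).
Local Notation V := 'rV[R]_d.
Local Notation e_ i := (delta_mx 0 i : V).
Implicit Types (f g : V -> R) (x y v : V) (s : seq 'I_d).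

(** The mean value theorem is applied to [f] and then to its derivative; this loses only the factor
    1/2 of Taylor's formula. *)
Lemma line_taylor2 f i x (t C : R) :
  (forall y, derivable f y (e_ i)) -> (forall y, derivable (partial i f) y (e_ i)) ->
  (forall u, `|u| <= `|t| -> `|partial i (partial i f) (x + u *: e_ i)| <= C) ->
  `|f (x + t *: e_ i) - f x - t * partial i f x| <= C * t ^+ 2.
Proof.
move=> df ddf H.
have [c ct ->] := line_mvt x t df.
have [c' cc E] := line_mvt x c ddf.
rewrite -mulrBr -/(partial i f _) E !normrM -[t ^+ 2]real_normK ?num_real//.
rewrite expr2 [leRHS]mulrCA; apply: ler_wpM2l => //; rewrite mulrC; apply: ler_pM => //.
by apply: H; exact: le_trans cc ct.
Qed.

(** The corners of a path from [x] to [y] that changes one coordinate at a time: each leg is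
    parallel to an axis, so partial derivatives control the increment without total
    differentiability. *)
Definition mixture x y (m : nat) : V :=
  \row_i (if (i < m)%N then y 0 i else x 0 i).

Lemma le_coord_norm (x : V) (i : 'I_d) : `|x 0 i| <= `|x|.
Proof.
rewrite [leRHS]mx_normrE; apply: (le_trans _ (le_bigmax _ _ (0, i))) => //.
Qed.

Lemma norm_le_coord (x : V) (C : R) : 0 <= C -> (forall i, `|x 0 i| <= C) -> `|x| <= C.
Proof.
move=> C0 H; rewrite [leLHS]mx_normrE; apply/bigmax_leP; split => // -[i k] _ /=.
by rewrite (ord1 i).
Qed.

Lemma partial_lipschitz f x y (B : R) : (forall i z, derivable f z (e_ i)) ->
  (forall i z, `|z - x| <= `|y - x| -> `|partial i f z| <= B) ->
  `|f y - f x| <= d%:R * (B * `|y - x|).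
Proof.
move=> df HB.
suff H (m : nat) : (m <= d)%N -> `|f (mixture x y m) - f x| <= m%:R * (B * `|y - x|).
  have := H d (leqnn d); rewrite (_ : mixture x y d = y)//.
  by apply/rowP => i; rewrite mxE ltn_ord.
elim: m => [_|m IH md].
  rewrite mul0r (_ : mixture x y 0 = x) ?subrr ?normr0//.
  by apply/rowP => i; rewrite mxE.
have := IH (ltnW md); set z := mixture x y m => Hz.
pose i := Ordinal md.
have -> : mixture x y m.+1 = z + (y 0 i - x 0 i) *: e_ i.
  apply/rowP => k; rewrite !mxE eqxx /= ltnS.
  have [->|ki] := eqVneq k i.
    by rewrite /= leqnn ltnn mulr1 addrC subrK.
  rewrite mulr0 addr0 leq_eqVlt.
  by rewrite (_ : (k == m :> nat) = false)//; apply/eqP => km; move/eqP: ki; apply; apply/val_inj.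
have [c ct E] := line_mvt z (y 0 i - x 0 i) (df i).
have -> : f (z + (y 0 i - x 0 i) *: e_ i) - f x =
   (f (z + (y 0 i - x 0 i) *: e_ i) - f z) + (f z - f x) by rewrite addrA subrK.
rewrite E -[m.+1%:R]natr1 [leRHS]mulrDl mul1r [leRHS]addrC; apply: (le_trans (ler_normD _ _)).
apply: lerD => //; rewrite normrM mulrC ler_pM//.
  (* The mean value point has each coordinate within [|y - x|] of that of [x], which in the sup norm
     is all that [HB] asks. *)
  apply: HB; apply: norm_le_coord => // k; rewrite !mxE eqxx /=.
  have [->|ki] := eqVneq k i.
    rewrite ltnn mulr1 addrAC subrr add0r; apply: (le_trans ct).
    by have := le_coord_norm (y - x) i; rewrite !mxE.
  rewrite mulr0 addr0; case: ifP => _; last by rewrite subrr normr0.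
  by have := le_coord_norm (y - x) k; rewrite !mxE.
by have := le_coord_norm (y - x) i; rewrite !mxE.
Qed.

Lemma continuous_lipschitz f x (C dl : R) : 0 < dl ->
  (forall y, `|y - x| <= dl -> `|f y - f x| <= C * `|y - x|) -> {for x, continuous f}.
Proof.
move=> dl0 H; apply/(@cvgrPdist_le _ _ _ _ (nbhs_filter x)) => e e0.
have e'0 : 0 < e / (`|C| + 1) by rewrite divr_gt0// ltr_wpDl.
near=> y.
rewrite distrC; apply: le_trans (H _ _) _.
  rewrite distrC; near: y; exact: cvgr_dist_le.
apply: (le_trans (ler_norm _)); rewrite normrM normr_id.
have /(ler_wpM2l (normr_ge0 C)) : `|y - x| <= e / (`|C| + 1).
  by rewrite distrC; near: y; exact: cvgr_dist_le.
by move=> /le_trans; apply; rewrite mulrA ler_pdivrMr ?ltr_wpDl// mulrC ler_wpM2l ?ltW// ltrDl.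
Unshelve. all: by end_near. Qed.

Lemma partialE f i x l : is_derive x (e_ i) f l -> partial i f x = l.
Proof. by case. Qed.

Lemma derivable_partial f i x : derivable f x (e_ i) -> is_derive x (e_ i) f (partial i f x).
Proof. exact: derivableP. Qed.

Lemma partial_mvt f i x (t : R) : (forall y, derivable f y (e_ i)) ->
  exists2 c, `|c| <= `|t| & f (x + t *: e_ i) - f x = t * partial i f (x + c *: e_ i).
Proof. exact: line_mvt. Qed.

Lemma partial_cst (c : R) i : partial i ((fun=> c) : V -> R) = (fun=> 0).
Proof. by apply/funext => x; apply: derive_cst. Qed.

Lemma near_eq_partial f g i x : (\near x, f x = g x) -> partial i f x = partial i g x.
Proof. exact: near_eq_derive. Qed.

(* Unification and [done] must not unfold the limits in these definitions. *)
Opaque partial.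

(** Seals [smooth_on setT] behind an opaque proof, so that unification and [done] treat [smooth] as
    atomic; [smoothP] opens it. *)
Lemma smooth_key : {P : (V -> R) -> Prop | P = smooth_on setT}.
Proof. by exists (smooth_on setT). Qed.

Definition smooth f : Prop := sval smooth_key f.

Lemma smoothP f : smooth f <-> smooth_on setT f.
Proof. by rewrite /smooth; case: smooth_key => P /= ->. Qed.

Lemma smooth_continuous f : smooth f -> continuous f.
Proof. by move=> /smoothP sf x; have [] := sf [::] x I. Qed.

Lemma smooth_derivable f x i : smooth f -> derivable f x (e_ i).
Proof. by move=> /smoothP sf; have [_ ] := sf [::] x I. Qed.

Lemma iter_partial_rcons s i f : iter_partial (rcons s i) f = iter_partial s (partial i f).
Proof. by rewrite /iter_partial foldr_rcons. Qed.

Lemma iter_partial_cat s s' f : iter_partial (s ++ s') f = iter_partial s (iter_partial s' f).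
Proof. by rewrite /iter_partial foldr_cat. Qed.

Lemma smooth_partial f i : smooth f -> smooth (partial i f).
Proof. by move=> /smoothP sf; apply/smoothP => s x _; rewrite -iter_partial_rcons; apply: sf. Qed.

Lemma smooth_iter_partial s f : smooth f -> smooth (iter_partial s f).
Proof. by move=> sf; elim: s => [|i s IH]; [exact: sf|exact: smooth_partial]. Qed.

(** Smoothness is the largest property that implies continuity and partial derivability and is
    stable under partial derivatives. Each closure property below exhibits a class with this
    stability instead of a formula for higher derivatives. *)
Lemma smooth_coind (P : (V -> R) -> Prop) :
  (forall f, P f -> continuous f) ->
  (forall f x i, P f -> derivable f x (e_ i)) ->
  (forall f i, P f -> P (partial i f)) -> forall f, P f -> smooth f.
Proof.
move=> Pc Pd Pp f Pf; apply/smoothP => s x _.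
have Ps : P (iter_partial s f) by elim: s => //= i s IH; apply: Pp.
by split; [exact: Pc|move=> i; exact: Pd].
Qed.

Lemma smooth_is_derive f x i : smooth f -> is_derive x (e_ i) f (partial i f x).
Proof. by move=> sf; apply/derivable_partial/smooth_derivable. Qed.

Lemma partialD f g i : smooth f -> smooth g ->
  partial i (fun x => f x + g x) = (fun x => partial i f x + partial i g x).
Proof.
move=> sf sg; apply/funext => x; apply: partialE.
exact: (is_deriveD (smooth_is_derive x i sf) (smooth_is_derive x i sg)).
Qed.

Lemma partialM f g i : smooth f -> smooth g ->
  partial i (fun x => f x * g x) = (fun x => partial i f x * g x + f x * partial i g x).
Proof.
move=> sf sg; apply/funext => x; apply: partialE.
apply: is_derive_eq; first exact: (is_deriveM (smooth_is_derive x i sf) (smooth_is_derive x i sg)).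
by rewrite /= addrC [_ *: partial i f x]mulrC.
Qed.

Lemma smoothD f g : smooth f -> smooth g -> smooth (fun x => f x + g x).
Proof.
move=> sf sg.
pose P h := exists f g : V -> R, [/\ smooth f, smooth g & h = fun x => f x + g x].
apply: (@smooth_coind P); last by exists f, g.
- move=> _ [f1 [g1 [sf1 sg1 ->]]] x.
  by apply: continuousD; exact: smooth_continuous.
- move=> _ x i [f1 [g1 [sf1 sg1 ->]]].
  by apply: derivableD; exact: smooth_derivable.
- move=> _ i [f1 [g1 [sf1 sg1 ->]]]; rewrite partialD//.
  by exists (partial i f1), (partial i g1); split => //; exact: smooth_partial.
Qed.

Lemma smooth_cst (c : R) : smooth (fun=> c).
Proof.
apply: (@smooth_coind (fun f => exists c, f = fun=> c)); last by exists c.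
- by move=> _ [a ->]; exact: cst_continuous.
- by move=> _ x i [a ->]; exact: derivable_cst.
- by move=> _ i [a ->]; exists 0; exact: partial_cst.
Qed.

Lemma is_derive_coord i k x : is_derive x (e_ i) (fun x : V => x 0 k) (i == k)%:R.
Proof.
apply: (@is_derive_quad _ _ (fun x : V => x 0 k) x (e_ i) _ 0 1) => // t _.
rewrite !mxE eqxx /= [k == i]eq_sym (_ : _ - _ = 0) ?normr0 ?mul0r//; ring.
Qed.

Lemma partial_coord i k : partial i (fun x : V => x 0 k) = (fun=> (i == k)%:R).
Proof. by apply/funext => x; apply: partialE; exact: is_derive_coord. Qed.

Lemma smooth_coord k : smooth (fun x : V => x 0 k).
Proof.
apply: (@smooth_coind (fun f => smooth f \/ f = fun x : V => x 0 k)); last by right.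
- by move=> f [/smooth_continuous//|->] x; exact: coord_continuous.
- by move=> f x i [/smooth_derivable//|->]; case: (is_derive_coord i k x).
- move=> f i [/smooth_partial ?|->]; left => //.
  by rewrite partial_coord; exact: smooth_cst.
Qed.

Lemma is_derive_comp (u : R -> R) (p : V -> R) x v a b :
  is_derive (p x) 1 u a -> is_derive x v p b ->
  is_derive x v (fun x => u (p x)) (a * b).
Proof.
move=> du dp.
have -> : x = x + 0 *: v by rewrite scale0r addr0.
apply/is_derive_line.
have dp' : is_derive (0 : R) 1 (fun t => p (x + t *: v)) b.
  by apply/(is_derive_line p x v); rewrite scale0r addr0.
have du' : is_derive ((fun t => p (x + t *: v)) (0 : R)) 1 u a by rewrite /= scale0r addr0.
exact: (is_derive1_comp du' dp').
Qed.

(** The derivative of a product is a sum of two products, so the stable class has to be closed under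
    sums. *)
Inductive prod_class : (V -> R) -> Prop :=
| Prod_term f g : smooth f -> smooth g -> prod_class (fun x => f x * g x)
| Prod_add f g : prod_class f -> prod_class g -> prod_class (fun x => f x + g x).

Lemma smoothM f g : smooth f -> smooth g -> smooth (fun x => f x * g x).
Proof.
move=> sf sg.
have X h i x : prod_class h -> derivable h x (e_ i).
  elim=> [f1 g1 s1 s2|f1 g1 _ H1 _ H2]; last exact: derivableD.
  by apply: derivableM; exact: smooth_derivable.
apply: (@smooth_coind prod_class); last exact: Prod_term.
- move=> h; elim=> [f1 g1 s1 s2 x|f1 g1 _ H1 _ H2 x]; last first.
    by apply: continuousD; [exact: H1|exact: H2].
  by apply: continuousM; exact: smooth_continuous.
- by move=> h x i /X.
- move=> h i; elim=> [f1 g1 s1 s2|f1 g1 C1 H1 C2 H2].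
    rewrite partialM//; apply: Prod_add; apply: Prod_term => //; exact: smooth_partial.
  rewrite (_ : partial _ _ = (fun x => partial i f1 x + partial i g1 x)).
    exact: Prod_add.
  apply/funext => x; apply: partialE.
  by apply: is_deriveD; apply/derivable_partial/X.
Qed.

(** Here [u k] stands for the k-th derivative of [u 0]. Sums of terms [u k (p x) * g x] are stable
    under differentiation, which replaces the formula of Faa di Bruno. *)
Inductive comp_class (u : nat -> R -> R) (p : V -> R) : (V -> R) -> Prop :=
| Comp_term k g : smooth g -> comp_class u p (fun x => u k (p x) * g x)
| Comp_add f g : comp_class u p f -> comp_class u p g ->
    comp_class u p (fun x => f x + g x).

Lemma smooth_comp (u : nat -> R -> R) (p : V -> R) : smooth p ->
  (forall k x, is_derive (p x) 1 (u k) (u k.+1 (p x))) ->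
  smooth (fun x => u 0%N (p x)).
Proof.
move=> sp du.
have T k g x i : smooth g -> is_derive x (e_ i) (fun x => u k (p x) * g x)
    (u k.+1 (p x) * (partial i p x * g x) + u k (p x) * partial i g x).
  move=> sg; apply: is_derive_eq.
    apply: is_deriveM.
      exact: (is_derive_comp (du k x) (smooth_is_derive x i sp)).
    exact: smooth_is_derive.
  rewrite /= addrC; congr (_ + _).
  by rewrite [LHS]mulrC mulrA.
have X f i x : comp_class u p f -> derivable f x (e_ i).
  elim=> [k g sg|f1 g1 _ H1 _ H2]; first by case: (T k g x i sg).
  exact: derivableD.
apply: (@smooth_coind (comp_class u p)).
- move=> f; elim=> [k g sg x|f1 g1 _ H1 _ H2 x]; last first.
    by apply: continuousD; [exact: H1|exact: H2].
  apply: continuousM; last exact: smooth_continuous.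
  apply: continuous_comp; first exact: smooth_continuous.
  by apply: differentiable_continuous; apply/derivable1_diffP; case: (du k x).
- by move=> f x i /X.
- move=> f i; elim=> [k g sg|f1 g1 C1 H1 C2 H2].
    rewrite (_ : partial _ _ = (fun x => u k.+1 (p x) * (partial i p x * g x) +
       u k (p x) * partial i g x)); last first.
      by apply/funext => x; apply: partialE; exact: T.
    apply: Comp_add; last by apply: Comp_term; exact: smooth_partial.
    by apply: (@Comp_term u p k.+1 (fun x => partial i p x * g x)); apply: smoothM => //; exact: smooth_partial.
  rewrite (_ : partial _ _ = (fun x => partial i f1 x + partial i g1 x)).
    exact: Comp_add.
  apply/funext => x; apply: partialE.
  by apply: is_deriveD; apply/derivable_partial/X.
- rewrite (_ : (fun x => _) = (fun x => u 0%N (p x) * 1)).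
    by apply: Comp_term; exact: smooth_cst.
  by apply/funext => x; rewrite mulr1.
Qed.
Lemma iter_partialD s f g : smooth f -> smooth g ->
  iter_partial s (fun x => f x + g x) = (fun x => iter_partial s f x + iter_partial s g x).
Proof.
move=> sf sg; elim: s => [//|i s IH] /=.
by rewrite IH partialD//; exact: smooth_iter_partial.
Qed.

Lemma iter_partial_cst s (c : R) : s != [::] -> iter_partial s (fun=> c) = (fun=> 0).
Proof.
elim: s => [//|i [|k s] IH] _; first exact: partial_cst.
by rewrite -cat1s iter_partial_cat IH//; exact: partial_cst.
Qed.

Lemma smoothZ (c : R) f : smooth f -> smooth (fun x => c * f x).
Proof. by move=> sf; apply: smoothM => //; exact: smooth_cst. Qed.

Lemma partialZ (c : R) f i : smooth f -> partial i (fun x => c * f x) = (fun x => c * partial i f x).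
Proof.
move=> sf; rewrite partialM//; last exact: smooth_cst.
by rewrite partial_cst; apply/funext => x; rewrite mul0r add0r.
Qed.

Lemma iter_partialZ s (c : R) f : smooth f ->
  iter_partial s (fun x => c * f x) = (fun x => c * iter_partial s f x).
Proof.
move=> sf; elim: s => [//|i s IH] /=.
by rewrite IH partialZ//; exact: smooth_iter_partial.
Qed.

Lemma smoothN f : smooth f -> smooth (fun x => - f x).
Proof.
move=> sf; rewrite (_ : (fun x => _) = fun x => (-1) * f x); first exact: smoothZ.
by apply/funext => x; rewrite mulN1r.
Qed.

Lemma smoothB f g : smooth f -> smooth g -> smooth (fun x => f x - g x).
Proof. by move=> sf sg; apply: smoothD => //; exact: smoothN. Qed.

Lemma iter_partialN s f : smooth f ->
  iter_partial s (fun x => - f x) = (fun x => - iter_partial s f x).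
Proof.
move=> sf; rewrite (_ : (fun x => - _) = fun x => (-1) * f x) ?iter_partialZ//.
  by apply/funext => x; rewrite mulN1r.
by apply/funext => x; rewrite mulN1r.
Qed.

Lemma iter_partialB s f g : smooth f -> smooth g ->
  iter_partial s (fun x => f x - g x) = (fun x => iter_partial s f x - iter_partial s g x).
Proof.
by move=> sf sg; rewrite iter_partialD ?iter_partialN//; exact: smoothN.
Qed.

Lemma smooth_sum (I : Type) (r : seq I) (F : I -> V -> R) :
  (forall k, smooth (F k)) -> smooth (fun x => \sum_(k <- r) F k x).
Proof.
move=> sF; elim: r => [|k r IH].
  by under eq_fun do rewrite big_nil; exact: smooth_cst.
by under eq_fun do rewrite big_cons; exact: smoothD.
Qed.

Lemma iter_partial_sum (I : Type) (r : seq I) (F : I -> V -> R) s :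
  (forall k, smooth (F k)) ->
  iter_partial s (fun x => \sum_(k <- r) F k x) = (fun x => \sum_(k <- r) iter_partial s (F k) x).
Proof.
move=> sF; elim: r => [|k r IH].
  under eq_fun do rewrite big_nil; under [RHS]eq_fun do rewrite big_nil.
  by case: s => [//|i s]; rewrite iter_partial_cst.
under eq_fun do rewrite big_cons; under [RHS]eq_fun do rewrite big_cons.
by rewrite iter_partialD ?IH//; exact: smooth_sum.
Qed.

Lemma smoothX f n : smooth f -> smooth (fun x => f x ^+ n).
Proof.
move=> sf; elim: n => [|n IH].
  by under eq_fun do rewrite expr0; exact: smooth_cst.
by under eq_fun do rewrite exprS; exact: smoothM.
Qed.

Lemma smoothV f : smooth f -> (forall x, 0 < f x) -> smooth (fun x => (f x)^-1).
Proof.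
move=> sf f0.
(* The k-th derivative of the inverse function. *)
pose u k (y : R) := (-1) ^+ k * (k`!)%:R * y ^- k.+1.
rewrite (_ : (fun x => _) = fun x => u 0%N (f x)).
  apply: smooth_comp => // k x.
  have fx0 : f x != 0 by rewrite gt_eqF.
  have -> : u k = fun y : R => ((-1) ^+ k * (k`!)%:R) *: (y ^+ k.+1)^-1 by [].
  have D : is_derive (f x) 1 (fun y : R => y ^+ k.+1) (k.+1%:R * f x ^+ k).
    by split; [exact: exprn_derivable|rewrite exp_derive /GRing.scale/= mulr1].
  apply: is_derive_eq.
    by apply: is_deriveZ; apply: (is_deriveV _ D); exact: expf_neq0.
  rewrite /u /GRing.scale/= factS natrM !exprS; field.
  by rewrite fx0 expf_neq0.
by apply/funext => x; rewrite /u expr0 fact0 !mul1r expr1.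
Qed.

(** One map for dilations ([b = 0]), translations ([c] constant 1) and the reflection through 0 ([c]
    constant -1). *)
Definition affine (c b x : V) : V := \row_i (c 0 i * x 0 i + b 0 i).

Lemma affine_line c b x i (t : R) :
  affine c b (x + t *: e_ i) = affine c b x + (c 0 i * t) *: e_ i.
Proof.
apply/rowP => k; rewrite !mxE eqxx /=; have [->|_] := eqVneq k i; rewrite /=; ring.
Qed.

Lemma is_derive_affine f c b x i l : is_derive (affine c b x) (e_ i) f l ->
  is_derive x (e_ i) (fun x => f (affine c b x)) (c 0 i * l).
Proof.
move=> df.
have -> : x = x + 0 *: e_ i by rewrite scale0r addr0.
apply/(is_derive_line (fun x => f (affine c b x)) x (e_ i)).
under eq_fun do rewrite affine_line.
have D1 : is_derive (0 : R) 1 (fun t : R => c 0 i * t) (c 0 i).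
  by apply: is_derive_eq; rewrite /GRing.scale/= !mulr1.
have D2 : is_derive ((fun t : R => c 0 i * t) 0) 1
    (fun t => f (affine c b x + t *: e_ i)) l.
  by apply/(is_derive_line f (affine c b x) (e_ i)); rewrite /= mulr0 scale0r addr0.
rewrite mulrC; exact: (is_derive1_comp D2 D1).
Qed.

Lemma partial_affine f c b i : smooth f ->
  partial i (fun x => f (affine c b x)) = (fun x => c 0 i * partial i f (affine c b x)).
Proof.
move=> sf; apply/funext => x; apply: partialE.
by apply: is_derive_affine; exact: smooth_is_derive.
Qed.

Lemma continuous_affine c b : continuous (affine c b).
Proof.
move=> x; apply/(@cvgrPdist_le _ _ _ _ (nbhs_filter x)) => e e0.
have e'0 : 0 < e / (`|c| + 1) by rewrite divr_gt0// ltr_wpDl.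
near=> y; apply: norm_le_coord; first exact: ltW.
move=> i; rewrite !mxE (_ : _ - _ = c 0 i * (x - y) 0 i); last by rewrite !mxE; ring.
rewrite normrM; apply: (@le_trans _ _ (`|c| * `|x - y|)).
  by apply: ler_pM => //; exact: le_coord_norm.
have /(ler_wpM2l (normr_ge0 c)) : `|x - y| <= e / (`|c| + 1).
  by near: y; exact: cvgr_dist_le.
by move=> /le_trans; apply; rewrite mulrA ler_pdivrMr ?ltr_wpDl// mulrC ler_wpM2l ?ltW// ltrDl.
Unshelve. all: by end_near. Qed.

Lemma smooth_affine f c b : smooth f -> smooth (fun x => f (affine c b x)).
Proof.
move=> sf.
apply: (@smooth_coind (fun h => exists (a : R) f, smooth f /\ h = fun x => a * f (affine c b x))).
- move=> _ [a [g [sg ->]]] x; apply: continuousM; first exact: cst_continuous.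
  apply: continuous_comp; first exact: continuous_affine.
  exact: smooth_continuous.
- move=> _ x i [a [g [sg ->]]]; apply: derivableM; first exact: derivable_cst.
  by case: (is_derive_affine (smooth_is_derive (affine c b x) i sg)).
- move=> _ i [a [g [sg ->]]]; exists (a * c 0 i), (partial i g); split.
    exact: smooth_partial.
  apply/funext => x; apply: partialE; apply: is_derive_eq.
    apply: is_deriveM.
    by apply: is_derive_affine; exact: smooth_is_derive.
  rewrite /GRing.scale/=; ring.
- by exists 1, f; split => //; apply/funext => x; rewrite mul1r.
Qed.

Lemma iter_partial_affine s f c b : smooth f ->
  iter_partial s (fun x => f (affine c b x)) =
  (fun x => (\prod_(i <- s) c 0 i) * iter_partial s f (affine c b x)).
Proof.
move=> sf; elim: s => [|i s IH]; first by apply/funext => x; rewrite big_nil mul1r.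
rewrite /= IH partialZ; last by apply: smooth_affine; exact: smooth_iter_partial.
rewrite partial_affine; last exact: smooth_iter_partial.
by apply/funext => x; rewrite big_cons; ring.
Qed.

(** The increment of [f] along [e_k] is varied along [e_i] by the mean value theorem, and what
    results is varied along [e_k] by the same theorem. *)
Lemma rectangle_mvt f i k x (h : R) : smooth f ->
  exists2 y, `|y - x| <= 2 * `|h| &
  f (x + h *: e_ i + h *: e_ k) - f (x + h *: e_ i) - f (x + h *: e_ k) + f x =
    h ^+ 2 * partial k (partial i f) y.
Proof.
move=> sf.
pose b := h *: e_ k.
pose g y := f (affine (const_mx 1) b y) - f y.
have bE y : affine (const_mx 1) b y = y + b by apply/rowP => l; rewrite !mxE mul1r.
have sg : smooth g by apply: smoothB => //; exact: smooth_affine.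
have [c ch] := @partial_mvt g i x h (fun y => @smooth_derivable g y i sg).
have -> : partial i g (x + c *: e_ i) =
    partial i f (x + c *: e_ i + h *: e_ k) - partial i f (x + c *: e_ i).
  have := iter_partialB [:: i] (@smooth_affine f (const_mx 1) b sf) sf => /= ->.
  by rewrite partial_affine// mxE mul1r bE.
have [c' c'h ->] := @partial_mvt _ k (x + c *: e_ i) h
  (fun y => @smooth_derivable _ y k (smooth_partial i sf)).
rewrite /g !bE mulrA -expr2 => E.
exists (x + c *: e_ i + c' *: e_ k).
  apply: norm_le_coord; first by rewrite mulr_ge0.
  move=> l; rewrite !mxE eqxx /= (_ : _ - _ = c * (l == i)%:R + c' * (l == k)%:R); last by ring.
  rewrite mulr_natl mulr2n; apply: le_trans (ler_normD _ _) _; rewrite !normrM.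
  by apply: lerD; case: (_ == _); rewrite ?normr1 ?normr0 ?mulr1 ?mulr0.
by rewrite -E /b addrAC opprB addrA [in RHS]addrAC addrAC.
Qed.

(** The second difference over a square does not depend on the order of its sides, so the two mixed
    derivatives take a common value at two points near [x]; their continuity does the rest. *)
Lemma partialC f i k : smooth f -> partial i (partial k f) = partial k (partial i f).
Proof.
move=> sf; apply/funext => x; apply/eqP; rewrite -subr_eq0 -normr_le0.
apply/ler_addgt0Pr => e e0; rewrite add0r.
have e20 : 0 < e / 2 by rewrite divr_gt0.
have C a b : \forall y \near x,
    `|partial a (partial b f) x - partial a (partial b f) y| <= e / 2.
  have := smooth_continuous (smooth_partial a (smooth_partial b sf)) (x := x).
  by move=> /(@cvgrPdist_le _ _ _ _ (nbhs_filter x)); apply.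
have : nbhs x [set y |
    `|partial i (partial k f) x - partial i (partial k f) y| <= e / 2 /\
    `|partial k (partial i f) x - partial k (partial i f) y| <= e / 2].
  by apply: filterI; exact: C.
move=> /nbhs_ballP[r /= r0 Hr].
(* The points given by [rectangle_mvt] are within 2 h of [x], which must stay below [r]. *)
pose h := r / 3.
have h0 : 0 < h by rewrite divr_gt0.
have H y : `|y - x| <= 2 * `|h| -> ball x r y.
  rewrite mx_norm_ball /ball_/= distrC => /le_lt_trans; apply.
  by rewrite gtr0_norm// /h; lra.
have [y1 /H/Hr[_ Y1] E1] := rectangle_mvt i k x h sf.
have [y2 /H/Hr[Y2 _] E2] := rectangle_mvt k i x h sf.
have E : partial k (partial i f) y1 = partial i (partial k f) y2.
  apply: (@mulfI _ (h ^+ 2)); first by rewrite expf_neq0// gt_eqF.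
  have A (a b c a' u v : R) : a - b - c + a' = u -> a - c - b + a' = v -> u = v.
    by move=> <- <-; ring.
  by apply: A E1 _; rewrite -E2 (addrAC x (h *: e_ k)).
move: Y1 Y2; rewrite E; move: (partial i (partial k f) x) (partial k (partial i f) x) (partial i _ y2).
move=> a b c bc ac; rewrite (splitr e) (_ : a - b = (a - c) - (b - c)); last by ring.
exact: le_trans (ler_normB _ _) (lerD _ _).
Qed.

Lemma iter_partial_move s t i f : smooth f ->
  iter_partial (s ++ i :: t) f = iter_partial (i :: s ++ t) f.
Proof.
move=> sf; elim: s => [//|k s IH] /=; rewrite IH /=.
by rewrite partialC//; exact: smooth_iter_partial.
Qed.

Lemma iter_partial_perm s t f : smooth f -> perm_eq s t -> iter_partial s f = iter_partial t f.
Proof.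
move=> sf; elim: s t => [|i s IH] t st.
  by move: st; rewrite perm_sym => /perm_nilP ->.
have it : i \in t by rewrite -(perm_mem st) mem_head.
case/splitPr: it st => t1 t2 st.
rewrite iter_partial_move//= (IH (t1 ++ t2))//.
by move: st; rewrite perm_sym -cat1s perm_catCA perm_cons perm_sym.
Qed.

Definition multi s : multiindex d := [ffun i => count_mem i s].

Lemma count_flatten_nseq (al : multiindex d) i :
  count_mem i (flatten [seq nseq (al k) k | k <- enum 'I_d]) = al i.
Proof.
rewrite count_flatten -map_comp sumnE big_map -[LHS]/(\sum_(k <- enum 'I_d) _)%N big_enum/=.
rewrite (bigD1 i)//= count_nseq /= eqxx mul1n big1 ?addn0// => k ki.
by rewrite count_nseq /= (negbTE ki).
Qed.

(** Multiindices are traded for lists of directions, which suit induction; by symmetry of mixed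
    derivatives only the multiplicities in the list matter. *)
Lemma mpartialE s f : smooth f -> mpartial (multi s) f = iter_partial s f.
Proof.
move=> sf; apply: iter_partial_perm => //; apply/allP => i _ /=.
by rewrite count_flatten_nseq ffunE.
Qed.

Lemma near_eq_iter_partial f g s x : (\near x, f x = g x) ->
  \near x, iter_partial s f x = iter_partial s g x.
Proof.
move=> fg; elim: s => [//|i s IH] /=.
by move/near_join: IH; apply: filterS => y; exact: near_eq_partial.
Qed.

End calculus.

(** * Cutoffs, bounded families of Schwartz functions, geometric series *)

Lemma finite_choice (R : realType) (I : finType) (P : I -> R -> Prop) :
  (forall i C C', C <= C' -> P i C -> P i C') -> (forall i, exists C, P i C) ->
  exists C : R, forall i, P i C.
Proof.
move=> mono /choice[c Hc]; exists (\sum_i `|c i|) => i.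
apply: mono (Hc i); rewrite (bigD1 i)//=; apply: (le_trans (ler_norm _)).
by rewrite lerDl sumr_ge0.
Qed.

Section geometric.
Variable R : realType.
Implicit Types (a b : nat -> R) (C : R).

Definition gsum a : R := limn (series a).

Lemma geo_partial (m n : nat) : (m <= n)%N ->
  \sum_(m <= k < n) (2^-1 : R) ^+ k <= 2 * 2^-1 ^+ m.
Proof.
move=> mn; rewrite -(subnKC mn) geometric_partial_tail mulrC.
have E : (2 : R) = (1 - 2^-1)^-1 by field.
rewrite [X in _ <= _ * X]E.
by apply: geometric_le_lim; rewrite ?exprn_ge0 ?invr_gt0 ?invr_ge0// ger0_norm ?invr_ge0//; lra.
Qed.

Lemma geo_cvg a C : (forall k, `|a k| <= C * 2^-1 ^+ k) -> cvgn (series a).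
Proof.
move=> aC; apply: normed_cvg.
apply: (@series_le_cvg _ _ (geometric C 2^-1)) => //.
- by move=> n /=.
- by move=> n; exact: le_trans (normr_ge0 _) (aC n).
- by apply: is_cvg_geometric_series; rewrite ger0_norm ?invr_ge0//; lra.
Qed.

Lemma geo_tail a C m : (forall k, `|a k| <= C * 2^-1 ^+ k) ->
  `|gsum a - \sum_(k < m) a k| <= 2 * C * 2^-1 ^+ m.
Proof.
move=> aC; have ca := geo_cvg aC.
have C0 : 0 <= C by have := le_trans (normr_ge0 _) (aC 0%N); rewrite expr0 mulr1.
have cb : (fun n => `|series a n - \sum_(k < m) a k|) @ \oo --> `|gsum a - \sum_(k < m) a k|.
  by apply: cvg_norm; apply: cvgB => //; exact: cvg_cst.
apply: (cvgr_to_le cb); near=> n.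
have mn : (m <= n)%N by near: n; exact: nbhs_infty_ge.
rewrite /series /= -(big_mkord xpredT) (big_cat_nat (n := m))//= [X in `|X|]addrAC subrr add0r.
apply: (le_trans (ler_norm_sum _ _ _)).
apply: (@le_trans _ _ (\sum_(m <= k < n) C * 2^-1 ^+ k)); first exact: ler_sum.
by rewrite -mulr_sumr -mulrA mulrCA ler_wpM2l// geo_partial.
Unshelve. all: by end_near. Qed.

Lemma geo_cvgn a C : (forall k, `|a k| <= C * 2^-1 ^+ k) ->
  (fun m => \sum_(k < m) a k) @ \oo --> gsum a.
Proof.
move=> /geo_cvg; rewrite /gsum (_ : series a = fun m => \sum_(k < m) a k)//.
by apply/funext => m; rewrite /series/= big_mkord.
Qed.

Lemma geo_le a C : (forall k, `|a k| <= C * 2^-1 ^+ k) -> `|gsum a| <= 2 * C.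
Proof.
by move=> /(geo_tail 0); rewrite big_ord0 subr0 expr0 mulr1.
Qed.

Lemma gsum_linear a b c C C' t u : (forall k, `|a k| <= C * 2^-1 ^+ k) ->
  (forall k, `|b k| <= C' * 2^-1 ^+ k) ->
  (forall k, c k = t * a k + u * b k) -> gsum c = t * gsum a + u * gsum b.
Proof.
move=> aC bC cE; apply: cvg_lim => //.
rewrite (_ : series c = (fun m => t * series a m + u * series b m)); last first.
  by apply/funext => m; rewrite /series/= 2!mulr_sumr -big_split/=; apply: eq_bigr.
by apply: cvgD; apply: cvgM; [exact: cvg_cst|exact: geo_cvg aC|exact: cvg_cst|exact: geo_cvg bC].
Qed.

End geometric.

(** * The smooth function that is flat at 0, and its derivatives *)

Section flat_function.
Variable R : realType.

(** With y = 1/x one has d/dx = - y^2 d/dy, which maps p(y) exp(-y) to y^2 (p - p')(y) exp(-y). *)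
Fixpoint flat_poly (k : nat) : {poly R} :=
  if k is k'.+1 then 'X^2 * (flat_poly k' - (flat_poly k')^`()) else 1.

(* The k-th derivative of the function equal to exp (-1/x) for x > 0 and to 0 for
   x <= 0. *)
Definition flat (k : nat) (x : R) : R :=
  if 0 < x then (flat_poly k).[x^-1] * expR (- x^-1) else 0.

Lemma poly_growth (p : {poly R}) : exists C : R, forall y : R, 1 <= y -> `|p.[y]| <= C * y ^+ size p.
Proof.
exists (\sum_(i < size p) `|p`_i|) => y y1.
rewrite horner_coef mulr_suml; apply: (le_trans (ler_norm_sum _ _ _)).
apply: ler_sum => i _; rewrite normrM ler_wpM2l// normrX ger0_norm ?(le_trans ler01)//.
by rewrite ler_weXn2l// ltnW.
Qed.

Lemma flat_quad k : exists C : R, forall t, `|t| <= 1 -> `|flat k t| <= C * t ^+ 2.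
Proof.
have [C HC] := poly_growth (flat_poly k).
set n := size (flat_poly k) in HC.
have C0 : 0 <= C by have := le_trans (normr_ge0 _) (HC 1 (lexx _)); rewrite expr1n mulr1.
(* The factorial is that of the term of degree n + 2 of the exponential series at 1/t: two degrees
   beyond the polynomial, which leaves t^2. *)
exists (C * (n.+2)`!%:R) => t t1; rewrite /flat; case: ifPn => [t0|_]; last first.
  by rewrite normr0 mulr_ge0 ?sqr_ge0// mulr_ge0.
have y1 : 1 <= t^-1 by rewrite invf_ge1//; rewrite gtr0_norm in t1.
set y := t^-1 in y1 *; have y0 : 0 < y by rewrite invr_gt0.
rewrite normrM [`|expR _|]ger0_norm ?expR_ge0// expRN.
have E : y ^+ n.+2 / (n.+2)`!%:R <= expR y.
  by apply: le_trans (expR_ge1Dxn n.+1 (ltW y0)); rewrite lerDr.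
have F0 : 0 < (n.+2)`!%:R :> R by rewrite ltr0n fact_gt0.
rewrite ler_pdivrMr ?expR_gt0//; apply: (le_trans (HC _ y1)).
rewrite -[leRHS]mulrA -[leRHS]mulrA; apply: ler_wpM2l => //.
rewrite ler_pdivrMr// in E.
have -> : y ^+ n = t ^+ 2 * y ^+ n.+2.
  by rewrite -[n.+2]addn2 exprD mulrCA -exprMn /y mulfV ?gt_eqF// expr1n mulr1.
move: (sqr_ge0 t); move: (t ^+ 2) => T T0; rewrite [leRHS]mulrCA.
by rewrite ler_wpM2l// mulrC.
Qed.

Lemma is_derive_flat k (x : R) : is_derive x 1 (flat k) (flat k.+1 x).
Proof.
have [x0|x0|->] := ltgtP x 0.
- apply: (@near_eq_is_derive _ _ _ (cst 0)).
    near=> y; rewrite /flat ifN// -leNgt; near: y.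
    by apply: filterS (lt_nbhsl x0) => y /ltW.
  by rewrite /flat ifN ?(le_gtF (ltW x0))//; exact: is_derive_cst.
- apply: (near_eq_is_derive (f := fun y : R => (flat_poly k).[y^-1] * expR (- y^-1))).
    near=> y; rewrite /flat ifT//; near: y; exact: lt_nbhsr.
  have xn : x != 0 by rewrite gt_eqF.
  have D1 : is_derive x 1 (fun y : R => y^-1) (- x ^- 2).
    by apply: is_derive_eq; first exact: (is_deriveV xn (is_derive_id _ _)); rewrite /GRing.scale/= mulr1.
  have D2 : is_derive x 1 (fun y : R => (flat_poly k).[y^-1]) ((flat_poly k)^`().[x^-1] * - x ^- 2).
    have D : is_derive (x^-1) 1 (horner (flat_poly k)) ((flat_poly k)^`().[x^-1]).
      by split; [exact: derivable_horner|rewrite derivE derive1E].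
    exact: (is_derive1_comp D D1).
  have D3 : is_derive x 1 (fun y : R => expR (- y^-1)) (expR (- x^-1) * - - x ^- 2).
    have D : is_derive ((fun y : R => - y^-1) x) 1 (@expR R) (expR (- x^-1)) by exact: is_derive_expR.
    have D' : is_derive x 1 (fun y : R => - y^-1) (- - x ^- 2) by exact: is_deriveN.
    exact: (@is_derive1_comp R (@expR R) (fun y => - y^-1) x _ _ D D').
  have D4 := @is_deriveM _ _ (fun y : R => (flat_poly k).[y^-1]) (fun y : R => expR (- y^-1)) x 1 _ _ D2 D3.
  apply: (is_derive_eq D4).
  rewrite /flat x0 /GRing.scale/= hornerM hornerD hornerN hornerXn opprK exprVn.
  move: (_.[_]) (_.[_]) (expR _) (x ^- 2) => a b c e; ring.
- have [C HC] := flat_quad k.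
  apply: (is_derive_quad (C := C) (dl := 1)) => // t t1.
  rewrite /flat ltxx add0r mulr0 !subr0 /GRing.scale/= mulr1 -/(flat k t); exact: HC.
Unshelve. all: by end_near. Qed.

Lemma flat_gt0 x : 0 < x -> 0 < flat 0 x.
Proof. by move=> x0; rewrite /flat x0 /= hornerE mul1r expR_gt0. Qed.

Lemma flat_le0 x : x <= 0 -> flat 0 x = 0.
Proof. by move=> x0; rewrite /flat ifN// -leNgt. Qed.

Lemma flat_ge0 x : 0 <= flat 0 x.
Proof. by have [x0|x0] := ltP 0 x; [rewrite ltW// flat_gt0|rewrite flat_le0]. Qed.

End flat_function.

Section cutoff.
Variables (R : realType) (d : nat).
Local Notation V := 'rV[R]_d.

(** The norm of row vectors is the sup norm, which is not smooth away from 0; cutoffs are built on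
    the Euclidean one. *)
Definition sqnorm (x : V) : R := \sum_(i < d) x 0 i ^+ 2.

(** Equal to 1 where [sqnorm x <= 1] and to 0 where [sqnorm x >= 4]; the two terms of the
    denominator never vanish together. *)
Definition cutoff (x : V) : R :=
  flat 0 (4 - sqnorm x) * (flat 0 (4 - sqnorm x) + flat 0 (sqnorm x - 1))^-1.

Lemma smooth_sqnorm : smooth sqnorm.
Proof. by apply: smooth_sum => i; apply: smoothX; exact: smooth_coord. Qed.

Lemma cutoff_denominator_gt0 (x : V) :
  0 < flat 0 (4 - sqnorm x) + flat 0 (sqnorm x - 1) :> R.
Proof.
have [x4|x4] := ltP (sqnorm x) 4.
  by rewrite ltr_wpDr ?flat_ge0// flat_gt0// subr_gt0.
by rewrite ltr_wpDl ?flat_ge0// flat_gt0// subr_gt0; apply: lt_le_trans x4; lra.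
Qed.

Lemma smooth_cutoff : smooth cutoff.
Proof.
have s1 : smooth (fun x => flat 0 (4 - sqnorm x)).
  apply: (smooth_comp (u := @flat R)); last by move=> k x; exact: is_derive_flat.
  by apply: smoothB; [exact: smooth_cst|exact: smooth_sqnorm].
apply: smoothM => //; apply: smoothV; last exact: cutoff_denominator_gt0.
apply: smoothD => //.
apply: (smooth_comp (u := @flat R)); last by move=> k x; exact: is_derive_flat.
by apply: smoothB; [exact: smooth_sqnorm|exact: smooth_cst].
Qed.

Lemma cutoff_ge0 x : 0 <= cutoff x.
Proof. by rewrite mulr_ge0 ?flat_ge0// invr_ge0 ltW// cutoff_denominator_gt0. Qed.

(** The squares of the d coordinates then sum to at most d / (d + 1); taking d + 1 rather than d
    also keeps the radius positive in dimension 0. *)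
Lemma cutoff_eq1 x : `|x| <= d.+1%:R^-1 -> cutoff x = 1.
Proof.
move=> x1; have s1 : sqnorm x <= 1.
  apply: (@le_trans _ _ (\sum_(i < d) d.+1%:R^-1)).
    apply: ler_sum => i _; rewrite -real_normK ?num_real// expr2.
    have xi : `|x 0 i| <= d.+1%:R^-1 by exact: le_trans (le_coord_norm x i) x1.
    apply: (le_trans _ xi); rewrite ler_piMr//; apply: (le_trans xi).
    by rewrite invf_le1// ler1n.
  by rewrite sumr_const card_ord -[_ *+ d]mulr_natl ler_pdivrMr// mul1r ler_nat.
rewrite /cutoff (@flat_le0 _ (sqnorm x - 1)) ?subr_le0// addr0 divff//.
by rewrite gt_eqF// flat_gt0// subr_gt0; apply: le_lt_trans s1 _; lra.
Qed.

Lemma cutoff_eq0 x : 2 <= `|x| -> cutoff x = 0.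
Proof.
move=> x2.
have /mx_norm_neq0[[i0 i] /= E] : mx_norm x != 0.
  by rewrite gt_eqF// (lt_le_trans _ x2).
suff s4 : 4 <= sqnorm x by rewrite /cutoff flat_le0 ?mul0r// subr_le0.
have : `|x 0 i| = `|x| by rewrite -[RHS]/(mx_norm x) E (ord1 i0).
rewrite /sqnorm (bigD1 i)//= => xi.
apply: (@le_trans _ _ (x 0 i ^+ 2)); last by rewrite lerDl sumr_ge0// => k _; exact: sqr_ge0.
by rewrite -real_normK ?num_real// xi (_ : 4 = 2 ^+ 2) ?ler_sqr// ?nnegrE//; lra.
Qed.

End cutoff.

(** * Families of functions with uniform bounds on all derivatives *)

Section families.
Variables (R : realType) (d : nat).
Local Notation V := 'rV[R]_d.
Implicit Types (s : seq 'I_d).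

(** One constant per derivative, uniform in the index. The region [P] makes it possible to estimate
    one factor of a product only on the support of the other. *)
Definition bounded_on (I : Type) (f : I -> V -> R) (P : I -> V -> Prop) (W : I -> V -> R) :=
  forall s, exists C : R, forall i x, P i x -> `|iter_partial s (f i) x| <= C * W i x.

Lemma bounded_on_partial (I : Type) (f : I -> V -> R) P W k :
  bounded_on f P W -> bounded_on (fun i => partial k (f i)) P W.
Proof.
by move=> bf s; have [C H] := bf (rcons s k); exists C => i x; rewrite -iter_partial_rcons; exact: H.
Qed.

Lemma bounded_on_nonneg (I : Type) (f : I -> V -> R) P W s :
  (forall i x, P i x -> 0 <= W i x) -> bounded_on f P W ->
  exists2 C : R, 0 <= C & forall i x, P i x -> `|iter_partial s (f i) x| <= C * W i x.
Proof.
move=> W0 /(_ s)[C H]; exists `|C| => // i x Px; apply: (le_trans (H i x Px)).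
by rewrite ler_wpM2r ?W0// ler_norm.
Qed.

Lemma bounded_onD (I : Type) (f g : I -> V -> R) P W :
  (forall i, smooth (f i)) -> (forall i, smooth (g i)) ->
  bounded_on f P W -> bounded_on g P W -> bounded_on (fun i x => f i x + g i x) P W.
Proof.
move=> sf sg bf bg s; have [C HC] := bf s; have [D HD] := bg s.
exists (C + D) => i x Px; rewrite iter_partialD// mulrDl.
by apply: (le_trans (ler_normD _ _)); apply: lerD; [exact: HC|exact: HD].
Qed.

Lemma bounded_onM (I : Type) (f g : I -> V -> R) P W W' :
  (forall i, smooth (f i)) -> (forall i, smooth (g i)) ->
  (forall i x, P i x -> 0 <= W i x) -> (forall i x, P i x -> 0 <= W' i x) ->
  bounded_on f P W -> bounded_on g P W' ->
  bounded_on (fun i x => f i x * g i x) P (fun i x => W i x * W' i x).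
Proof.
(* Removing the innermost derivative splits the product into two products of the same kind, so no
   binomial expansion of the Leibniz rule is needed. *)
move=> + + W0 W0' + + s; elim/last_ind: s f g => [|s k IH] f g sf sg bf bg.
  have [C C0 HC] := bounded_on_nonneg [::] W0 bf.
  have [D D0 HD] := bounded_on_nonneg [::] W0' bg.
  exists (C * D) => i x Px /=; rewrite normrM mulrACA.
  by apply: ler_pM => //; [exact: HC|exact: HD].
have [C HC] := IH (fun i => partial k (f i)) g
  (fun i => smooth_partial k (sf i)) sg (bounded_on_partial k bf) bg.
have [D HD] := IH f (fun i => partial k (g i))
  sf (fun i => smooth_partial k (sg i)) bf (bounded_on_partial k bg).
exists (C + D) => i x Px.
rewrite iter_partial_rcons partialM// iter_partialD; last 2 first.
- by apply: smoothM => //; exact: smooth_partial.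
- by apply: smoothM => //; exact: smooth_partial.
rewrite mulrDl; apply: (le_trans (ler_normD _ _)).
by apply: lerD; [exact: HC|exact: HD].
Qed.

Lemma bounded_on_le (I : Type) (f : I -> V -> R) P W W' (A : R) : 0 <= A ->
  (forall i x, P i x -> 0 <= W i x) ->
  (forall i x, P i x -> W i x <= A * W' i x) -> bounded_on f P W -> bounded_on f P W'.
Proof.
move=> A0 W0 WW bf s; have [C C0 H] := bounded_on_nonneg s W0 bf.
exists (C * A) => i x Px; apply: (le_trans (H i x Px)).
by rewrite -mulrA ler_wpM2l// WW.
Qed.

Definition weight (M : nat) (x : V) : R := (1 + `|x|) ^- M.

Lemma weight_gt0 M x : 0 < weight M x.
Proof. by rewrite invr_gt0 exprn_gt0// ltr_wpDr. Qed.

Lemma expr_weight M x : (1 + `|x|) ^+ M * weight M x = 1.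
Proof. by rewrite mulfV// gt_eqF// exprn_gt0// ltr_wpDr. Qed.

Lemma weight_ge0 M x : 0 <= weight M x.
Proof. exact: ltW (weight_gt0 M x). Qed.

Lemma weightD M M' x : weight (M + M') x = weight M x * weight M' x.
Proof. by rewrite /weight exprD invfM. Qed.

Lemma weight_le1 M x : weight M x <= 1.
Proof. by rewrite invf_le1 ?exprn_gt0 ?ltr_wpDr// exprn_ege1// lerDl. Qed.

Lemma le_weight M M' x : (M <= M')%N -> weight M' x <= weight M x.
Proof. by move=> /subnKC <-; rewrite weightD ler_piMr ?weight_ge0// weight_le1. Qed.

(** The weights replace the monomials of the Schwartz norms; [csboundedP] and [csbounded_norm] give
    the equivalence. *)
Definition sbounded (I : Type) (f : I -> V -> R) :=
  (forall i, smooth (f i)) /\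
  forall M : nat, bounded_on f (fun _ _ => True) (fun _ => weight M).

Definition rschwartz (f : V -> R) := sbounded (fun _ : unit => f).

Lemma sbounded_rschwartz (I : Type) (f : I -> V -> R) i : sbounded f -> rschwartz (f i).
Proof.
by move=> [sf bf]; split => // M s; have [C H] := bf M s; exists C => _ x _; exact: H.
Qed.

Lemma sbounded_smooth (I : Type) (f : I -> V -> R) i : sbounded f -> smooth (f i).
Proof. by case. Qed.

Lemma rschwartz_smooth f : rschwartz f -> smooth f.
Proof. by move=> [sf _]; exact: (sf tt). Qed.

Lemma sbounded_bound (I : Type) (f : I -> V -> R) M s : sbounded f ->
  exists2 C : R, 0 <= C & forall i x, `|iter_partial s (f i) x| <= C * weight M x.
Proof.
move=> [_ bf]; have [|C C0 H] := bounded_on_nonneg s _ (bf M).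
  by move=> *; exact: weight_ge0.
by exists C => // i x; exact: H.
Qed.

Lemma sboundedD (I : Type) (f g : I -> V -> R) :
  sbounded f -> sbounded g -> sbounded (fun i x => f i x + g i x).
Proof.
move=> [sf bf] [sg bg]; split; first by move=> i; exact: smoothD.
by move=> M; apply: bounded_onD.
Qed.

Lemma sboundedM (I : Type) (f g : I -> V -> R) m :
  sbounded f -> (forall i, smooth (g i)) ->
  bounded_on g (fun _ _ => True) (fun _ x => (1 + `|x|) ^+ m) ->
  sbounded (fun i x => f i x * g i x).
Proof.
move=> [sf bf] sg bg; split; first by move=> i; exact: smoothM.
move=> M; apply: (@bounded_on_le _ _ _ (fun _ x => weight (M + m) x * (1 + `|x|) ^+ m) _ 1) => //.
- by move=> i x _; rewrite mulr_ge0 ?weight_ge0// exprn_ge0// addr_ge0.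
- move=> i x _; rewrite mul1r weightD -mulrA mulVf ?mulr1//.
apply: bounded_onM => // i x _; exact: weight_ge0.
Qed.

Lemma bounded_on_cst (I : Type) (c : R) P (W : I -> V -> R) :
  (forall i x, P i x -> 1 <= W i x) -> bounded_on (fun (_ : I) (_ : V) => c) P W.
Proof.
move=> W1 [|k s].
  by exists `|c| => i x Px /=; rewrite ler_peMr// W1.
by exists 0 => i x _; rewrite iter_partial_cst// normr0 mul0r.
Qed.

Lemma bounded_on_coord (I : Type) (k : 'I_d) P :
  bounded_on (fun (_ : I) (x : V) => x 0 k) P (fun _ x => (1 + `|x|) ^+ 1).
Proof.
move=> s; case: (lastP s) => [|{}s i].
  exists 1 => _ x _ /=; rewrite mul1r expr1; apply: (le_trans (le_coord_norm _ _)).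
  by rewrite lerDr.
have [|C H] := @bounded_on_cst I (i == k)%:R P (fun _ x => (1 + `|x|) ^+ 1) _ s.
  by move=> _ x _; rewrite expr1 lerDl.
exists C => j x Px; rewrite iter_partial_rcons partial_coord; exact: H Px.
Qed.

Lemma sboundedZ (I : Type) (f : I -> V -> R) (c : R) :
  sbounded f -> sbounded (fun i x => c * f i x).
Proof.
move=> [sf bf]; split; first by move=> i; exact: smoothZ.
move=> M s; have [C H] := bf M s; exists (`|c| * C) => i x _.
by rewrite iter_partialZ// normrM -mulrA ler_wpM2l// H.
Qed.

Lemma sboundedN (I : Type) (f : I -> V -> R) :
  sbounded f -> sbounded (fun i x => - f i x).
Proof.
move=> [sf bf]; split; first by move=> i; exact: smoothN.
move=> M s; have [C H] := bf M s; exists C => i x _.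
by rewrite iter_partialN// normrN H.
Qed.

Lemma sbounded_coord (I : Type) (f : I -> V -> R) (k : 'I_d) :
  sbounded f -> sbounded (fun i x => f i x * x 0 k).
Proof.
move=> sf; apply: (sboundedM (m := 1) sf); first by move=> _; exact: smooth_coord.
exact: bounded_on_coord.
Qed.

Lemma sbounded_partial (I : Type) (f : I -> V -> R) (k : 'I_d) :
  sbounded f -> sbounded (fun i => partial k (f i)).
Proof.
move=> [sf bf]; split; first by move=> i; exact: smooth_partial.
by move=> M; exact: bounded_on_partial.
Qed.

Lemma sbounded_iter_partial (I : Type) (f : I -> V -> R) s :
  sbounded f -> sbounded (fun i => iter_partial s (f i)).
Proof. by move=> sf; elim: s => [|k s IH] //=; exact: sbounded_partial. Qed.

Lemma sbounded_pull (I J : Type) (f : I -> V -> R) (h : J -> I) :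
  sbounded f -> sbounded (fun j => f (h j)).
Proof.
move=> [sf bf]; split; first by move=> j.
by move=> M s; have [C H] := bf M s; exists C => j x _; exact: H.
Qed.

(** A Taylor estimate by induction on the order: if every derivative is O(|x|^L) uniformly in the
    family, the mean value bound from 0 to [x] makes each one O(|x|^(L+1)). *)
Lemma flat_family (I : Type) (f : I -> V -> R) : (forall i, smooth (f i)) ->
  (forall s, exists C : R, forall i x, `|iter_partial s (f i) x| <= C) ->
  (forall s i, iter_partial s (f i) 0 = 0) ->
  forall L s, exists2 C : R, 0 <= C & forall i x, `|iter_partial s (f i) x| <= C * `|x| ^+ L.
Proof.
move=> sf bf f0; elim=> [|L IH] s.
  have [C H] := bf s; exists `|C| => // i x; rewrite expr0 mulr1.
  exact: le_trans (H i x) (ler_norm _).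
pose P (k : 'I_d) (C : R) := forall i x, `|iter_partial (k :: s) (f i) x| <= C * `|x| ^+ L.
have [C HC] : exists C : R, forall k, P k C.
  apply: finite_choice => [k C C' CC H i x|k].
    by apply: (le_trans (H i x)); rewrite ler_wpM2r// exprn_ge0.
  by have [C _ H] := IH (k :: s); exists C.
exists (d%:R * `|C|) => [|i x]; first by rewrite mulr_ge0.
have := @partial_lipschitz _ _ (iter_partial s (f i)) 0 x (`|C| * `|x| ^+ L).
rewrite f0 !subr0 exprSr !mulrA; apply.
  by move=> k z; apply: smooth_derivable; exact: smooth_iter_partial.
move=> k z; rewrite !subr0 => zx; apply: (le_trans (HC k i z)).
apply: (@le_trans _ _ (`|C| * `|z| ^+ L)).
  by rewrite ler_wpM2r ?exprn_ge0// ler_norm.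
by rewrite ler_wpM2l// lerXn2r// nnegrE.
Qed.

Definition geometric_family (h : nat -> V -> R) :=
  (forall k, smooth (h k)) /\
  forall s (B : R), exists C : R, forall k x, `|x| <= B ->
    `|iter_partial s (h k) x| <= C * 2^-1 ^+ k.

Lemma geometric_family_partial h i :
  geometric_family h -> geometric_family (fun k => partial i (h k)).
Proof.
move=> [sh gh]; split=> [k|s B]; first exact: smooth_partial.
by have [C H] := gh (rcons s i) B; exists C => k x xB; rewrite -iter_partial_rcons H.
Qed.

Definition fsum (h : nat -> V -> R) : V -> R := fun x => gsum (fun k => h k x).

Lemma fsum_continuous h : geometric_family h -> continuous (fsum h).
Proof.
move=> gh x; have [sh bh] := gh.
pose P (i : 'I_d) (C : R) := forall k y, `|y| <= `|x| + 1 ->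
  `|partial i (h k) y| <= C * 2^-1 ^+ k.
have [C HC] : exists C, forall i, P i C.
  apply: finite_choice => [i C C' CC H k y yx|i]; last exact: (bh [:: i]).
  by apply: (le_trans (H k y yx)); rewrite ler_wpM2r// exprn_ge0// invr_ge0.
have [C0 HC0] := bh [::] (`|x| + 1).
apply: (@continuous_lipschitz _ _ (fsum h) x (2 * (d%:R * C)) 1) => // y yx.
have yx1 : `|y| <= `|x| + 1.
  by rewrite -[y](subrK x) addrC; apply: le_trans (ler_normD _ _) _; rewrite lerD2l.
have xx1 : `|x| <= `|x| + 1 by rewrite lerDl.
have -> : fsum h y - fsum h x = gsum (fun k => h k y - h k x).
  rewrite /fsum (@gsum_linear _ (h ^~ y) (h ^~ x) (fun k => h k y - h k x) C0 C0 1 (-1)).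
  - by rewrite mul1r mulN1r.
  - by move=> k; exact: (HC0 k y).
  - by move=> k; exact: (HC0 k x).
  - by move=> k; rewrite mul1r mulN1r.
rewrite -!mulrA; apply: geo_le => k.
rewrite -mulrA [C * _ * _]mulrAC.
have := @partial_lipschitz _ _ (h k) x y (C * 2^-1 ^+ k); apply.
  by move=> i z; exact: smooth_derivable.
move=> i z zx; apply: HC; rewrite -[z](subrK x) addrC.
apply: le_trans (ler_normD _ _) _; rewrite lerD2l; exact: le_trans zx yx.
Qed.

(** The second-order remainder of the k-th term is O(2^-k t^2), so the remainder of the sum is again
    quadratic in t. *)
Lemma is_derive_fsum h i x : geometric_family h ->
  is_derive x (delta_mx 0 i : V) (fsum h) (fsum (fun k => partial i (h k)) x).
Proof.
move=> [sh bh].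
have [C0 HC0] := bh [::] (`|x| + 1).
have [C1 HC1] := bh [:: i] (`|x| + 1).
have [C2 HC2] := bh [:: i; i] (`|x| + 1).
apply: (@is_derive_quad _ _ (fsum h) x _ _ (2 * C2) 1) => // t t1.
have N (u : R) : `|u| <= 1 -> `|x + u *: (delta_mx 0 i : V)| <= `|x| + 1.
  move=> u1; apply: le_trans (ler_normD _ _) _; rewrite lerD2l normrZ.
  apply: (@le_trans _ _ (`|u| * 1)); last by rewrite mulr1.
  rewrite ler_wpM2l//; apply: norm_le_coord => // l; rewrite mxE.
  by case: (_ && _); rewrite ?normr1 ?normr0.
have xx1 : `|x| <= `|x| + 1 by rewrite lerDl.
have -> : fsum h (x + t *: delta_mx 0 i) - fsum h x - t * fsum (fun k => partial i (h k)) x =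
    gsum (fun k => h k (x + t *: delta_mx 0 i) - h k x - t * partial i (h k) x).
  rewrite /fsum; symmetry.
  rewrite (@gsum_linear _ (fun k => h k (x + t *: delta_mx 0 i) - h k x)
    (fun k => partial i (h k) x) _ (C0 + C0) C1 1 (- t)).
  - rewrite mul1r mulNr; congr (_ - _).
    rewrite (@gsum_linear _ (h ^~ (x + t *: delta_mx 0 i)) (h ^~ x) _ C0 C0 1 (-1)).
    + by rewrite mul1r mulN1r.
    + by move=> k; apply: (HC0 k); exact: N.
    + by move=> k; exact: (HC0 k x).
    + by move=> k; rewrite mul1r mulN1r.
  - move=> k; apply: le_trans (ler_normB _ _) _; rewrite mulrDl.
    by apply: lerD; apply: (HC0 k) => //; exact: N.
  - by move=> k; exact: (HC1 k x).
  - by move=> k; rewrite mul1r mulNr.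
rewrite -mulrA; apply: geo_le => k.
rewrite mulrAC; apply: line_taylor2.
- by move=> y; exact: smooth_derivable.
- by move=> y; apply: smooth_derivable; exact: smooth_partial.
- by move=> u ut; apply: (HC2 k); apply: N; exact: le_trans ut t1.
Qed.

Lemma smooth_fsum h : geometric_family h -> smooth (fsum h).
Proof.
move=> gh; apply: (@smooth_coind _ _ (fun f => exists2 h, geometric_family h & f = fsum h)).
- by move=> _ [k gk ->]; exact: fsum_continuous.
- by move=> _ x i [k gk ->]; case: (is_derive_fsum i x gk).
- move=> _ i [k gk ->]; exists (fun m => partial i (k m)); first exact: geometric_family_partial.
  by apply/funext => x; apply: partialE; exact: is_derive_fsum.
- by exists h.
Qed.

Lemma iter_partial_fsum h s : geometric_family h ->
  iter_partial s (fsum h) = fsum (fun k => iter_partial s (h k)).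
Proof.
elim/last_ind: s h => [//|s i IH] h gh.
rewrite iter_partial_rcons (_ : partial i (fsum h) = fsum (fun k => partial i (h k))).
  rewrite IH; last exact: geometric_family_partial.
  by rewrite /fsum; apply/funext => x; congr gsum; apply/funext => k; rewrite iter_partial_rcons.
by apply/funext => x; apply: partialE; exact: is_derive_fsum.
Qed.

End families.

(** * Lebesgue integration on row vectors *)

Section tuple_measure.
Variable R : realType.
Local Notation mR := (measurableTypeR R).
Local Notation mu d := (lebesgue_tuple R d).

Definition row_of (d : nat) (t : d.-tuple mR) : 'rV[R]_d := \row_i tnth t i.

Lemma measurable_row_coord d (i : 'I_d) : measurable_fun setT (fun t : d.-tuple mR => row_of t 0 i : mR).
Proof.
rewrite (_ : (fun t => _) = (@tnth d mR ^~ i)); first exact: measurable_tnth.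
by apply/funext => t; rewrite mxE.
Qed.

(** Links the topology of rows to the product sigma-algebra of tuples: an open set is a countable
    union of cubes with rational centres and radii 1/(k+1), and a cube is a finite intersection of
    conditions on single coordinates. *)
Lemma measurable_row_open d (U : set 'rV[R]_d) : open U -> measurable (@row_of d @^-1` U).
Proof.
move=> oU.
pose cube (q : 'rV[rat]_d * nat) : set 'rV[R]_d :=
  [set x | forall i, `|ratr (q.1 0 i) - x 0 i| < q.2.+1%:R^-1].
pose F (q : 'rV[rat]_d * nat) := if `[< cube q `<=` U >] then cube q else set0.
have -> : U = \bigcup_q F q.
  apply/seteqP; split=> [x Ux|x [q _]]; last by rewrite /F; case: asboolP => // qU; exact: qU.
  have /nbhs_ballP[e /= e0 xe] : nbhs x U by exact: open_nbhs_nbhs.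
  (* The centre of the cube is not [x], so points of the cube may be two radii away from [x]. *)
  have [k ke] : exists k : nat, k.+1%:R^-1 < e / 2.
    exists (Num.bound (2 / e)); rewrite invf_plt ?posrE ?divr_gt0// invf_div.
    apply: (lt_trans (archi_boundP _)); first by rewrite divr_ge0// ltW.
    by rewrite ltr_nat.
  have /choice[q Hq] : forall i : 'I_d, exists q : rat, `|ratr q - x 0 i| < k.+1%:R^-1.
    move=> i.
    have [|q] := @rat_in_itvoo R (x 0 i - k.+1%:R^-1) (x 0 i + k.+1%:R^-1).
      by rewrite ltrBlDr -addrA ltrDl addr_gt0// invr_gt0.
    rewrite in_itv/= => /andP[q1 q2]; exists q.
    by rewrite ltr_distl q1 q2.
  exists (\row_i q i, k) => //; rewrite /F ifT; first by move=> i /=; rewrite mxE.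
  apply/asboolP => y Hy; apply: xe; rewrite mx_norm_ball /ball_/=.
  apply: (@le_lt_trans _ _ (k.+1%:R^-1 + k.+1%:R^-1)); last by rewrite [ltRHS]splitr ltrD.
  apply: norm_le_coord; first by rewrite addr_ge0.
  move=> i; rewrite !mxE.
  rewrite (_ : _ - _ = (x 0 i - ratr (q i)) + (ratr (q i) - y 0 i)); last by rewrite addrA subrK.
  apply: (le_trans (ler_normD _ _)); apply: lerD; apply: ltW; first by rewrite distrC.
  by have := Hy i; rewrite /= mxE.
rewrite preimage_bigcup; apply: countable_bigcupT_measurable => [|q]; first exact: countableP.
rewrite /F; case: ifP => _; last by rewrite preimage_set0.
rewrite (_ : _ @^-1` _ = \bigcap_(i in [set: 'I_d])
   ((fun t : d.-tuple mR => row_of t 0 i) @^-1` [set y | `|ratr (q.1 0 i) - y| < q.2.+1%:R^-1])).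
  apply: fin_bigcap_measurable => // i _.
  rewrite -[X in measurable X]setTI; apply: measurable_row_coord => //.
  rewrite (_ : [set y | _] = ball (ratr (q.1 0 i) : R) q.2.+1%:R^-1).
    exact: measurable_ball.
  by apply/seteqP; split.
by apply/seteqP; split=> [t Ht i _ /=|t Ht i]; [exact: Ht|exact: (Ht i)].
Qed.

Lemma measurable_row_continuous d (f : 'rV[R]_d -> R) : continuous f ->
  measurable_fun setT (fun t : d.-tuple mR => f (row_of t) : mR).
Proof.
move=> cf; apply: (measurability _ (RGenOpens.measurableE R)).
move=> _ [_ [a [b ->]] <-]; rewrite setTI.
rewrite (_ : _ @^-1` _ = @row_of d @^-1` (f @^-1` `]a, b[%classic))//.
by apply: measurable_row_open; apply: open_comp => // x _; exact: cf.
Qed.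

Local Open Scope ereal_scope.

Lemma tonelli_cons d (F : d.+1.-tuple mR -> \bar R) : measurable_fun setT F ->
  (forall t, 0 <= F t) ->
  \int[mu d.+1]_t F t = \int[lebesgue_measure]_x \int[mu d]_t F [tuple of x :: t].
Proof.
move=> mF F0.
have mc : measurable_fun setT (fun p : mR * d.-tuple mR => [tuple of p.1 :: p.2]).
  exact: measurable_cons.
rewrite [LHS]ge0_integral_pushforward//.
rewrite fubini_tonelli1//; first exact: measurableT_comp.
by move=> p; exact: F0.
Qed.

Lemma measurable_tuple_cons d (x : mR) : measurable_fun setT (fun t : d.-tuple mR => [tuple of x :: t]).
Proof. exact: measurable_cons. Qed.

Lemma integral_tuple_prod (u : mR -> R) d : measurable_fun setT u -> (forall x, 0 <= u x)%R ->
  \int[mu d]_t (\prod_(i < d) u (tnth t i))%:E = (\int[lebesgue_measure]_x (u x)%:E) ^+ d.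
Proof.
move=> mu0 u0.
have mp k : measurable_fun setT (fun t : k.-tuple mR => (\prod_(i < k) u (tnth t i))%R : mR).
  apply: measurable_prod => i _; apply: measurableT_comp => //; exact: measurable_tnth.
have p0 k (t : k.-tuple mR) : (0 <= \prod_(i < k) u (tnth t i))%R by exact: prodr_ge0.
elim: d => [|d IH].
  rewrite expe0 integral_dirac//; first by rewrite diracE mem_set// mul1e big_ord0.
  by apply/measurable_EFinP; exact: (mp 0%N).
rewrite tonelli_cons//; last 2 first.
  by apply/measurable_EFinP; exact: mp.
  by move=> t; rewrite lee_fin.
rewrite expeS -ge0_integralZr//; last 3 first.
- exact/measurable_EFinP.
- by move=> x _; rewrite lee_fin.
- by apply: expe_ge0; apply: integral_ge0 => x _; rewrite lee_fin.
apply: eq_integral => x _; rewrite -IH -ge0_integralZl//; last 3 first.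
- by apply/measurable_EFinP; exact: mp.
- by move=> t _; rewrite lee_fin.
- by rewrite lee_fin.
apply: eq_integral => t _; rewrite -EFinM big_ord_recl.
congr (_ * _)%:E; apply: eq_bigr => i _; congr u.
by rewrite tnthS.
Qed.

(** The image of Lebesgue measure under the affine map, multiplied by |a|, gives half-open intervals
    their length, so it is Lebesgue measure by uniqueness. *)
Lemma ge0_integral_affine1 (a b : R) (F : mR -> \bar R) : (a != 0)%R ->
  measurable_fun setT F -> (forall x, 0 <= F x) ->
  \int[lebesgue_measure]_x F (a * x + b)%R = (`|a|^-1)%:E * \int[lebesgue_measure]_x F x.
Proof.
move=> a0 mF F0.
pose phi (x : mR) : mR := (a * x + b)%R.
have mphi : measurable_fun setT phi.
  by apply: measurable_funD => //; apply: measurable_funM.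
pose nu := mscale (NngNum (normr_ge0 a)) (measure_function_pushforward__canonical__measure_function_Measure
     (@lebesgue_measure R) mphi).
have E A : measurable A -> lebesgue_measure A = nu A.
  apply: lebesgue_measure_unique => _ [[u v] _ <-] /=.
  rewrite /nu /mscale /= /pushforward lebesgue_measure_itv /= lte_fin.
  have [an|ap|a00] := ltgtP a 0%R; last by rewrite a00 eqxx in a0.
    rewrite (_ : phi @^-1` _ = `[((v - b) / a)%R, ((u - b) / a)%R[%classic); last first.
      apply/seteqP; split => x /=; rewrite !in_itv/= ler_ndivrMr// ltr_ndivlMr// /phi.
        by rewrite ltrBlDr lerBrDr mulrC andbC.
      by rewrite ltrBlDr lerBrDr mulrC andbC.
    rewrite lebesgue_measure_itv/= lte_fin ltr_nM2r ?invr_lt0// ltrD2r.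
    case: ifPn => uv; last by rewrite mule0.
    rewrite -!EFinB -EFinM ltr0_norm//; congr EFin; field; by rewrite a0.
  rewrite (_ : phi @^-1` _ = `]((u - b) / a)%R, ((v - b) / a)%R]%classic); last first.
    apply/seteqP; split => x /=; rewrite !in_itv/= ltr_pdivrMr// ler_pdivlMr// /phi.
      by rewrite ltrBlDr lerBrDr mulrC.
    by rewrite ltrBlDr lerBrDr mulrC.
  rewrite lebesgue_measure_itv/= lte_fin ltr_pM2r ?invr_gt0// ltrD2r.
  case: ifPn => uv; last by rewrite mule0.
  by rewrite -!EFinB -EFinM gtr0_norm//; congr EFin; field.
rewrite [in RHS](eq_measure_integral nu) => [|A mA _]; last exact: E.
rewrite ge0_integral_mscale//= muleA -EFinM mulVf ?normr_eq0// mul1e.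
by rewrite ge0_integral_pushforward.
Qed.


Definition affine_tuple d (c b : 'I_d -> R) (t : d.-tuple mR) : d.-tuple mR :=
  [tuple (c i * tnth t i + b i)%R | i < d].

Lemma measurable_affine_tuple d (c b : 'I_d -> R) : measurable_fun setT (affine_tuple c b).
Proof.
apply/measurable_fun_tnthP => i.
rewrite (_ : _ \o _ = fun t : d.-tuple mR => (c i * tnth t i + b i)%R : mR).
  by apply: measurable_funD => //; apply: measurable_funM => //; exact: measurable_tnth.
by apply/funext => t /=; rewrite tnth_mktuple.
Qed.

Lemma ge0_integral_affine d (c b : 'I_d -> R) (F : d.-tuple mR -> \bar R) :
  (forall i, c i != 0%R) -> measurable_fun setT F -> (forall t, 0 <= F t) ->
  \int[mu d]_t F (affine_tuple c b t) = (\prod_(i < d) `|c i|^-1)%:E * \int[mu d]_t F t.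
Proof.
elim: d c b F => [|d IH] c b F c0 mF F0.
  by rewrite big_ord0 mul1e; apply: eq_integral => t _; rewrite [affine_tuple _ _ _]tuple0 [t]tuple0.
have mFa : measurable_fun setT (F \o affine_tuple c b).
  by apply: measurableT_comp => //; exact: measurable_affine_tuple.
rewrite [LHS](tonelli_cons mFa)//; last by move=> t; exact: F0.
rewrite (tonelli_cons mF)//.
pose c' := fun i => c (lift ord0 i); pose b' := fun i => b (lift ord0 i).
pose G (x : mR) := \int[mu d]_t F [tuple of x :: t].
have mG : measurable_fun setT G.
  apply: (@measurable_fun_fubini_tonelli_F _ _ mR (d.-tuple mR) R (lebesgue_tuple R d)
    (fun p : mR * d.-tuple mR => F [tuple of p.1 :: p.2])) => //.
  by apply: measurableT_comp => //; exact: measurable_cons.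
have G0 x : 0 <= G x by exact: integral_ge0.
transitivity (\int[lebesgue_measure]_x ((\prod_(i < d) `|c' i|^-1)%:E * G (c ord0 * x + b ord0)%R)).
  apply: eq_integral => x _; rewrite /G -(IH c' b')//; last 2 first.
  - by move=> i; exact: c0.
  - by apply: measurableT_comp => //; exact: measurable_tuple_cons.
  apply: eq_integral => t _; congr F; apply: eq_from_tnth => i.
  rewrite tnth_mktuple; have [->|i0] := eqVneq i ord0; first by rewrite !tnth0.
  have [k ->] : exists k, i = lift ord0 k by case: (unliftP ord0 i) i0 => [k ->|->//]; exists k.
  by rewrite !tnthS tnth_mktuple.
rewrite [LHS]ge0_integralZl.
- by rewrite ge0_integral_affine1// muleA -EFinM big_ord_recl mulrC.
- by [].
- apply: measurableT_comp => //.
  by apply: measurable_funD => //; apply: measurable_funM.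
- by move=> x _; exact: G0.
- by rewrite lee_fin prodr_ge0.
Qed.

End tuple_measure.

Section real_integral_theory.
Variables (R : realType) (d : nat).
Local Notation V := 'rV[R]_d.
Local Notation mu := (lebesgue_tuple R d).
Implicit Types f g : V -> R.

Definition rint f := mu.-integrable setT (EFin \o (f \o @row_of R d)).

Lemma real_integral_EFin f : rint f -> (\int[mu]_t (f (row_of t))%:E)%E = (real_integral f)%:E.
Proof. by move=> rf; rewrite /real_integral /Rintegral fineK//; exact: integrable_fin_num. Qed.

Lemma real_integral_ge0 f : (forall x, 0 <= f x) -> 0 <= real_integral f.
Proof. by move=> f0; apply: Rintegral_ge0. Qed.

Lemma real_integralZ c f : rint f -> real_integral (fun x => c * f x) = c * real_integral f.
Proof. by move=> rf; rewrite [LHS]RintegralZl. Qed.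

Lemma real_integralD f g : rint f -> rint g ->
  real_integral (fun x => f x + g x) = real_integral f + real_integral g.
Proof. by move=> rf rg; rewrite [LHS]RintegralD. Qed.

Lemma real_integralB f g : rint f -> rint g ->
  real_integral (fun x => f x - g x) = real_integral f - real_integral g.
Proof. by move=> rf rg; rewrite [LHS]RintegralB. Qed.

Lemma le_real_integral f g : rint f -> rint g -> (forall x, f x <= g x) ->
  real_integral f <= real_integral g.
Proof. by move=> rf rg fg; apply: le_Rintegral. Qed.

Lemma le_norm_real_integral f g : rint f -> rint g -> (forall x, `|f x| <= g x) ->
  `|real_integral f| <= real_integral g.
Proof.
move=> rf rg fg.
have rn : rint (fun x => `|f x|) by exact: (integrable_norm rf).
apply: (@le_trans _ _ (real_integral (fun x => `|f x|))); last exact: le_real_integral.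
exact: le_normr_Rintegral.
Qed.

Lemma rintZ c f : rint f -> rint (fun x => c * f x).
Proof. by move=> rf; apply: (integrableZl measurableT c rf). Qed.

Lemma rintD f g : rint f -> rint g -> rint (fun x => f x + g x).
Proof. by move=> rf rg; apply: (integrableD measurableT rf rg). Qed.

Lemma rint_le f g : rint g -> continuous f -> (forall x, `|f x| <= g x) -> rint f.
Proof.
move=> rg cf fg; apply: (le_integrable _ _ _ rg) => //.
  by apply/measurable_EFinP; exact: measurable_row_continuous.
by move=> t _ /=; rewrite lee_fin (le_trans (fg _))// ler_norm.
Qed.

Lemma integral_oneDsqr_lty :
  (\int[@lebesgue_measure R]_x ((1 + x ^+ 2)^-1)%:E < +oo)%E.
Proof.
rewrite (@ge0_symfun_integralT R (fun x => (1 + x ^+ 2)^-1)).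
- rewrite (_ : [set x | _] = `[0, +oo[%classic); last first.
    by apply/seteqP; split => x/=; rewrite in_itv/= andbT.
  have := @integral0y_oneDsqr R; rewrite /oneDsqr => ->.
  by rewrite -EFinM ltry.
- by move=> x; rewrite invr_ge0 addr_ge0// sqr_ge0.
- exact: continuous_oneDsqrV.
- by move=> x /=; rewrite sqrrN.
Qed.

Lemma rint_prod_oneDsqr : rint (fun x => \prod_(i < d) (1 + x 0 i ^+ 2)^-1).
Proof.
have mu1 : measurable_fun setT (fun x : measurableTypeR R => (1 + x ^+ 2)^-1 : measurableTypeR R).
  by apply: continuous_measurable_fun; exact: continuous_oneDsqrV.
have p0 (x : V) : 0 <= \prod_(i < d) (1 + x 0 i ^+ 2)^-1.
  by apply: prodr_ge0 => i _; rewrite invr_ge0 addr_ge0// sqr_ge0.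
apply/integrableP; split.
  apply/measurable_EFinP; apply: measurable_prod => i _.
  rewrite (_ : (fun _ => _) = (fun x : measurableTypeR R => (1 + x ^+ 2)^-1) \o
    (fun t => row_of t 0 i))//.
  by apply: measurableT_comp => //; exact: measurable_row_coord.
set I := (X in (X < _)%E).
have -> : I = (\int[mu]_t (\prod_(i < d) (1 + (tnth t i : R) ^+ 2)^-1)%:E)%E.
  apply: eq_integral => t _ /=; rewrite ger0_norm//; congr EFin; apply: eq_bigr => i _.
  by rewrite mxE.
rewrite (@integral_tuple_prod R (fun x => (1 + x ^+ 2)^-1))//; last first.
  by move=> x; rewrite invr_ge0 addr_ge0// sqr_ge0.
have I0 : (0 <= \int[@lebesgue_measure R]_x ((1 + x ^+ 2)^-1)%:E)%E.
  by apply: integral_ge0 => x _; rewrite lee_fin invr_ge0 addr_ge0// sqr_ge0.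
have : (\int[@lebesgue_measure R]_x ((1 + x ^+ 2)^-1)%:E \is a fin_num)%E.
  by rewrite ge0_fin_numE// integral_oneDsqr_lty.
by move/fineK <-; rewrite -EFin_expe ltry.
Qed.

Lemma continuous_norm_weight M : continuous (fun x : V => weight M x).
Proof.
move=> x; apply: (@continuousV _ _ (fun x : V => (1 + `|x|) ^+ M)).
  by rewrite gt_eqF// exprn_gt0// ltr_wpDr.
apply: (continuous_comp (g := fun y : R => y ^+ M)); last exact: exprn_continuous.
apply: continuousD; [exact: cst_continuous|exact: norm_continuous].
Qed.

(** In the sup norm (1 + |x|)^(2d) dominates the product of the 1 + x_i^2, whose inverse is
    integrable coordinate by coordinate. The exponent is chosen for this comparison and is not
    sharp. *)
Lemma rint_weight0 : rint (weight (2 * d)).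
Proof.
apply: (rint_le rint_prod_oneDsqr); first exact: continuous_norm_weight.
move=> x; rewrite ger0_norm ?weight_ge0// /weight exprM.
rewrite prodfV lef_pV2; last 2 first.
- by rewrite posrE !exprn_gt0// ltr_wpDr.
- by rewrite posrE prodr_gt0// => i _; rewrite ltr_wpDr ?sqr_ge0.
rewrite -[leRHS](_ : \prod_(i < d) (1 + `|x|) ^+ 2 = _); last by rewrite prodr_const card_ord.
apply: ler_prod => i _; rewrite addr_ge0 ?sqr_ge0//=.
rewrite -real_normK ?num_real//.
have := le_coord_norm x i; have := normr_ge0 (x 0 i).
by move: (`|x 0 i|) (`|x|) => a b a0 ab; nra.
Qed.

Lemma rint_weight f M C : (2 * d <= M)%N -> continuous f ->
  (forall x, `|f x| <= C * weight M x) -> rint f.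
Proof.
move=> dM cf fC; apply: (@rint_le _ (fun x => `|C| * weight (2 * d) x)) => //.
  exact: rintZ rint_weight0.
move=> x; apply: (le_trans (fC x)).
apply: (@le_trans _ _ (`|C| * weight M x)); first by rewrite ler_wpM2r ?weight_ge0// ler_norm.
by rewrite ler_wpM2l// le_weight.
Qed.

Definition weight_mass : R := real_integral (fun x : V => weight (2 * d) x).

Lemma weight_mass_ge0 : 0 <= weight_mass.
Proof. by apply: real_integral_ge0 => x; exact: weight_ge0. Qed.

Lemma real_integral_weight f M C : (2 * d <= M)%N -> continuous f -> 0 <= C ->
  (forall x, `|f x| <= C * weight M x) -> `|real_integral f| <= C * weight_mass.
Proof.
move=> dM cf C0 fC.
rewrite -real_integralZ; last exact: rint_weight0.
apply: le_norm_real_integral; first exact: rint_weight fC.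
  exact: rintZ rint_weight0.
by move=> x; apply: (le_trans (fC x)); rewrite ler_wpM2l// le_weight.
Qed.

Lemma real_integral_affine f (c b : V) : rint f -> continuous f -> (forall i, c 0 i != 0) ->
  real_integral (fun x => f (affine c b x)) = (\prod_(i < d) `|c 0 i|^-1) * real_integral f.
Proof.
move=> rf cf c0.
pose F (t : d.-tuple (measurableTypeR R)) := (f (row_of t))%:E.
have mf : measurable_fun setT F.
  by apply/measurable_EFinP; exact: measurable_row_continuous.
pose A := @affine_tuple R d (fun i => c 0 i) (fun i => b 0 i).
have E t : F (A t) = (f (affine c b (row_of t)))%:E.
  by congr (f _)%:E; apply/rowP => i; rewrite !mxE tnth_mktuple.
have -> : real_integral (fun x => f (affine c b x)) = fine (\int[mu]_t F (A t))%E.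
  by rewrite /real_integral /Rintegral; congr fine; apply: eq_integral => t _; rewrite E.
have -> : real_integral f = fine (\int[mu]_t F t)%E by [].
rewrite integralE [X in _ = _ * fine X]integralE.
have -> : (\int[mu]_t (fun t => F (A t))^\+ t = (\prod_(i < d) `|c 0 i|^-1)%:E * \int[mu]_t F^\+ t)%E.
  have M := measurable_funepos mf.
  rewrite -(@ge0_integral_affine R d (fun i => c 0 i) (fun i => b 0 i) F^\+%E c0 M (fun t => funepos_ge0 F t)).
  by apply: eq_integral => t _; rewrite ?funeposE ?funenegE.
have -> : (\int[mu]_t (fun t => F (A t))^\- t = (\prod_(i < d) `|c 0 i|^-1)%:E * \int[mu]_t F^\- t)%E.
  have M := measurable_funeneg mf.
  rewrite -(@ge0_integral_affine R d (fun i => c 0 i) (fun i => b 0 i) F^\-%E c0 M (fun t => funeneg_ge0 F t)).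
  by apply: eq_integral => t _; rewrite ?funeposE ?funenegE.
have fp := integrable_pos_fin_num measurableT rf.
have fn := integrable_neg_fin_num measurableT rf.
by rewrite -muleBr// ?fin_num_adde_defl ?fin_numN// fineM// fin_numB fp fn.
Qed.

Lemma real_integral_gt0 f : rint f -> continuous f -> (forall x, 0 <= f x) ->
  0 < f 0 -> 0 < real_integral f.
Proof.
move=> rf cf f0 fp.
have f20 : 0 < f 0 / 2 by rewrite divr_gt0.
have : \forall y \near (0 : V), f 0 / 2 <= f y.
  have := cf (0 : V) => /(@cvgrPdist_le _ _ _ _ (nbhs_filter (0 : V)))/(_ _ f20).
  by apply: filterS => y; rewrite ler_norml => /andP[_]; lra.
move=> /nbhs_ballP[r /= r0 Hr].
(* The indicator of one side of a cube on which [f] is at least [f 0 / 2]; half-width r / 2 keeps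
   the closed cube inside the open ball of radius r. The cube has volume r^d. *)
pose u (x : measurableTypeR R) : R := \1_(`[(- (r / 2))%R, (r / 2)%R]%classic : set R) x.
have mu1 : measurable_fun setT u by exact: measurable_indic.
have u0 x : 0 <= u x by rewrite /u indicE.
have p0 (t : d.-tuple (measurableTypeR R)) : 0 <= \prod_(i < d) u (tnth t i) by exact: prodr_ge0.
have mp : measurable_fun setT (fun t : d.-tuple (measurableTypeR R) =>
    (\prod_(i < d) u (tnth t i))%R : measurableTypeR R).
  apply: measurable_prod => i _; apply: measurableT_comp => //; exact: measurable_tnth.
have r20 : 0 < r / 2 by rewrite divr_gt0.
have I1 : (\int[@lebesgue_measure R]_x (u x)%:E = r%:E)%E.
  transitivity (lebesgue_measure (`[(- (r / 2))%R, (r / 2)%R]%classic : set R)).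
    by rewrite integral_indic// setIT.
  rewrite lebesgue_measure_itv/= lte_fin ifT; last by lra.
  by rewrite -EFinD; congr EFin; lra.
have Ip : (\int[mu]_t (\prod_(i < d) u (tnth t i))%:E = (r ^+ d)%:E)%E.
  by rewrite integral_tuple_prod// I1 -EFin_expe.
rewrite -lte_fin -real_integral_EFin//.
apply: (@lt_le_trans _ _ ((f 0 / 2)%:E * \int[mu]_t (\prod_(i < d) u (tnth t i))%:E)%E).
  by rewrite Ip -EFinM lte_fin mulr_gt0// exprn_gt0.
rewrite -ge0_integralZl//; last 3 first.
- by apply/measurable_EFinP.
- by move=> t _; rewrite lee_fin.
- by rewrite lee_fin ltW.
apply: ge0_le_integral => //.
- by move=> t _; rewrite -EFinM lee_fin mulr_ge0// ltW.
- by apply/measurable_EFinP; apply: measurable_funM.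
- by apply/measurable_EFinP; exact: measurable_row_continuous.
move=> t _; rewrite -EFinM lee_fin.
have [/allP H|/allPn[i _ ti]] := boolP (all (fun i => `|tnth t i : R| <= r / 2) (enum 'I_d)).
  rewrite big1 ?mulr1.
    apply: Hr; rewrite mx_norm_ball /ball_/= sub0r normrN.
    apply: (@le_lt_trans _ _ (r / 2)); last by lra.
    by apply: norm_le_coord; [exact: ltW|move=> i; rewrite mxE; apply: H; rewrite mem_enum].
  move=> i _; rewrite /u indicE mem_set//= in_itv/= -ler_norml; apply: H.
  by rewrite mem_enum.
rewrite (bigD1 i)//= /u indicE memNset ?mul0r ?mulr0//.
by rewrite /= in_itv/= -ler_norml; exact/negP.
Qed.

End real_integral_theory.

Section fubini_rows.
Variables (R : realType) (d : nat).
Local Notation V := 'rV[R]_d.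
Local Notation mu := (lebesgue_tuple R d).

Lemma smooth_dotp (x : V) : smooth (dotp x).
Proof. by apply: smooth_sum => i; apply: smoothZ; exact: smooth_coord. Qed.

Lemma dotpC (x y : V) : dotp x y = dotp y x.
Proof. by apply: eq_bigr => i _; rewrite mulrC. Qed.

Lemma continuous_kernel (k : R -> R) (f : V -> R) x : continuous k -> continuous f ->
  continuous (fun y : V => k (dotp x y) * f y).
Proof.
move=> ck cf y; apply: continuousM; last exact: cf.
apply: (continuous_comp (f := dotp x)); last exact: ck.
exact: (smooth_continuous (smooth_dotp x)).
Qed.

Lemma rint_kernel (k : R -> R) (f : V -> R) x : continuous k -> (forall y, `|k y| <= 1) ->
  continuous f -> rint f -> rint (fun y => k (dotp x y) * f y).
Proof.
move=> ck k1 cf rf.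
apply: (@rint_le _ _ _ (fun y => `|f y|)).
- exact: (integrable_norm rf).
- exact: continuous_kernel.
- by move=> y; rewrite normrM ler_piMl.
Qed.

Lemma real_integral_swap (k : R -> R) (f g : V -> R) :
  continuous k -> (forall y, `|k y| <= 1) ->
  continuous f -> rint f -> continuous g -> rint g ->
  real_integral (fun x => f x * real_integral (fun y => k (dotp x y) * g y)) =
  real_integral (fun y => g y * real_integral (fun x => k (dotp y x) * f x)).
Proof.
move=> ck k1 cf rf cg rg.
pose T := d.-tuple (measurableTypeR R).
pose h (p : T * T) : R := f (row_of p.1) * (k (dotp (row_of p.1) (row_of p.2)) * g (row_of p.2)).
have mh : measurable_fun setT (h : _ -> measurableTypeR R).
  apply: measurable_funM.
    by apply: (measurableT_comp (f := fun t : T => f (row_of t) : measurableTypeR R)) => //;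
      exact: measurable_row_continuous.
  apply: measurable_funM; last first.
    by apply: (measurableT_comp (f := fun t : T => g (row_of t) : measurableTypeR R)) => //;
      exact: measurable_row_continuous.
  apply: (measurableT_comp (f := k : measurableTypeR R -> measurableTypeR R)).
    exact: continuous_measurable_fun.
  apply: measurable_sum => i; apply: measurable_funM.
    by apply: (measurableT_comp (f := fun t : T => row_of t 0 i : measurableTypeR R)) => //;
      exact: measurable_row_coord.
  by apply: (measurableT_comp (f := fun t : T => row_of t 0 i : measurableTypeR R)) => //;
    exact: measurable_row_coord.
have mh' : measurable_fun setT (EFin \o h) by exact/measurable_EFinP.
have mah : measurable_fun setT (fun p => `|(EFin \o h) p|%E) by exact: measurableT_comp.
have rng : rint (fun y => `|g y|) by exact: (integrable_norm rg).
have rnf : rint (fun y => `|f y|) by exact: (integrable_norm rf).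
have ih : (mu \x mu)%E.-integrable setT (EFin \o h).
  apply/integrable12ltyP => //.
  apply: (@le_lt_trans _ _ (\int[mu]_x (`|f (row_of x)| * real_integral (fun y => `|g y|))%:E)%E).
    apply: ge0_le_integral => //.
    - by move=> x _; apply: integral_ge0 => y _; exact: abse_ge0.
    - exact: (@measurable_fun_fubini_tonelli_F _ _ _ _ R mu (fun p => `|(EFin \o h) p|%E) mah).
    - apply/measurable_EFinP; apply: measurable_funM => //.
      by apply: measurableT_comp => //; exact: measurable_row_continuous.
    move=> x _; rewrite -real_integralZ// -real_integral_EFin; last exact: rintZ.
    apply: ge0_le_integral => //.
    - exact: (measurableT_comp (f := fun p => `|(EFin \o h) p|%E) mah (measurable_pair1 x)).
    - apply/measurable_EFinP; apply: measurable_funM => //.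
      by apply: measurableT_comp => //; exact: measurable_row_continuous.
    by move=> y _; rewrite lee_fin /h/= !normrM ler_wpM2l// ler_piMl.
  rewrite (real_integral_EFin (f := fun x => `|f x| * real_integral (fun y => `|g y|))); first exact: ltry.
  rewrite (_ : (fun x => _) = (fun x => real_integral (fun y => `|g y|) * `|f x|)).
    exact: rintZ.
  by apply/funext => x; rewrite mulrC.
have RE (F : V -> R) : real_integral F = fine (\int[mu]_t (F (row_of t))%:E)%E by [].
rewrite [LHS]RE [RHS]RE; congr fine.
transitivity (\int[mu]_x \int[mu]_y (EFin \o h) (x, y))%E.
  apply: eq_integral => x _; rewrite -real_integralZ; last exact: rint_kernel.
  by rewrite -real_integral_EFin//; apply: rintZ; exact: rint_kernel.
rewrite (Fubini ih); apply: eq_integral => y _.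
rewrite -real_integralZ; last exact: rint_kernel.
rewrite -real_integral_EFin; last by apply: rintZ; exact: rint_kernel.
by apply: eq_integral => x _; rewrite /h/= dotpC mulrCA [in RHS]mulrCA [g _ * _]mulrC.
Qed.

End fubini_rows.

(** * Cosine and sine transforms *)

Section trigonometric_kernel.
Variable R : realType.

(** The boolean is the parity of the kernel: differentiation replaces [b] by [~~ b] up to the sign
    [tsign b], so that one argument serves both transforms. *)
Definition trig (b : bool) (u : R) : R := if b then sin (2 * pi * u) else cos (2 * pi * u).

Definition tsign (b : bool) : R := if b then 1 else -1.

Lemma norm_tsign b : `|tsign b| = 1.
Proof. by case: b; rewrite /tsign ?normrN normr1. Qed.

Lemma norm_trig b u : `|trig b u| <= 1.
Proof. by case: b; rewrite /trig ler_norml ?sin_geN1 ?sin_le1 ?cos_geN1 ?cos_le1. Qed.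

Lemma is_derive_trig b (u : R) : is_derive u 1 (trig b) (2 * pi * tsign b * trig (~~ b) u).
Proof.
have D : is_derive u 1 (fun u : R => 2 * pi * u) (2 * pi).
  by apply: is_derive_eq; rewrite /GRing.scale/= mulr1.
case: b; rewrite /trig /tsign /=.
  have D' : is_derive ((fun u : R => 2 * pi * u) u) 1 (@sin R) (cos (2 * pi * u)) by exact: is_derive_sin.
  have := @is_derive1_comp R (@sin R) (fun u : R => 2 * pi * u) u _ _ D' D.
  by move=> H; apply: (is_derive_eq H); ring.
have D' : is_derive ((fun u : R => 2 * pi * u) u) 1 (@cos R) (- sin (2 * pi * u)) by exact: is_derive_cos.
have := @is_derive1_comp R (@cos R) (fun u : R => 2 * pi * u) u _ _ D' D.
by move=> H; apply: (is_derive_eq H); ring.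
Qed.

Lemma continuous_trig b : continuous (trig b).
Proof.
by move=> u; apply: differentiable_continuous; apply/derivable1_diffP; case: (is_derive_trig b u).
Qed.

Lemma trig_mvt b (u h : R) : exists c, trig b (u + h) - trig b u = h * (2 * pi * tsign b * trig (~~ b) (u + c)) /\ `|c| <= `|h|.
Proof.
have D (y : R) : derivable (trig b) y 1 by case: (is_derive_trig b y).
have [c ch] := @line_mvt R R (trig b) 1 u h D.
rewrite ![_ *: 1]mulr1 => ->; exists c; split => //; congr (_ * _).
by case: (is_derive_trig b (u + c)).
Qed.

Lemma pi2_ge0 : 0 <= 2 * pi :> R.
Proof. by rewrite mulr_ge0// pi_ge0. Qed.

Lemma trig_lipschitz b (u v : R) : `|trig b u - trig b v| <= 2 * pi * `|u - v|.
Proof.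
have [c [E _]] := trig_mvt b v (u - v); move: E; rewrite [v + _]addrC subrK => ->.
rewrite normrM mulrC ler_wpM2r// normrM -[leRHS]mulr1; apply: ler_pM => //.
  by rewrite normrM norm_tsign mulr1 (ger0_norm pi2_ge0).
exact: norm_trig.
Qed.

Lemma trig_taylor b (u h : R) :
  `|trig b (u + h) - trig b u - h * (2 * pi * tsign b * trig (~~ b) u)| <= (2 * pi) ^+ 2 * h ^+ 2.
Proof.
have [c [-> ch]] := trig_mvt b u h.
rewrite -mulrBr -mulrBr !normrM norm_tsign mulr1 -normrM (ger0_norm pi2_ge0).
have := trig_lipschitz (~~ b) (u + c) u; rewrite [u + c]addrC addrK => H.
rewrite -[h ^+ 2]real_normK ?num_real// 2!expr2.
have p0 := pi2_ge0; move: (2 * pi) p0 H => p p0 H.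
apply: (@le_trans _ _ (`|h| * (p * (p * `|h|)))).
  rewrite ler_wpM2l// ler_wpM2l//; apply: le_trans H _; exact: ler_wpM2l.
by rewrite le_eqVlt; apply/orP; left; apply/eqP; ring.
Qed.

End trigonometric_kernel.

Section fourier.
Variables (R : realType) (d : nat).
Local Notation V := 'rV[R]_d.
Local Notation e_ i := (delta_mx 0 i : V).
Implicit Types (f g : V -> R) (x y : V) (b : bool).

Lemma continuous_add f g : continuous f -> continuous g -> continuous (fun x => f x + g x).
Proof. by move=> cf cg x; apply: continuousD; [exact: cf|exact: cg]. Qed.

Lemma continuous_sub f g : continuous f -> continuous g -> continuous (fun x => f x - g x).
Proof.
move=> cf cg; apply: (continuous_add cf (g := fun x => - g x)) => x.
by apply: continuousN; exact: cg.
Qed.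

Lemma continuous_mul f g : continuous f -> continuous g -> continuous (fun x => f x * g x).
Proof. by move=> cf cg x; apply: continuousM; [exact: cf|exact: cg]. Qed.

Lemma continuous_scale (c : R) f : continuous f -> continuous (fun x => c * f x).
Proof. by move=> cf; apply: continuous_mul => //; exact: cst_continuous. Qed.

Lemma dotpBl x z y : dotp (x - z) y = dotp x y - dotp z y.
Proof. by rewrite /dotp -sumrB/=; apply: eq_bigr => i _; rewrite !mxE mulrBl. Qed.

Lemma dotpDl x z y : dotp (x + z) y = dotp x y + dotp z y.
Proof. by rewrite /dotp -big_split/=; apply: eq_bigr => i _; rewrite mxE mulrDl. Qed.

Lemma dotpZl (t : R) x y : dotp (t *: x) y = t * dotp x y.
Proof. by rewrite /dotp mulr_sumr; apply: eq_bigr => i _; rewrite mxE mulrA. Qed.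

Lemma dotp_delta i y : dotp (e_ i) y = y 0 i.
Proof.
rewrite /dotp (bigD1 i)//= big1 ?addr0 => [|k ki]; first by rewrite mxE !eqxx mul1r.
by rewrite mxE (negbTE ki) mul0r.
Qed.

Lemma norm_scale_delta (t : R) i : `|t *: e_ i| <= `|t|.
Proof.
by apply: norm_le_coord => // k; rewrite !mxE; case: (_ && _); rewrite ?mulr1 ?mulr0 ?normr0.
Qed.

Lemma partial_dotp x y i : partial i (dotp x) y = x 0 i.
Proof.
apply: partialE; apply: (@is_derive_quad _ _ (dotp x) y _ _ 0 1) => // t _.
rewrite dotpC dotpDl dotpZl dotp_delta (dotpC y) mul0r (_ : _ - _ = 0) ?normr0//.
move: (dotp x y) (t * _) => a c; ring.
Qed.

Lemma norm_dotp x y : `|dotp x y| <= d%:R * (`|x| * `|y|).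
Proof.
apply: (le_trans (ler_norm_sum _ _ _)).
apply: (@le_trans _ _ (\sum_(i < d) `|x| * `|y|)); last by rewrite sumr_const card_ord mulr_natl.
apply: ler_sum => i _; rewrite normrM; apply: ler_pM => //; exact: le_coord_norm.
Qed.

Lemma rschwartz_continuous f : rschwartz f -> continuous f.
Proof. by move=> /rschwartz_smooth/smooth_continuous. Qed.

Lemma rschwartz_bound f M : rschwartz f -> exists2 C, 0 <= C & forall x, `|f x| <= C * weight M x.
Proof. by move=> rf; have [C C0 H] := sbounded_bound M [::] rf; exists C => // x; exact: (H tt). Qed.

Lemma rschwartz_rint f : rschwartz f -> rint f.
Proof.
move=> rf; have [C _ H] := rschwartz_bound (2 * d) rf.
exact: rint_weight (leqnn _) (rschwartz_continuous rf) H.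
Qed.

Lemma ft_key : {F : bool -> (V -> R) -> V -> R |
  forall b f x, F b f x = real_integral (fun y => trig b (dotp x y) * f y)}.
Proof. by exists (fun b f x => real_integral (fun y => trig b (dotp x y) * f y)). Qed.

(* The cosine ([b = false]) and sine ([b = true]) transforms, sealed so that
   unification does not unfold integrals. *)
Definition ft b f : V -> R := sval ft_key b f.

Lemma ftE b f x : ft b f x = real_integral (fun y => trig b (dotp x y) * f y).
Proof. exact: (svalP ft_key). Qed.

Lemma rintB f g : rint f -> rint g -> rint (fun x => f x - g x).
Proof.
move=> rf rg; have -> : (fun x => f x - g x) = (fun x => f x + (-1) * g x).
  by apply/funext => x; rewrite mulN1r.
by apply: rintD => //; exact: rintZ.
Qed.

Lemma rint_trig b f x : continuous f -> rint f -> rint (fun y => trig b (dotp x y) * f y).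
Proof. by move=> cf rf; apply: rint_kernel => //; [exact: continuous_trig|exact: norm_trig]. Qed.

Lemma rint_rtrig b f x : rschwartz f -> rint (fun y => trig b (dotp x y) * f y).
Proof. by move=> rf; apply: rint_trig; [exact: rschwartz_continuous|exact: rschwartz_rint]. Qed.

Lemma continuous_rtrig b f x : rschwartz f -> continuous (fun y => trig b (dotp x y) * f y).
Proof.
by move=> rf; apply: continuous_kernel; [exact: continuous_trig|exact: rschwartz_continuous].
Qed.

Lemma ftD b f g : rschwartz f -> rschwartz g ->
  ft b (fun x => f x + g x) = (fun x => ft b f x + ft b g x).
Proof.
move=> rf rg; apply/funext => x; rewrite !ftE -real_integralD; try exact: rint_rtrig.
by congr real_integral; apply/funext => y; rewrite mulrDr.
Qed.

Lemma ftZ b f (c : R) : rschwartz f -> ft b (fun x => c * f x) = (fun x => c * ft b f x).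
Proof.
move=> rf; apply/funext => x; rewrite !ftE -real_integralZ; last exact: rint_rtrig.
by congr real_integral; apply/funext => y; rewrite mulrCA.
Qed.

Lemma ft_swap b f g : rschwartz f -> rschwartz g ->
  real_integral (fun x => f x * ft b g x) = real_integral (fun x => g x * ft b f x).
Proof.
move=> rf rg; under eq_fun do rewrite ftE; under [in RHS]eq_fun do rewrite ftE.
apply: real_integral_swap; try exact: rschwartz_rint.
- exact: continuous_trig.
- exact: norm_trig.
- exact: rschwartz_continuous.
- exact: rschwartz_continuous.
Qed.

Lemma weight_norm M x : weight M.+1 x * `|x| <= weight M x.
Proof.
rewrite /weight exprS invfM mulrC mulrA ler_piMl//.
by rewrite ler_pdivrMr ?ltr_wpDr// mul1r lerDr.
Qed.

Lemma ft_lipschitz b f x : rschwartz f ->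
  exists2 C, 0 <= C & forall z, `|ft b f z - ft b f x| <= C * `|z - x|.
Proof.
move=> rf; have [C C0 H] := rschwartz_bound (2 * d).+1 rf.
pose D := 2 * pi * d%:R * C * weight_mass R d.
exists D => [|z]; first by rewrite !mulr_ge0// ?pi_ge0// weight_mass_ge0.
rewrite !ftE -real_integralB; try exact: rint_rtrig.
have -> : D * `|z - x| = (2 * pi * d%:R * C * `|z - x|) * weight_mass R d by rewrite /D; ring.
apply: (@real_integral_weight _ _ _ (2 * d)) => //.
- by apply: continuous_sub; exact: continuous_rtrig.
- by rewrite !mulr_ge0// pi_ge0.
move=> y; rewrite -mulrBl normrM.
apply: (@le_trans _ _ ((2 * pi * (d%:R * (`|z - x| * `|y|))) * (C * weight (2 * d).+1 y))).
  apply: ler_pM => //; apply: (le_trans (trig_lipschitz _ _ _)).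
  by rewrite -dotpBl ler_wpM2l ?pi2_ge0// norm_dotp.
rewrite (_ : _ * _ = 2 * pi * d%:R * C * `|z - x| * (weight (2 * d).+1 y * `|y|)); last by ring.
rewrite ler_wpM2l ?weight_norm//.
by rewrite !mulr_ge0// pi_ge0.
Qed.

Lemma is_derive_ft b f x i : rschwartz f ->
  is_derive x (e_ i) (ft b f) (ft (~~ b) (fun y => 2 * pi * tsign R b * (f y * y 0 i)) x).
Proof.
move=> rf.
have rfi : rschwartz (fun y => f y * y 0 i) by exact: sbounded_coord rf.
(* Two orders of decay beyond integrability pay for the factor |y|^2 in the second-order remainder
   of the kernel. *)
have [C C0 H] := rschwartz_bound (2 * d).+2 rf.
apply: (@is_derive_quad _ _ (ft b f) x _ _ ((2 * pi) ^+ 2 * C * weight_mass R d) 1) => // t t1.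
have rg : rschwartz (fun y => 2 * pi * tsign R b * (f y * y 0 i)) by exact: sboundedZ.
rewrite !ftE -real_integralZ; last exact: rint_rtrig.
rewrite -real_integralB; try exact: rint_rtrig.
rewrite -real_integralB; last 2 first.
- apply: rintD; first exact: rint_rtrig.
  by under eq_fun do rewrite -mulN1r; apply: rintZ; exact: rint_rtrig.
- by apply: rintZ; exact: rint_rtrig.
have -> : (2 * pi) ^+ 2 * C * weight_mass R d * t ^+ 2 = ((2 * pi) ^+ 2 * C * t ^+ 2) * weight_mass R d by ring.
apply: (@real_integral_weight _ _ _ (2 * d)) => //.
- apply: continuous_sub; last by apply: continuous_scale; exact: continuous_rtrig.
  by apply: continuous_sub; exact: continuous_rtrig.
- by rewrite mulr_ge0 ?sqr_ge0// mulr_ge0 ?sqr_ge0.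
move=> y; rewrite dotpDl dotpZl dotp_delta.
have := trig_taylor b (dotp x y) (t * y 0 i).
set A := trig b _; set B := trig b _; set E := trig (~~ b) _ => T.
rewrite (_ : _ - _ - _ = (A - B - t * y 0 i * (2 * pi * tsign R b * E)) * f y); last by ring.
rewrite normrM.
apply: (@le_trans _ _ ((2 * pi) ^+ 2 * (t * `|y|) ^+ 2 * (C * weight (2 * d).+2 y))).
  apply: ler_pM => //; apply: (le_trans T); rewrite ler_wpM2l ?sqr_ge0//.
  rewrite !exprMn ler_wpM2l ?sqr_ge0// -real_normK ?num_real// lerXn2r ?nnegrE//.
  exact: le_coord_norm.
have W : weight (2 * d).+2 y * (`|y| * `|y|) <= weight (2 * d) y.
  rewrite mulrA; apply: le_trans (weight_norm _ _).
  by rewrite ler_wpM2r// weight_norm.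
rewrite (_ : _ * _ = (2 * pi) ^+ 2 * C * t ^+ 2 * (weight (2 * d).+2 y * (`|y| * `|y|))); last by ring.
by rewrite ler_wpM2l// mulr_ge0 ?sqr_ge0// mulr_ge0 ?sqr_ge0.
Qed.

Lemma partial_ft b f i : rschwartz f ->
  partial i (ft b f) = ft (~~ b) (fun y => 2 * pi * tsign R b * (f y * y 0 i)).
Proof. by move=> rf; apply/funext => x; apply: partialE; exact: is_derive_ft. Qed.

Lemma smooth_ft b f : rschwartz f -> smooth (ft b f).
Proof.
move=> rf; apply: (@smooth_coind _ _ (fun h => exists b f, rschwartz f /\ h = ft b f)).
- move=> _ [c [g [rg ->]]] x; have [C C0 H] := ft_lipschitz c x rg.
  by apply: (@continuous_lipschitz _ _ _ x C 1) => // y _; exact: H.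
- by move=> _ x i [c [g [rg ->]]]; case: (is_derive_ft c x i rg).
- move=> _ i [c [g [rg ->]]]; rewrite partial_ft//.
  exists (~~ c), (fun y => 2 * pi * tsign R c * (g y * y 0 i)); split => //.
  by apply: sboundedZ; exact: sbounded_coord rg.
- by exists b, f.
Qed.

Lemma weight_shift M x y : `|y| <= 1 -> weight M (x + y) <= 2 ^+ M * weight M x.
Proof.
move=> y1; rewrite /weight -expr_div_n -exprVn lerXn2r ?nnegrE ?divr_ge0 ?invr_ge0 ?addr_ge0//.
rewrite -div1r ler_pdivlMr ?ltr_wpDr// mul1r.
rewrite ler_pdivrMl ?ltr_wpDr//.
have := ler_normB (x + y) y; rewrite addrK => H.
have := normr_ge0 (x + y); move: H y1; move: (`|x|) (`|y|) (`|x + y|) => p q r; lra.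
Qed.

(** By translation invariance the increment of [f] by t along [e_i] integrates to 0, so t times the
    integral is O(t^2). *)
Lemma integral_partial f i : rschwartz f -> real_integral (partial i f) = 0.
Proof.
move=> rf.
have rpf : rschwartz (partial i f) by exact: sbounded_partial rf.
have rppf : rschwartz (partial i (partial i f)) by exact: sbounded_partial rpf.
have [C C0 H] := rschwartz_bound (2 * d) rppf.
set I := real_integral _.
pose D := 2 ^+ (2 * d) * C * weight_mass R d.
have D0 : 0 <= D by rewrite !mulr_ge0// ?exprn_ge0// weight_mass_ge0.
suff K t : 0 < t -> t <= 1 -> `|I| <= D * t.
  apply/eqP; rewrite -normr_le0; apply/ler_addgt0Pr => e e0; rewrite add0r.
  (* This value of t is at most 1 and satisfies D t <= e. *)
  have De : 0 < e / (D + e) by rewrite divr_gt0// ltr_wpDl.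
  apply: (le_trans (K _ De _)).
    by rewrite ler_pdivrMr ?ltr_wpDl// mul1r lerDr.
  rewrite mulrA ler_pdivrMr ?ltr_wpDl// mulrC ler_pM2l// lerDl; exact: ltW.
move=> t0 t1.
pose u := t *: e_ i.
have uE y : affine (const_mx 1) u y = y + u by apply/rowP => k; rewrite !mxE mul1r.
have sa : smooth (fun y => f (affine (const_mx 1) u y)).
  by apply: smooth_affine; exact: rschwartz_smooth.
have ri : rint (fun y => f (affine (const_mx 1) u y)).
  have [C' _ H'] := rschwartz_bound (2 * d) rf.
  apply: (@rint_weight _ _ _ (2 * d) (`|C'| * 2 ^+ (2 * d))) => //; first exact: smooth_continuous.
  move=> y; rewrite uE; apply: (le_trans (H' _)); rewrite -mulrA.
  apply: (@le_trans _ _ (`|C'| * weight (2 * d) (y + u))).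
    by rewrite ler_wpM2r ?weight_ge0// ler_norm.
  by rewrite ler_wpM2l//; apply: weight_shift; apply: (le_trans (norm_scale_delta _ _)); rewrite gtr0_norm.
have E : real_integral (fun y => f (affine (const_mx 1) u y)) = real_integral f.
  rewrite real_integral_affine.
  - by rewrite big1 ?mul1r// => k _; rewrite mxE normr1 invr1.
  - exact: rschwartz_rint.
  - exact: rschwartz_continuous.
  - by move=> k; rewrite mxE oner_neq0.
have K : `|real_integral (fun y => f (affine (const_mx 1) u y) - f y - t * partial i f y)| <= D * t ^+ 2.
  have -> : D * t ^+ 2 = (2 ^+ (2 * d) * C * t ^+ 2) * weight_mass R d by rewrite /D; ring.
  apply: (@real_integral_weight _ _ _ (2 * d)) => //.
  - apply: continuous_sub; last by apply: continuous_scale; exact: rschwartz_continuous.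
    by apply: continuous_sub; [exact: smooth_continuous|exact: rschwartz_continuous].
  - by rewrite mulr_ge0 ?sqr_ge0// mulr_ge0 ?exprn_ge0.
  move=> y; rewrite uE mulrAC.
  apply: line_taylor2.
  - by move=> z; apply: smooth_derivable; exact: rschwartz_smooth.
  - by move=> z; apply: smooth_derivable; exact: rschwartz_smooth.
  move=> v vt; apply: (le_trans (H _)); rewrite -mulrA mulrCA ler_wpM2l//.
  apply: weight_shift; apply: (le_trans (norm_scale_delta _ _)); apply: (le_trans vt).
  by rewrite gtr0_norm.
move: K; rewrite real_integralB; last 2 first.
- rewrite (_ : (fun y => _) = fun y => f (affine (const_mx 1) u y) + (-1) * f y).
    by apply: rintD => //; apply: rintZ; exact: rschwartz_rint.
  by apply/funext => y; rewrite mulN1r.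
- by apply: rintZ; exact: rschwartz_rint.
rewrite real_integralB//; last exact: rschwartz_rint.
rewrite E subrr sub0r normrN real_integralZ; last exact: rschwartz_rint.
by rewrite -/I normrM gtr0_norm// expr2 mulrA [_ * t]mulrC -mulrA ler_pM2l// mulrC.
Qed.

Lemma smooth_trig b x : smooth (fun y : V => trig b (dotp x y)).
Proof.
apply: (@smooth_coind _ _ (fun h => exists c (b : bool), h = fun y : V => c * trig b (dotp x y))).
- move=> _ [c [a ->]]; apply: continuous_scale => y.
  apply: (continuous_comp (f := dotp x)); last exact: continuous_trig.
  exact: (smooth_continuous (smooth_dotp x)).
- move=> _ y i [c [a ->]]; apply: derivableM; first exact: derivable_cst.
  by case: (is_derive_comp (is_derive_trig a (dotp x y)) (smooth_is_derive y i (smooth_dotp x))).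
- move=> _ i [c [a ->]]; exists (c * (2 * pi * tsign R a * x 0 i)), (~~ a).
  apply/funext => y; apply: partialE; apply: is_derive_eq.
    apply: is_deriveM.
    exact: (is_derive_comp (is_derive_trig a (dotp x y)) (smooth_is_derive y i (smooth_dotp x))).
  rewrite partial_dotp /GRing.scale/= mulr0 addr0; ring.
- by exists 1, b; apply/funext => y; rewrite mul1r.
Qed.

Lemma partial_trig b x i :
  partial i (fun y : V => trig b (dotp x y)) = (fun y => 2 * pi * tsign R b * x 0 i * trig (~~ b) (dotp x y)).
Proof.
apply/funext => y; apply: partialE; apply: is_derive_eq.
  exact: (is_derive_comp (is_derive_trig b (dotp x y)) (smooth_is_derive y i (smooth_dotp x))).
by rewrite partial_dotp mulrAC.
Qed.

Lemma rschwartz_trig b f x : rschwartz f -> rschwartz (fun y => f y * trig b (dotp x y)).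
Proof.
move=> rf; apply: (sboundedM (m := 0) rf); first by move=> _; exact: smooth_trig.
move=> s; elim/last_ind: s b => [|s i IH] b.
  by exists 1 => _ y _ /=; rewrite expr0 mulr1 norm_trig.
have [C HC] := IH (~~ b).
exists (`|2 * pi * tsign R b * x 0 i| * C) => j y Py.
rewrite iter_partial_rcons partial_trig iter_partialZ; last exact: smooth_trig.
by rewrite normrM -[leRHS]mulrA; apply: ler_wpM2l => //; exact: (HC j).
Qed.

(** Integration by parts: the derivative of [f] times the kernel of opposite parity integrates to 0,
    and the derivative of that kernel brings back [trig b]. *)
Lemma coord_ft b f x i : rschwartz f ->
  x 0 i * ft b f x = tsign R b / (2 * pi) * ft (~~ b) (partial i f) x.
Proof.
move=> rf.
have rpf : rschwartz (partial i f) by exact: sbounded_partial rf.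
have := integral_partial i (rschwartz_trig (~~ b) x rf).
rewrite partialM; [|exact: rschwartz_smooth|exact: smooth_trig].
rewrite partial_trig negbK.
have -> : (fun y => partial i f y * trig (~~ b) (dotp x y) +
    f y * (2 * pi * tsign R (~~ b) * x 0 i * trig b (dotp x y))) =
  (fun y => trig (~~ b) (dotp x y) * partial i f y +
    (2 * pi * tsign R (~~ b) * x 0 i) * (trig b (dotp x y) * f y)).
  by apply/funext => y; rewrite mulrC; congr (_ + _); rewrite mulrCA [f y * _]mulrC.
rewrite real_integralD; [|exact: rint_rtrig|by apply: rintZ; exact: rint_rtrig].
rewrite real_integralZ; last exact: rint_rtrig.
rewrite -!ftE.
have p0 : 2 * pi != 0 :> R by rewrite gt_eqF// mulr_gt0// pi_gt0.
move=> /eqP; rewrite addr_eq0 => /eqP ->.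
by move: (2 * pi) p0 => p p0; case: b; rewrite /tsign /=; field.
Qed.

Lemma ft_bounded (I : Type) (f : I -> V -> R) b : sbounded f ->
  exists2 C : R, 0 <= C & forall i x, `|ft b (f i) x| <= C.
Proof.
move=> sf; have [C C0 H] := sbounded_bound (2 * d) [::] sf.
exists (C * weight_mass R d) => [|i x]; first by rewrite mulr_ge0// weight_mass_ge0.
have rf := sbounded_rschwartz i sf.
rewrite ftE; apply: (@real_integral_weight _ _ _ (2 * d)) => //; first exact: continuous_rtrig.
move=> y; rewrite normrM; apply: le_trans (H i y).
by rewrite ler_piMl// norm_trig.
Qed.

Lemma ft_bounded_monomial (I : Type) (f : I -> V -> R) b (l : seq 'I_d) : sbounded f ->
  exists2 C : R, 0 <= C & forall i x, `|(\prod_(k <- l) x 0 k) * ft b (f i) x| <= C.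
Proof.
elim: l b f => [|k l IH] b f sf.
  have [C C0 H] := ft_bounded b sf; exists C => // i x; rewrite big_nil mul1r; exact: H.
have [C C0 H] := IH (~~ b) _ (sbounded_partial k sf).
exists (`|tsign R b / (2 * pi)| * C) => [|i x]; first by rewrite mulr_ge0.
rewrite big_cons mulrAC [_ * ft b _ _]coord_ft; last exact: sbounded_rschwartz sf.
by rewrite normrM [`|_ * ft _ _ _|]normrM -mulrA ler_wpM2l// -normrM mulrC.
Qed.

(** A coordinate of maximal size accounts for the left side. The exponent is positive because in
    dimension 0 the sum is empty. *)
Lemma pow_norm_le_sum x M : `|x| ^+ M.+1 <= \sum_(k < d) `|x 0 k| ^+ M.+1.
Proof.
have [x0|x0] := eqVneq `|x| 0; first by rewrite x0 expr0n /= sumr_ge0// => k _; exact: exprn_ge0.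
have [[i0 i] /= E] := mx_norm_neq0 x0.
rewrite -[`|x|]/(mx_norm x) E (ord1 i0) (bigD1 i)//= lerDl.
by apply: sumr_ge0 => k _; exact: exprn_ge0.
Qed.

Lemma weight_of_monomials M x (a A B : R) : `|a| <= A ->
  (forall k : 'I_d, `|x 0 k| ^+ M.+1 * `|a| <= B) ->
  `|a| <= 2 ^+ M.+1 * (A + d%:R * B) * weight M.+1 x.
Proof.
move=> aA aB.
have H : `|x| ^+ M.+1 * `|a| <= d%:R * B.
  apply: (@le_trans _ _ (\sum_(k < d) `|x 0 k| ^+ M.+1 * `|a|)).
    by rewrite -mulr_suml ler_wpM2r// pow_norm_le_sum.
  apply: (@le_trans _ _ (\sum_(k < d) B)); first exact: ler_sum.
  by rewrite sumr_const card_ord mulr_natl.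
rewrite /weight ler_pdivlMr ?exprn_gt0 ?ltr_wpDr//.
have P : (1 + `|x|) ^+ M.+1 <= 2 ^+ M.+1 * (1 + `|x| ^+ M.+1).
  have [x1|x1] := leP `|x| 1.
    apply: (@le_trans _ _ (2 ^+ M.+1)).
      by rewrite lerXn2r ?nnegrE ?addr_ge0//; lra.
    by rewrite ler_peMr ?exprn_ge0// lerDl exprn_ge0.
  apply: (@le_trans _ _ (2 ^+ M.+1 * `|x| ^+ M.+1)).
    by rewrite -exprMn lerXn2r ?nnegrE ?addr_ge0// ?mulr_ge0//; lra.
  by rewrite ler_wpM2l ?exprn_ge0// lerDr.
apply: (@le_trans _ _ (`|a| * (2 ^+ M.+1 * (1 + `|x| ^+ M.+1)))); first by rewrite ler_wpM2l.
by rewrite mulrCA ler_wpM2l ?exprn_ge0// mulrDr mulr1 mulrC mulrC [`|a| * _ ^+ _]mulrC lerD.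
Qed.

(** A derivative of a transform is the transform of another bounded family, so the bounds in
    [sbounded_ft] need only be found for transforms themselves. *)
Lemma iter_partial_ft (I : Type) (f : I -> V -> R) b s : sbounded f ->
  exists b' (g : I -> V -> R), sbounded g /\ forall i, iter_partial s (ft b (f i)) = ft b' (g i).
Proof.
elim/last_ind: s b f => [|s k IH] b f sf; first by exists b, f.
have sf' : sbounded (fun i y => 2 * pi * tsign R b * (f i y * y 0 k)).
  by apply: sboundedZ; exact: sbounded_coord.
have [b' [g [sg H]]] := IH (~~ b) _ sf'.
exists b', g; split => // i; rewrite iter_partial_rcons -H partial_ft//.
exact: sbounded_rschwartz sf.
Qed.

Lemma sbounded_ft (I : Type) (f : I -> V -> R) b : sbounded f -> sbounded (fun i => ft b (f i)).
Proof.
move=> sf; split=> [i|M s]; first by apply: smooth_ft; exact: sbounded_rschwartz sf.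
have [b' [g [sg E]]] := iter_partial_ft b s sf.
have [A A0 HA] := ft_bounded b' sg.
pose P (k : 'I_d) (B : R) := forall i x, `|x 0 k| ^+ M.+1 * `|ft b' (g i) x| <= B.
have [B HB] : exists B, forall k, P k B.
  apply: finite_choice => [k C C' CC H i x|k]; first exact: le_trans (H i x) CC.
  have [C C0 H] := ft_bounded_monomial b' (nseq M.+1 k) sg; exists C => i x.
  have := H i x; rewrite normrM (_ : \prod_(l <- _) _ = x 0 k ^+ M.+1) ?normrX//.
  by rewrite big_nseq; elim: M.+1 => //= m ->; rewrite exprS.
exists (2 ^+ M.+1 * (A + d%:R * `|B|)) => i x _.
rewrite E; apply: (le_trans (weight_of_monomials (HA i x)
  (fun k => le_trans (HB k i x) (ler_norm B)))).
rewrite ler_wpM2l ?le_weight//.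
by rewrite mulr_ge0 ?exprn_ge0// addr_ge0// mulr_ge0.
Qed.

Lemma rschwartz_ft f b : rschwartz f -> rschwartz (ft b f).
Proof. exact: sbounded_ft. Qed.

Definition inv_row (c : V) : V := \row_i (c 0 i)^-1.

Lemma dotp_affine0 (c x y : V) : dotp x (affine c 0 y) = dotp (affine c 0 x) y.
Proof. by apply: eq_bigr => i _; rewrite !mxE !addr0; ring. Qed.

Lemma affine_inv (c x : V) : (forall i, c 0 i != 0) -> affine (inv_row c) 0 (affine c 0 x) = x.
Proof. by move=> c0; apply/rowP => i; rewrite !mxE !addr0 mulrA mulVf// mul1r. Qed.

Lemma weight_affine (c b' : V) M x : (forall i, c 0 i != 0) ->
  weight M (affine c b' x) <= (1 + (1 + `|b'|) * `|inv_row c|) ^+ M * (1 + `|b'|) ^+ M * weight M x.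
Proof.
move=> c0; rewrite -exprMn /weight -exprVn -[in leRHS]exprVn -exprMn.
have b1 : 0 < 1 + `|b'| by rewrite ltr_wpDr.
have a1 : 0 < 1 + `|affine c b' x| by rewrite ltr_wpDr.
have x1 : 0 < 1 + `|x| by rewrite ltr_wpDr.
have i0 : 0 <= `|inv_row c| by [].
have K0 : 0 <= (1 + (1 + `|b'|) * `|inv_row c|) * (1 + `|b'|).
  by rewrite mulr_ge0 ?addr_ge0// mulr_ge0// addr_ge0.
rewrite lerXn2r ?nnegrE ?mulr_ge0 ?invr_ge0 ?(ltW a1) ?(ltW x1)//.
rewrite ler_pdivlMr// mulrC ler_pdivrMr//.
have H : `|x| <= `|inv_row c| * (`|affine c b' x| + `|b'|).
  apply: norm_le_coord => [|i]; first by rewrite mulr_ge0// addr_ge0.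
  have -> : x 0 i = inv_row c 0 i * (affine c b' x 0 i - b' 0 i) by rewrite !mxE addrK mulKf.
  rewrite normrM; apply: ler_pM => //; first exact: le_coord_norm.
  by apply: (le_trans (ler_normB _ _)); apply: lerD; exact: le_coord_norm.
have n1 := normr_ge0 (affine c b' x); have n2 := normr_ge0 b'.
move: H n1 n2 i0; move: (`|x|) (`|inv_row c|) (`|affine c b' x|) (`|b'|) => p q r u H r0 u0 q0.
have X : r + u <= (1 + u) ^+ 2 * (1 + r) by nra.
have Y := ler_wpM2l q0 X.
have W : 0 <= u + r + u * r by rewrite !addr_ge0// mulr_ge0.
have -> : (1 + (1 + u) * q) * (1 + u) * (1 + r) =
  1 + (u + r + u * r) + q * ((1 + u) ^+ 2 * (1 + r)) by ring.
by rewrite lerD// ?lerDl// (le_trans H).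
Qed.

Lemma rschwartz_affine f (c b' : V) : (forall i, c 0 i != 0) -> rschwartz f ->
  rschwartz (fun x => f (affine c b' x)).
Proof.
move=> c0 rf; split; first by move=> _; apply: smooth_affine; exact: rschwartz_smooth.
move=> M s; have [C C0 H] := sbounded_bound M s rf.
eexists => _ x _; rewrite iter_partial_affine; last exact: rschwartz_smooth.
rewrite normrM; apply: (le_trans (ler_wpM2l (normr_ge0 _) (H tt _))).
apply: (le_trans (ler_wpM2l (normr_ge0 _) (ler_wpM2l C0 (weight_affine b' M x c0)))).
by rewrite !mulrA.
Qed.

Lemma ft_affine b f (c : V) x : (forall i, c 0 i != 0) -> rschwartz f ->
  ft b (fun y => f (affine c 0 y)) x = (\prod_i `|c 0 i|^-1) * ft b f (affine (inv_row c) 0 x).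
Proof.
move=> c0 rf; rewrite !ftE -(@real_integral_affine R d _ c 0 _ _ c0); last 2 first.
- exact: rint_rtrig.
- exact: continuous_rtrig.
by congr real_integral; apply/funext => y; rewrite -dotp_affine0 affine_inv.
Qed.

(** The error bound for [integral_ft_proportional]: at scale e, replacing a Lipschitz factor by its
    value at 0 costs O(e), since one further order of decay of [f] pays for |x|. *)
Lemma rschwartz_mass f : rschwartz f ->
  exists2 C : R, 0 <= C & forall (g : V -> R) (e : R), continuous g -> 0 <= e ->
    (forall x, `|g x| <= e * (`|x| * `|f x|)) -> `|real_integral g| <= C * e.
Proof.
move=> rf; have [C C0 H] := rschwartz_bound (2 * d).+1 rf.
exists (C * weight_mass R d) => [|g e cg e0 Hg]; first by rewrite mulr_ge0// weight_mass_ge0.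
rewrite mulrAC; apply: (@real_integral_weight _ _ _ (2 * d)) => //; first exact: mulr_ge0.
move=> x; apply: (le_trans (Hg x)).
rewrite [C * e]mulrC -mulrA ler_wpM2l// mulrC.
apply: (@le_trans _ _ (C * weight (2 * d).+1 x * `|x|)); first by rewrite ler_wpM2r.
by rewrite -mulrA ler_wpM2l// weight_norm.
Qed.

Lemma rschwartz_lipschitz f : rschwartz f ->
  exists2 C : R, 0 <= C & forall x y, `|f y - f x| <= C * `|y - x|.
Proof.
move=> rf.
pose P (i : 'I_d) (C : R) := forall x, `|partial i f x| <= C.
have [C HC] : exists C, forall i, P i C.
  apply: finite_choice => [i C C' CC H x|i]; first exact: le_trans (H x) CC.
  have [C C0 H] := rschwartz_bound 0 (sbounded_partial i rf).
  by exists C => x; apply: (le_trans (H x)); rewrite /weight expr0 invr1 mulr1.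
exists (d%:R * `|C|) => [|x y]; first by rewrite mulr_ge0.
rewrite -mulrA; apply: partial_lipschitz.
  by move=> i z; apply: smooth_derivable; exact: rschwartz_smooth.
by move=> i z _; apply: (le_trans (HC i z)); exact: ler_norm.
Qed.

Lemma bounded_on_ball f (r : R) : continuous f ->
  exists2 C : R, 0 <= C & forall x, `|x| <= r -> `|f x| <= C.
Proof.
move=> cf; have [r0|r0] := ltP r 0.
  by exists 0 => // x xr; have := le_lt_trans (le_trans (normr_ge0 _) xr) r0; rewrite ltxx.
pose A := [set x : V | `|x| <= r].
have cA : compact A.
  apply: bounded_closed_compact.
    by exists r; split; [exact: num_real|move=> M rM x /= xr; exact: le_trans xr (ltW rM)].
  apply: (closed_comp (f := fun x : V => `|x|) (D := [set y | y <= r])); last exact: closed_le.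
  by move=> x _; exact: norm_continuous.
have A0 : A !=set0 by exists 0; rewrite /A/= normr0.
have cw : {within A, continuous (fun x => `|f x|)}.
  apply: continuous_subspaceT => x; apply: (continuous_comp (f := f)); first exact: cf.
  exact: norm_continuous.
have [c Ac Hc] := @EVT_max_rV R d (fun x => `|f x|) A A0 cA cw.
by exists `|f c| => // x xr; apply: Hc; rewrite inE.
Qed.

Lemma iter_partial_eq0 f s x : (\near x, f x = 0) -> iter_partial s f x = 0.
Proof.
move=> H; have /nbhs_singleton -> := near_eq_iter_partial (g := fun=> 0) s H.
by case: s => [//|i s]; rewrite iter_partial_cst.
Qed.

Lemma iter_partial_outside f s (r : R) x :
  (forall x, r < `|x| -> f x = 0) -> r < `|x| -> iter_partial s f x = 0.
Proof.
move=> f0 xr; apply: iter_partial_eq0.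
have : \forall y \near x, r < `|y|.
  have := @norm_continuous _ V x; move=> /(_ [set y | r < y]); apply.
  exact: lt_nbhsr.
by apply: filterS => y; exact: f0.
Qed.

Lemma compact_support_rschwartz f (r : R) : smooth f ->
  (forall x, r < `|x| -> f x = 0) -> rschwartz f.
Proof.
move=> sf f0; split=> // M s.
have [C C0 H] := bounded_on_ball r (smooth_continuous (smooth_iter_partial s sf)).
exists (C * (1 + `|r|) ^+ M) => _ x _.
have [xr|xr] := ltP r `|x|.
  rewrite (iter_partial_outside _ f0)// normr0 mulr_ge0 ?weight_ge0// mulr_ge0//.
apply: (le_trans (H x xr)); rewrite -mulrA ler_peMr// /weight ler_pdivlMr ?exprn_gt0 ?ltr_wpDr//.
rewrite mul1r lerXn2r ?nnegrE ?addr_ge0// lerD2l.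
exact: le_trans xr (ler_norm r).
Qed.

Lemma rschwartzM f g : rschwartz f -> rschwartz g -> rschwartz (fun x => f x * g x).
Proof.
move=> rf rg; apply: (sboundedM (m := 0) rf); first by move=> _; exact: rschwartz_smooth.
move=> s; have [_ /(_ 0%N s)[C H]] := rg; exists C => i x Px.
by have := H i x Px; rewrite /weight !expr0 invr1.
Qed.

Lemma cutoff_rschwartz : rschwartz (@cutoff R d).
Proof.
apply: (@compact_support_rschwartz _ 2); first exact: smooth_cutoff.
by move=> x /ltW; exact: cutoff_eq0.
Qed.

Lemma cutoff0 : cutoff (0 : V) = 1.
Proof. by apply: cutoff_eq1; rewrite normr0 invr_ge0. Qed.

(* Its value is 1, but only its being nonzero is needed. *)
Definition fourier_constant : R := real_integral (ft false (@cutoff R d)).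

(* Compare the integrals of [ft b f x * g (e x)] and [f (e y) * ft b g y] as [e] tends
   to 0. *)
Lemma integral_ft_proportional b f g : rschwartz f -> rschwartz g -> g 0 = 1 ->
  real_integral (ft b f) = f 0 * real_integral (ft b g).
Proof.
move=> rf rg g0.
have [K1 K10 H1] := rschwartz_mass (rschwartz_ft b rf).
have [K2 K20 H2] := rschwartz_mass (rschwartz_ft b rg).
have [L1 L10 HL1] := rschwartz_lipschitz rf.
have [L2 L20 HL2] := rschwartz_lipschitz rg.
pose D := K1 * L2 + K2 * L1.
have D0 : 0 <= D by rewrite addr_ge0// mulr_ge0.
suff K e : 0 < e -> `|real_integral (ft b f) - f 0 * real_integral (ft b g)| <= D * e.
  apply/eqP; rewrite -subr_eq0 -normr_le0; apply/ler_addgt0Pr => e e0; rewrite add0r.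
  have De : 0 < e / (D + 1) by rewrite divr_gt0// ltr_wpDl.
  apply: (le_trans (K _ De)).
  by rewrite mulrA ler_pdivrMr ?ltr_wpDl// mulrC ler_pM2l// lerDl.
move=> e0.
pose c : V := const_mx e.
have c0 i : c 0 i != 0 by rewrite mxE gt_eqF.
have cE y : affine c 0 y = e *: y by apply/rowP => i; rewrite !mxE addr0.
have rge : rschwartz (fun y => g (affine c 0 y)) by exact: rschwartz_affine.
have rfe : rschwartz (fun y => f (affine c 0 y)) by exact: rschwartz_affine.
have S := ft_swap b rge rf.
(* A change of variables moves the dilation from [g] to [f]: its Jacobian cancels the one produced
   by transforming the dilate of [g]. *)
have E1 : real_integral (fun x => f x * ft b (fun y => g (affine c 0 y)) x) =
    real_integral (fun z => f (affine c 0 z) * ft b g z).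
  have rc : rschwartz (fun x => f x * ft b g (affine (inv_row c) 0 x)).
    apply: rschwartzM => //; apply: rschwartz_affine; last exact: rschwartz_ft.
    by move=> i; rewrite mxE invr_neq0.
  have -> : (fun x => f x * ft b (fun y => g (affine c 0 y)) x) =
     (fun x => (\prod_i `|c 0 i|^-1) * (f x * ft b g (affine (inv_row c) 0 x))).
    by apply/funext => x; rewrite ft_affine// mulrCA.
  rewrite real_integralZ; last exact: rschwartz_rint.
  rewrite -(@real_integral_affine R d _ c 0 _ _ c0); last 2 first.
  - exact: rschwartz_rint.
  - exact: rschwartz_continuous.
  by congr real_integral; apply/funext => y; rewrite affine_inv.
rewrite E1 in S.
have rgf : rschwartz (fun x => g (affine c 0 x) * ft b f x).
  by apply: rschwartzM => //; exact: rschwartz_ft.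
have rfg : rschwartz (fun x => f (affine c 0 x) * ft b g x).
  by apply: rschwartzM => //; exact: rschwartz_ft.
have B1 : `|real_integral (fun x => ft b f x - g (affine c 0 x) * ft b f x)| <= K1 * (L2 * e).
  apply: H1; first by apply: continuous_sub; apply: rschwartz_continuous => //; exact: rschwartz_ft.
    by rewrite mulr_ge0// ltW.
  move=> x; rewrite -{1}[ft b f x]mul1r -mulrBl normrM mulrA; apply: ler_wpM2r => //.
  rewrite -[1]g0 distrC; apply: (le_trans (HL2 _ _)).
  by rewrite cE subr0 normrZ gtr0_norm// mulrA.
have B2 : `|real_integral (fun x => f (affine c 0 x) * ft b g x - f 0 * ft b g x)| <= K2 * (L1 * e).
  apply: H2.
  - apply: continuous_sub; first exact: rschwartz_continuous.
    by apply: continuous_scale; apply: rschwartz_continuous; exact: rschwartz_ft.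
  - by rewrite mulr_ge0// ltW.
  move=> x; rewrite -mulrBl normrM mulrA; apply: ler_wpM2r => //.
  apply: (le_trans (HL1 _ _)).
  by rewrite cE subr0 normrZ gtr0_norm// mulrA.
move: B1 B2; rewrite !real_integralB; try (exact: rschwartz_rint); last 2 first.
- by apply: rintZ; apply: rschwartz_rint; exact: rschwartz_ft.
- by apply: rschwartz_rint; exact: rschwartz_ft.
rewrite S real_integralZ; last by apply: rschwartz_rint; exact: rschwartz_ft.
move: (real_integral (ft b f)) (real_integral (fun z : V => f (affine c 0 z) * ft b g z)) (f 0 * _) => p q u B1 B2.
rewrite (_ : p - u = (p - q) + (q - u)); last by ring.
apply: le_trans (ler_normD _ _) _; rewrite /D mulrDl -(mulrA K1) -(mulrA K2).
exact: lerD.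
Qed.

Lemma ft_sin_odd f x : rschwartz f -> ft true f (- x) = - ft true f x.
Proof.
move=> rf; rewrite !ftE -[RHS]mulN1r -real_integralZ; last exact: rint_rtrig.
congr real_integral; apply/funext => y.
by rewrite -scaleN1r dotpZl /trig mulN1r mulrN sinN mulNr mulN1r.
Qed.

(** The sine transform is odd, so reflecting the variable equates its integral with its opposite. *)
Lemma integral_ft_sin f : rschwartz f -> real_integral (ft true f) = 0.
Proof.
move=> rf; have rF := rschwartz_ft true rf.
have := @real_integral_affine _ _ (ft true f) (const_mx (-1)) 0 (rschwartz_rint rF) (rschwartz_continuous rF).
rewrite (_ : (fun x => _) = fun x => (-1) * ft true f x); last first.
  apply/funext => x; rewrite mulN1r -ft_sin_odd//; congr ft.
  by apply/rowP => i; rewrite !mxE addr0 mulN1r.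
rewrite real_integralZ; last exact: rschwartz_rint.
rewrite big1 => [|i _]; last by rewrite mxE normrN normr1 invr1.
rewrite mul1r mulN1r => E.
have /E : forall i : 'I_d, (const_mx (-1) : V) 0 i != 0 by move=> i; rewrite mxE oppr_eq0 oner_neq0.
by move=> /eqP; rewrite -subr_eq0 -opprD oppr_eq0 -mulr2n mulrn_eq0/= => /eqP.
Qed.

Lemma integral_ft_cos f : rschwartz f -> real_integral (ft false f) = fourier_constant * f 0.
Proof.
by move=> rf; rewrite (integral_ft_proportional false rf cutoff_rschwartz cutoff0) mulrC.
Qed.

Lemma rschwartz_shift f x : rschwartz f -> rschwartz (fun y => f (y + x)).
Proof.
move=> rf; have -> : (fun y => f (y + x)) = (fun y => f (affine (const_mx 1) x y)).
  by apply/funext => y; congr f; apply/rowP => i; rewrite !mxE mul1r.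
by apply: rschwartz_affine => // i; rewrite mxE oner_neq0.
Qed.

Lemma real_integral_shift f x : rschwartz f -> real_integral (fun y => f (y + x)) = real_integral f.
Proof.
move=> rf; have -> : (fun y => f (y + x)) = (fun y => f (affine (const_mx 1) x y)).
  by apply/funext => y; congr f; apply/rowP => i; rewrite !mxE mul1r.
rewrite real_integral_affine ?big1 ?mul1r//.
- by move=> i _; rewrite mxE normr1 invr1.
- exact: rschwartz_rint.
- exact: rschwartz_continuous.
- by move=> i; rewrite mxE oner_neq0.
Qed.

Lemma ft_shift b f x y : rschwartz f ->
  ft b (fun z => f (z + x)) y = real_integral (fun z => trig b (dotp y z - dotp y x) * f z).
Proof.
move=> rf; rewrite ftE.
have rt : rschwartz (fun z => trig b (dotp y z - dotp y x) * f z).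
  have -> : (fun z => trig b (dotp y z - dotp y x) * f z) =
     (fun z => (fun z' => f (z' + x) * trig b (dotp y z')) (z + (- x))).
    by apply/funext => z; rewrite subrK mulrC [dotp y (z - x)]dotpC dotpBl ![dotp _ y]dotpC.
  apply: (@rschwartz_shift (fun z => f (z + x) * trig b (dotp y z)) (- x)).
  by apply: rschwartz_trig; exact: rschwartz_shift.
rewrite -(real_integral_shift x rt); congr real_integral; apply/funext => z.
by rewrite (dotpC y (z + x)) dotpDl (dotpC z) (dotpC x) addrK.
Qed.

(** [integral_ft_cos] is inversion at the origin. Applied to the translate of [f] by [x], it gives
    the formula at [x] once the cosine of a difference is expanded. *)
Lemma fourier_inversion f x : rschwartz f ->
  ft false (ft false f) x + ft true (ft true f) x = fourier_constant * f x.
Proof.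
move=> rf.
have := integral_ft_cos (rschwartz_shift x rf); rewrite add0r => <-.
rewrite ![ft _ (ft _ _) _]ftE -real_integralD; last 2 first.
- by apply: rint_rtrig; exact: rschwartz_ft.
- by apply: rint_rtrig; exact: rschwartz_ft.
congr real_integral; apply/funext => y; rewrite [RHS]ft_shift// !ftE.
rewrite -!real_integralZ; try exact: rint_rtrig.
rewrite -real_integralD; try (apply: rintZ; exact: rint_rtrig).
congr real_integral; apply/funext => z.
by rewrite /trig mulrBr cosB [dotp x y]dotpC; ring.
Qed.

(** The companion identity: the same translate in [integral_ft_sin], with the sine of a difference.
    It cancels the cross terms of the complex inversion formula. *)
Lemma fourier_inversion_cross f x : rschwartz f ->
  ft true (ft false f) x = ft false (ft true f) x.
Proof.
move=> rf; apply/eqP; rewrite -subr_eq0; apply/eqP.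
have := integral_ft_sin (rschwartz_shift x rf) => E.
rewrite -[RHS]oppr0 -{}E -[RHS]mulN1r -real_integralZ; last first.
  by apply: rschwartz_rint; apply: rschwartz_ft; exact: rschwartz_shift.
rewrite ![ft _ (ft _ _) _]ftE -real_integralB; last 2 first.
- by apply: rint_rtrig; exact: rschwartz_ft.
- by apply: rint_rtrig; exact: rschwartz_ft.
congr real_integral; apply/funext => y; rewrite [X in -1 * X]ft_shift// !ftE.
rewrite -!real_integralZ; try exact: rint_rtrig; last first.
  have -> : (fun z => trig true (dotp y z - dotp y x) * f z) =
     (fun z => cos (2 * pi * dotp y x) * (trig true (dotp y z) * f z) -
       sin (2 * pi * dotp y x) * (trig false (dotp y z) * f z)).
    by apply/funext => z; rewrite /trig mulrBr sinB; ring.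
  by apply: rintB; apply: rintZ; exact: rint_rtrig.
rewrite -real_integralB; try (apply: rintZ; exact: rint_rtrig).
congr real_integral; apply/funext => z.
by rewrite /trig mulrBr sinB [dotp x y]dotpC; ring.
Qed.

(** Parseval's identity: if the constant were 0, the squares of both transforms of the cutoff would
    integrate to 0, although its cosine transform is positive at 0, being there the integral of a
    nonnegative function with value 1 at 0. *)
Lemma fourier_constant_neq0 : fourier_constant != 0.
Proof.
apply/eqP => c0.
have [g [rg gp g0]] : exists g : V -> R, [/\ rschwartz g, forall x, 0 <= g x & g 0 = 1].
  by exists (@cutoff R d); split; [exact: cutoff_rschwartz|exact: cutoff_ge0|exact: cutoff0].
have rc := rschwartz_ft false rg; have rs := rschwartz_ft true rg.
have S1 := ft_swap false rg rc.
have S2 := ft_swap true rg rs.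
have : real_integral (fun x => ft false g x * ft false g x) +
  real_integral (fun x => ft true g x * ft true g x) = 0.
  rewrite -S1 -S2 -real_integralD; last 2 first.
  - by apply: rschwartz_rint; apply: rschwartzM => //; exact: rschwartz_ft.
  - by apply: rschwartz_rint; apply: rschwartzM => //; exact: rschwartz_ft.
  rewrite (_ : (fun x => _) = fun x => 0 * g x).
    by rewrite real_integralZ ?mul0r//; exact: rschwartz_rint.
  by apply/funext => x; rewrite -mulrDr fourier_inversion// c0 !mul0r mulr0.
have P : 0 < real_integral (fun x => ft false g x * ft false g x).
  apply: real_integral_gt0.
  - by apply: rschwartz_rint; exact: rschwartzM.
  - by apply: rschwartz_continuous; exact: rschwartzM.
  - by move=> x; rewrite -expr2 sqr_ge0.
  - rewrite -expr2 exprn_gt0//.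
    rewrite ftE (_ : (fun y => _) = g); last first.
      by apply/funext => y; rewrite -[0 : V](scale0r 0) dotpZl mul0r /trig mulr0 cos0 mul1r.
    apply: real_integral_gt0; [exact: rschwartz_rint|exact: rschwartz_continuous|exact: gp|].
    by rewrite g0.
have Q : 0 <= real_integral (fun x => ft true g x * ft true g x).
  by apply: real_integral_ge0 => x; rewrite -expr2 sqr_ge0.
by move=> /eqP; rewrite gt_eqF// ltr_wpDr.
Qed.

End fourier.

Lemma powRV (R : realType) (r e : R) : 0 <= r -> r^-1 `^ e = (r `^ e)^-1.
Proof. by move=> r0; rewrite -[r^-1]powR_inv1// -powRrM mulN1r powRN. Qed.

Lemma gt0_powRD (R : realType) (r e e' : R) : 0 < r -> r `^ (e + e') = r `^ e * r `^ e'.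
Proof. by move=> r0; rewrite powRD// (gt_eqF r0) implybT. Qed.

Lemma open_norm_lt (R : realType) d (r : R) : open [set x : 'rV[R]_d | `|x| < r].
Proof.
apply: (open_comp (f := fun x : 'rV[R]_d => `|x|) (D := [set y | y < r])); last exact: open_lt.
by move=> x _; exact: norm_continuous.
Qed.

Lemma open_norm_gt (R : realType) d (r : R) : open [set x : 'rV[R]_d | r < `|x|].
Proof.
apply: (open_comp (f := fun x : 'rV[R]_d => `|x|) (D := [set y | r < y])); last exact: open_gt.
by move=> x _; exact: norm_continuous.
Qed.

(** * Dilations and homogeneous norms *)

Section dilations.
Variables (R : realType) (n : nat) (a : 'I_n.+1 -> R).
Hypothesis a1 : forall i, 1 <= a i.
Local Notation V := 'rV[R]_n.+1.
Implicit Types (f g : V -> R) (x y : V) (r : R).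

Definition scaling r : V := \row_i (r `^ a i).

Lemma dilationE r : dilation a r = affine (scaling r) 0.
Proof. by apply/funext => x; apply/rowP => i; rewrite !mxE addr0. Qed.

Lemma scaling_neq0 r i : 0 < r -> scaling r 0 i != 0.
Proof. by move=> r0; rewrite mxE gt_eqF// powR_gt0. Qed.

Lemma inv_scaling r : 0 < r -> inv_row (scaling r) = scaling r^-1.
Proof.
by move=> r0; apply/rowP => i; rewrite !mxE powRV// ltW.
Qed.

Lemma dilationM r r' x : 0 <= r -> 0 <= r' -> dilation a r (dilation a r' x) = dilation a (r * r') x.
Proof. by move=> r0 r0'; apply/rowP => i; rewrite !mxE mulrA powRM. Qed.

Lemma dilation1 x : dilation a 1 x = x.
Proof. by apply/rowP => i; rewrite !mxE powR1 mul1r. Qed.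

Lemma dilationK r x : 0 < r -> dilation a r^-1 (dilation a r x) = x.
Proof.
by move=> r0; rewrite dilationM ?invr_ge0 ?(ltW r0)// mulVf ?gt_eqF// dilation1.
Qed.

Lemma norm_dilation_le r x : 0 < r <= 1 -> `|dilation a r x| <= r * `|x|.
Proof.
move=> /andP[r0 r1]; apply: norm_le_coord => [|i]; first by rewrite mulr_ge0 ?(ltW r0).
rewrite mxE normrM ger0_norm ?powR_ge0//; apply: ler_pM; rewrite ?powR_ge0//.
  by apply: ge1r_powR => //; rewrite r0.
exact: le_coord_norm.
Qed.

Lemma norm_dilation_ge r x : 1 <= r -> r * `|x| <= `|dilation a r x|.
Proof.
move=> r1; have r0 : 0 < r by exact: lt_le_trans r1.
have := @norm_dilation_le r^-1 (dilation a r x).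
rewrite dilationK// invr_gt0 r0 invf_le1// r1 => /(_ isT).
by rewrite mulrC ler_pdivlMr// mulrC.
Qed.

Lemma norm_dilation_bound r x : `|dilation a r x| <= `|scaling r| * `|x|.
Proof.
apply: norm_le_coord => [|i]; first exact: mulr_ge0.
rewrite mxE normrM; apply: ler_pM => //; last exact: le_coord_norm.
by have := le_coord_norm (scaling r) i; rewrite mxE.
Qed.

Lemma dilation_polar x : x != 0 ->
  exists (t : R) (u : V), [/\ 0 < t, `|u| = 1 & x = dilation a t u].
Proof.
move=> x0.
(* [t] is the maximum of the [`|x_i| ^ (1 / a_i)]. *)
pose p i := `|x 0 i| `^ (a i)^-1.
have a0 i : 0 < a i by exact: lt_le_trans (a1 i).
have [i0 _ /= Hi] := @arg_maxP _ R _ ord0 xpredT p isT.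
have pE i : p i `^ a i = `|x 0 i| by rewrite -powRrM mulVf ?gt_eqF// powRr1.
have p0 : 0 < p i0.
  rewrite lt_neqAle powR_ge0 andbT eq_sym; apply: contra x0 => /eqP E.
  apply/eqP/rowP => i; apply/eqP; rewrite mxE -normr_eq0 -pE.
  have /eqP -> : p i == 0 by rewrite eq_le powR_ge0 andbT -E; exact: Hi.
  by rewrite powR0// gt_eqF.
exists (p i0), (dilation a (p i0)^-1 x); split => //; last first.
  by rewrite -{1}(invrK (p i0)) dilationK// invr_gt0.
have E i : `|dilation a (p i0)^-1 x 0 i| = p i `^ a i / p i0 `^ a i.
  by rewrite mxE normrM pE mulrC (ger0_norm (powR_ge0 _ _)) powRV// ltW.
have pa0 : 0 < p i0 `^ a i0 by apply: powR_gt0.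
apply/eqP; rewrite eq_le; apply/andP; split.
  apply: norm_le_coord => // i; rewrite E ler_pdivrMr; last exact: (powR_gt0 _ p0).
  rewrite mul1r.
  apply: ge0_ler_powR; rewrite ?nnegrE ?powR_ge0 ?(ltW (a0 i))//; exact: Hi.
apply: le_trans (le_coord_norm _ i0); by rewrite E divff// gt_eqF.
Qed.

Lemma continuous_norm_comp f : continuous f -> continuous (fun x => `|f x|).
Proof. by move=> cf x; apply: (cvg_norm (F := nbhs x)); exact: cf. Qed.

Variable N : V -> R.
Hypotheses (N0 : forall x, 0 <= N x) (cN : continuous N)
  (NE : forall x, N x = 0 <-> x = 0)
  (NZ : forall (r : R) x, 0 < r -> N (dilation a r x) = r * N x).

(** Homogeneity reduces both bounds to the unit sphere. Since the exponents are at least 1, a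
    dilation by t <= 1 shrinks the sup norm at least by t and one by t >= 1 enlarges it at least by
    t. This gives a linear lower bound on [N] near 0 and a linear upper bound at infinity, but
    neither of them everywhere. *)
Lemma norm_gauge : exists m M : R, [/\ 0 < m, 0 < M,
  forall x, m * Num.min 1 `|x| <= N x & forall x, N x <= M * (1 + `|x|)].
Proof.
have [M M0 HM] := bounded_on_ball 1 cN.
(* [h] is bounded on the unit ball, which bounds [N] below on the unit sphere. *)
pose h x := (N x + `| `|x| - 1 |)^-1.
have hp x : 0 < N x + `| `|x| - 1 |.
  rewrite lt_neqAle addr_ge0// andbT eq_sym paddr_eq0//; apply/negP => /andP[/eqP/NE -> ].
  by rewrite normr0 sub0r normrN1 oner_eq0.
have ch : continuous h.
  move=> x; apply: (continuousV (s := fun x => N x + `| `|x| - 1 |)); first by rewrite gt_eqF.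
  apply: continuous_add => //; apply: continuous_norm_comp.
  by apply: (@continuous_sub _ _ (fun x : V => `|x|) (fun=> 1)); [exact: norm_continuous|exact: cst_continuous].
have [C C0 HC] := bounded_on_ball 1 ch.
have m0 : 0 < (C + 1)^-1 by rewrite invr_gt0 ltr_wpDl.
have P t u : 0 < t -> `|u| = 1 -> (C + 1)^-1 * t <= N (dilation a t u) <= (M + 1) * t.
  move=> t0 u1; rewrite NZ// ![_ * t]mulrC !ler_pM2l//; apply/andP; split; last first.
    by rewrite (le_trans (ler_norm _))// (le_trans (HM _ _)) ?u1// lerDl.
  have := HC u; rewrite u1 lexx /h u1 subrr normr0 addr0 => /(_ isT).
  have Nu : 0 < N u by have := hp u; rewrite u1 subrr normr0 addr0.
  rewrite gtr0_norm ?invr_gt0// => uC; rewrite invf_ple ?posrE ?ltr_wpDl//.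
  by rewrite (le_trans uC)// lerDl.
exists (C + 1)^-1, (M + 1); split => // [|x|x]; first by rewrite ltr_wpDl.
  have [->|/dilation_polar[t [u [t0 u1 ->]]]] := eqVneq x 0.
    by rewrite normr0 (min_idPr _)// mulr0.
  have /andP[A _] := P t u t0 u1; apply: (le_trans _ A); rewrite ler_pM2l// ge_min.
  have [t1|t1] := leP t 1; last by rewrite ltW.
  apply/orP; right; rewrite -[leRHS]mulr1 -u1; apply: norm_dilation_le => //.
  by rewrite t0.
have [->|/dilation_polar[t [u [t0 u1 ->]]]] := eqVneq x 0.
  by rewrite normr0 (NE 0).2// mulr_ge0// addr_ge0.
have /andP[_ A] := P t u t0 u1; apply: (le_trans A); rewrite ler_pM2l ?ltr_wpDl//.
have [t1|t1] := leP t 1; first by rewrite (le_trans t1)// lerDl.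
by rewrite -[leLHS]mulr1 -u1 (le_trans (norm_dilation_ge _ (ltW t1)))// lerDr.
Qed.

End dilations.

Lemma powR_sandwich (R : realType) (c r e : R) : 1 <= c -> c^-1 <= r <= c -> r `^ e <= c `^ `|e|.
Proof.
move=> c1 /andP[cr rc]; have c0 : 0 < c by exact: lt_le_trans c1.
have r0 : 0 < r by apply: lt_le_trans cr; rewrite invr_gt0.
have [e0|e0] := leP 0 e.
  by rewrite ger0_norm//; apply: ge0_ler_powR; rewrite // nnegrE ltW.
have -> : r `^ e = r^-1 `^ (- e).
  by rewrite -[r^-1]powR_inv1 ?(ltW r0)// -powRrM mulN1r opprK.
rewrite ltr0_norm//; apply: ge0_ler_powR; rewrite ?nnegrE ?invr_ge0 ?(ltW r0) ?(ltW c0) ?oppr_ge0 ?(ltW e0)//.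
by rewrite invf_ple ?posrE.
Qed.

(** * Symbols and dyadic decompositions *)

Section symbols.
Variables (R : realType) (n : nat) (a : 'I_n.+1 -> R).
Hypothesis a1 : forall i, 1 <= a i.
Local Notation V := 'rV[R]_n.+1.
Implicit Types (f g : V -> R) (x y : V) (e j : R).

Definition wlen (s : seq 'I_n.+1) : R := \sum_(i <- s) a i.

Lemma prod_scaling (r : R) s : 0 < r -> \prod_(i <- s) scaling a r 0 i = r `^ wlen s.
Proof.
move=> r0; rewrite /wlen; elim: s => [|i s IH]; first by rewrite !big_nil powRr0.
by rewrite !big_cons IH mxE gt0_powRD.
Qed.

Lemma iter_partial_dilation s f (r : R) : 0 < r -> smooth f ->
  iter_partial s (fun x => f (dilation a r x)) =
  (fun x => r `^ wlen s * iter_partial s f (dilation a r x)).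
Proof. by move=> r0 sf; rewrite dilationE iter_partial_affine// prod_scaling. Qed.

Lemma smooth_dilation f (r : R) : smooth f -> smooth (fun x => f (dilation a r x)).
Proof. by move=> sf; rewrite dilationE; exact: smooth_affine. Qed.

Definition piece e (Phi : nat -> V -> R) (k : nat) x :=
  (2 `^ e) ^+ k * Phi k (dilation a (2^-1 ^+ k) x).

Let half_gt0 k : 0 < (2^-1 : R) ^+ k.
Proof. by rewrite exprn_gt0// invr_gt0. Qed.

Let half_le1 k : (2^-1 : R) ^+ k <= 1.
Proof. by rewrite exprn_ile1 ?invr_ge0// invf_le1// ler1n. Qed.

Lemma powR_half e k : (2^-1 ^+ k) `^ e = (2 `^ (- e)) ^+ k :> R.
Proof. by rewrite -[2^-1 ^+ k]powR_mulrn ?invr_ge0// powRAC powRV// powR_mulrn ?invr_ge0 ?powR_ge0// powRN. Qed.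

(** Differentiation keeps the shape of a piece and lowers its order by the weighted length, so
    symbol estimates only have to be proved for the sum itself, at every order. *)
Lemma iter_partial_piece s e Phi k : (forall k, smooth (Phi k)) ->
  iter_partial s (piece e Phi k) = piece (e - wlen s) (fun k => iter_partial s (Phi k)) k.
Proof.
move=> sP; rewrite /piece iter_partialZ; last exact: smooth_dilation.
rewrite iter_partial_dilation//; apply/funext => x.
rewrite mulrA; congr (_ * _); rewrite powR_half -exprMn -gt0_powRD//.
Qed.

Lemma smooth_piece e Phi k : (forall k, smooth (Phi k)) -> smooth (piece e Phi k).
Proof. by move=> sP; apply: smoothZ; exact: smooth_dilation. Qed.

(** The frequency side of [admissible]: all derivatives vanish at 0, except possibly for the member
    of index 0. *)
Definition flat_bounded (Phi : nat -> V -> R) :=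
  sbounded Phi /\ forall k s, iter_partial s (Phi k.+1) 0 = 0.

Lemma flat_bounded_partial Phi s : flat_bounded Phi ->
  flat_bounded (fun k => iter_partial s (Phi k)).
Proof.
move=> [sP fP]; split; first exact: sbounded_iter_partial.
by move=> k t; rewrite -iter_partial_cat.
Qed.

Lemma flat_bounded_bound Phi L : flat_bounded Phi -> exists2 C : R, 0 <= C &
  (forall k x, `|Phi k.+1 x| <= C * `|x| ^+ L) /\ (forall k x, `|Phi k x| <= C * weight L x).
Proof.
move=> [sP fP].
have [C C0 HC] := sbounded_bound L [::] sP.
have [|||D D0 HD] := @flat_family _ _ nat (fun k => Phi k.+1) _ _ _ L [::].
- by move=> k; exact: sbounded_smooth.
- move=> s; have [B B0 HB] := sbounded_bound 0 s sP.
  by exists B => k x; apply: (le_trans (HB k.+1 x)); rewrite /weight expr0 invr1 mulr1.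
- by move=> s k; exact: fP.
exists (C + D); first exact: addr_ge0.
split=> k x.
  by apply: (le_trans (HD k x)); rewrite ler_wpM2r ?exprn_ge0// lerDr.
by apply: (le_trans (HC k x)); rewrite ler_wpM2r ?weight_ge0// lerDl.
Qed.

Lemma exists_nat_ge e : exists L : nat, e <= L%:R.
Proof. by exists (Num.bound `|e|); exact: le_trans (ler_norm e) (ltW (archi_boundP (normr_ge0 e))). Qed.

Lemma pow2_half e L k : e + 1 <= L%:R -> (2 `^ e) ^+ k * (2^-1 ^+ k) ^+ L <= 2^-1 ^+ k :> R.
Proof.
move=> eL; rewrite -[(_ ^+ k) ^+ L]exprM mulnC exprM -exprMn.
rewrite lerXn2r ?nnegrE ?mulr_ge0 ?powR_ge0 ?exprn_ge0 ?invr_ge0//.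
rewrite exprVn ler_pdivrMr ?exprn_gt0// -[2 ^+ L]powR_mulrn//.
rewrite ler_pdivlMl// -[X in X * _]powRr1// -gt0_powRD//.
by apply: ler_powR; rewrite ?ler1n// addrC.
Qed.

(** Flatness to an order L >= e + 1 turns the growth 2^(ek) into the decay 2^-k, at the price of the
    factor (1 + |x|)^L. This gives convergence, but not yet the growth of a symbol. *)
Lemma piece_growth e Phi : flat_bounded Phi ->
  exists (L : nat) (C : R), 0 <= C /\ forall k x, `|piece e Phi k x| <= C * (1 + `|x|) ^+ L * 2^-1 ^+ k.
Proof.
move=> fP; have [L eL] := exists_nat_ge (e + 1).
have [C C0 [H1 H2]] := flat_bounded_bound L fP.
exists L, C; split => // k x.
rewrite /piece normrM ger0_norm ?exprn_ge0 ?powR_ge0//.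
case: k => [|k].
  rewrite !expr0 mul1r mulr1; apply: (le_trans (H2 _ _)); rewrite ler_wpM2l//.
  by rewrite (le_trans (weight_le1 _ _))// exprn_ege1// lerDl.
apply: (@le_trans _ _ ((2 `^ e) ^+ k.+1 * (C * ((2^-1 ^+ k.+1) * `|x|) ^+ L))).
  rewrite ler_wpM2l ?exprn_ge0 ?powR_ge0//; apply: (le_trans (H1 _ _)).
  rewrite ler_wpM2l// lerXn2r ?nnegrE ?mulr_ge0 ?(ltW (half_gt0 _))//.
  by apply: norm_dilation_le => //; rewrite half_gt0 half_le1.
rewrite exprMn mulrCA mulrA mulrA -mulrA [leRHS]mulrAC -[leRHS]mulrA.
rewrite -[leLHS]mulrA ler_wpM2l// mulrA ler_pM ?mulr_ge0 ?exprn_ge0 ?powR_ge0 ?(ltW (half_gt0 _))//.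
  exact: pow2_half.
by rewrite lerXn2r ?nnegrE ?addr_ge0// lerDr.
Qed.

Lemma geometric_piece e Phi : flat_bounded Phi -> geometric_family (piece e Phi).
Proof.
move=> fP; have sP k : smooth (Phi k) by case: fP => sP _; exact: sbounded_smooth.
split=> [k|s B]; first exact: smooth_piece.
have [L [C [C0 H]]] := piece_growth (e - wlen s) (flat_bounded_partial s fP).
exists (C * (1 + `|B|) ^+ L) => k x xB; rewrite iter_partial_piece//.
apply: (le_trans (H k x)); rewrite ler_wpM2r ?(ltW (half_gt0 _))// ler_wpM2l//.
rewrite lerXn2r ?nnegrE ?addr_ge0// lerD2l; exact: le_trans xB (ler_norm _).
Qed.

(** The geometric bound only secures convergence. Its constant does not enter the conclusion, and in
    [piece_sum_bound] it grows with the point. *)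
Lemma gsum_le (u : nat -> R) (C B : R) : (forall k, `|u k| <= C * 2^-1 ^+ k) ->
  (forall m, \sum_(k < m) `|u k| <= B) -> `|gsum u| <= B.
Proof.
move=> uC uB; apply/ler_addgt0Pr => e e0.
have [m me] : exists m, 2 * C * 2^-1 ^+ m <= e.
  have := @cvg_geometric R (2 * C) 2^-1; rewrite ger0_norm ?invr_ge0// invf_lt1// ltr1n => /(_ isT).
  move=> /cvgrPdist_le/(_ e e0)[m _ /(_ m (leqnn _))].
  by rewrite sub0r normrN => H; exists m; exact: le_trans (ler_norm _) H.
rewrite -[gsum u](subrK (\sum_(k < m) u k)) addrC.
apply: (le_trans (ler_normD _ _)); apply: lerD.
  exact: le_trans (ler_norm_sum _ _ _) (uB m).
exact: le_trans (geo_tail m uC) me.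
Qed.

Variable N : V -> R.
Hypotheses (N0 : forall x, 0 <= N x) (cN : continuous N)
  (NE : forall x, N x = 0 <-> x = 0)
  (NZ : forall (r : R) x, 0 < r -> N (dilation a r x) = r * N x).

(** For [|x| <= 1] the lower bound of [norm_gauge] replaces |x| by [N x / m]; for [|x| > 1] that
    quotient is at least 1 and boundedness is enough. Decay is transferred by the upper bound. *)
Lemma flat_bounded_gauge Phi L : flat_bounded Phi -> exists2 C : R, 0 <= C &
  (forall k x, `|Phi k.+1 x| <= C * N x ^+ L) /\
  (forall k x, `|Phi k x| <= C * (1 + N x) ^- L).
Proof.
move=> fP; have [C C0 [H1 H2]] := flat_bounded_bound L fP.
have [m [M [m0 M0 Hm HM]]] := norm_gauge a1 N0 cN NE NZ.
have mi : 0 <= m^-1 by rewrite invr_ge0 ltW.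
have M1 : 0 <= 1 + M by rewrite addr_ge0// ltW.
exists (C * (m^-1 ^+ L + (1 + M) ^+ L)).
  by rewrite mulr_ge0// addr_ge0// exprn_ge0.
split=> k x.
  apply: (@le_trans _ _ (C * (m^-1 * N x) ^+ L)); last first.
    by rewrite exprMn mulrA ler_wpM2r ?exprn_ge0// ler_wpM2l// lerDl exprn_ge0.
  have A : Num.min 1 `|x| <= m^-1 * N x by rewrite ler_pdivlMl.
  have [x1|x1] := leP `|x| 1.
    apply: (le_trans (H1 k x)); rewrite ler_wpM2l// lerXn2r ?nnegrE ?mulr_ge0//.
    by apply: le_trans A; rewrite (min_idPr _).
  apply: (le_trans (H2 _ _)); rewrite ler_wpM2l//; apply: (le_trans (weight_le1 _ _)).
  rewrite exprn_ege1//; apply: le_trans A; rewrite (min_idPl _)//; exact: ltW.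
apply: (le_trans (H2 _ _)); rewrite -mulrA ler_wpM2l// mulrDl.
have Nx : 0 < 1 + N x by rewrite ltr_wpDr.
apply: (@le_trans _ _ ((1 + M) ^+ L * (1 + N x) ^- L)); last first.
  by rewrite lerDr mulr_ge0 ?invr_ge0 ?exprn_ge0// ltW.
rewrite ler_pdivlMr ?exprn_gt0// mulrC ler_pdivrMr ?exprn_gt0 ?ltr_wpDr// -exprMn.
rewrite lerXn2r ?nnegrE ?mulr_ge0 ?addr_ge0// ?(ltW M0)//.
have := HM x; have := normr_ge0 x; move: (`|x|) => u u0 H.
rewrite mulrDl mul1r; apply: lerD => //; rewrite ?lerDl//.
Qed.

Lemma piece_sum_bound e Phi : flat_bounded Phi ->
  exists C : R, forall x, `|fsum (piece e Phi) x| <= C * (1 + N x) `^ e.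
Proof.
(* With this margin y^(L - e) <= y for 0 < y < 1 and y^(- e - L) <= y^-2 for y >= 1, whatever the
   sign of [e]. *)
move=> fP; have [L eL] := exists_nat_ge (`|e| + 2).
have [C C0 [H1 H2]] := flat_bounded_gauge L fP.
have [L' [C' [C'0 HG]]] := piece_growth e fP.
(* The 8 is 4 times 2: the 4 absorbs (1 + y)^2 and the 2 comes from telescoping. The factor 2^|e|
   trades powers of [N x], or of 1, for powers of [1 + N x]. *)
exists (8 * C * 2 `^ `|e|) => x.
have c12 : (1 : R) <= 2 by rewrite ler1n.
have T0 := N0 x; have T10 : 0 < 1 + N x by rewrite ltr_wpDr.
apply: (@gsum_le _ (C' * (1 + `|x|) ^+ L')) => [k|m]; first exact: HG.
have Ny k : N (dilation a (2^-1 ^+ k) x) = 2^-1 ^+ k * N x by rewrite NZ.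
have pE k : `|piece e Phi k x| = (2 `^ e) ^+ k * `|Phi k (dilation a (2^-1 ^+ k) x)|.
  by rewrite /piece normrM ger0_norm ?exprn_ge0 ?powR_ge0.
(* For [N x <= 1] the right side is bounded below by a positive constant, so a geometric sum
   suffices: decay bounds the term k = 0 and flatness the others. *)
have [T1|T1] := leP (N x) 1.
  apply: (@le_trans _ _ (2 * C)).
    apply: (@le_trans _ _ (\sum_(0 <= k < m) C * 2^-1 ^+ k)); last first.
      rewrite -mulr_sumr [2 * C]mulrC ler_wpM2l//.
      by apply: (le_trans (geo_partial R (leq0n m))); rewrite expr0 mulr1.
    rewrite big_mkord; apply: ler_sum => -[k /= _] _; rewrite pE; case: k => [|k].
      rewrite !expr0 mul1r mulr1; apply: (le_trans (H2 _ _)).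
      by rewrite ler_piMr// invf_le1 ?exprn_gt0 ?ltr_wpDr// exprn_ege1// lerDl.
    apply: (@le_trans _ _ ((2 `^ e) ^+ k.+1 * (C * (2^-1 ^+ k.+1) ^+ L))).
      rewrite ler_wpM2l ?exprn_ge0 ?powR_ge0//; apply: (le_trans (H1 _ _)).
      rewrite ler_wpM2l// Ny lerXn2r ?nnegrE ?mulr_ge0 ?(ltW (half_gt0 _))//.
      by rewrite ler_piMr// ltW.
    rewrite mulrCA ler_wpM2l//; apply: pow2_half; apply: le_trans eL.
    by rewrite lerD ?ler_norm// ler1n.
  have A : 1 <= 2 `^ `|e| * (1 + N x) `^ e.
    have := @powR_sandwich R 2 (1 + N x)^-1 e c12.
    rewrite lef_pV2 ?posrE// [in 1 + N x <= 2](_ : 2 = 1 + 1)// lerD2l T1 /=.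
    rewrite (le_trans _ c12) ?invf_le1 ?lerDl// => /(_ isT).
    by rewrite powRV ?(ltW T10)// -ler_pdivrMr ?powR_gt0// div1r.
  rewrite -!mulrA; apply: (@le_trans _ _ (2 * C * 1)); first by rewrite mulr1.
  rewrite mulrA ler_pM ?mulr_ge0// ler_wpM2r// ler_nat//.
have T00 : 0 < N x by exact: lt_trans T1.
pose y k := 2^-1 ^+ k * N x.
have y0 k : 0 < y k by rewrite mulr_gt0.
have B k : `|piece e Phi k x| <= 4 * C * N x `^ e * (y k / (1 + y k) ^+ 2).
  have y10 : 0 < 1 + y k by rewrite ltr_wpDl// y0.
  (* Since y = 2^-k N x, the scale 2^k is N x / y; this extracts the expected power of [N x] and
     leaves a function of y alone. *)
  have E : (2 `^ e) ^+ k = N x `^ e * y k `^ (- e).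
    rewrite /y powRM ?(ltW (half_gt0 _))// powR_half opprK mulrCA -gt0_powRD//.
    by rewrite subrr powRr0 mulr1.
  rewrite pE E.
  suff Q : y k `^ (- e) * `|Phi k (dilation a (2^-1 ^+ k) x)| <= C * (4 * (y k / (1 + y k) ^+ 2)).
    apply: (@le_trans _ _ (N x `^ e * (C * (4 * (y k / (1 + y k) ^+ 2))))).
      by rewrite -mulrA ler_wpM2l ?powR_ge0.
    by rewrite le_eqVlt; apply/orP; left; apply/eqP; ring.
  have eL' : - e + 2 <= L%:R by apply: le_trans eL; rewrite lerD2r -normrN ler_norm.
  have [y1|y1] := ltP (y k) 1.
    (* As [N x > 1], the condition y < 1 rules out k = 0, the only index without flatness. *)
    case: k y1 {E} y10 => [|k] y1 y10.
      by move: y1; rewrite /y expr0 mul1r ltNge (ltW T1).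
    apply: (@le_trans _ _ (y k.+1 `^ (- e) * (C * y k.+1 ^+ L))).
      by rewrite ler_wpM2l ?powR_ge0// (le_trans (H1 _ _))// Ny.
    rewrite mulrCA ler_wpM2l// -[_ ^+ L]powR_mulrn ?(ltW (y0 _))// -gt0_powRD//.
    apply: (@le_trans _ _ (y k.+1)).
      apply: ge1r_powR; first by rewrite y0 ltW.
      have : `|e| + 2 <= L%:R by [].
      have := ler_norm e; lra.
    rewrite mulrCA ler_peMr ?(ltW (y0 _))// ler_pdivlMr ?exprn_gt0// mul1r.
    move: y1 y10; move: (y k.+1) => u; nra.
  apply: (@le_trans _ _ (y k `^ (- e) * (C * y k ^- L))).
    rewrite ler_wpM2l ?powR_ge0// (le_trans (H2 _ _))// Ny ler_wpM2l//.
    rewrite lef_pV2 ?posrE ?exprn_gt0// lerXn2r ?nnegrE ?(ltW (y0 _)) ?(ltW y10)//.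
    by rewrite lerDr.
  rewrite mulrCA ler_wpM2l// -powR_invn ?(ltW (y0 _))// -gt0_powRD//.
  apply: (@le_trans _ _ (y k `^ (- 2%:R))).
    by apply: ler_powR => //; move: eL'; lra.
  rewrite powR_invn ?(ltW (y0 _))// mulrA ler_pdivlMr ?exprn_gt0// mulrC.
  rewrite ler_pdivrMr ?exprn_gt0//.
  move: y1; move: (y k) => u u1; have : 0 <= (u - 1) * u by nra.
  nra.
(* [y / (1 + y)^2 <= 2 (1 / (1 + y / 2) - 1 / (1 + y))], a telescoping bound. *)
apply: (@le_trans _ _ (\sum_(k < m) 4 * C * N x `^ e * (2 * ((1 + y k.+1)^-1 - (1 + y k)^-1)))).
  apply: ler_sum => -[k /= _] _; apply: (le_trans (B k)).
  rewrite ler_wpM2l ?mulr_ge0 ?powR_ge0//.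
  have -> : y k.+1 = y k / 2 by rewrite /y exprS -mulrA mulrC.
  have := y0 k; move: (y k) => u u0.
  have -> : 2 * ((1 + u / 2)^-1 - (1 + u)^-1) = u / ((1 + u / 2) * (1 + u)).
    by field; apply/andP; split; rewrite gt_eqF//; lra.
  rewrite ler_wpM2l ?(ltW u0)// lef_pV2 ?posrE; try by nra.
rewrite -mulr_sumr -mulr_sumr -(big_mkord xpredT (fun k => (1 + y k.+1)^-1 - (1 + y k)^-1)).
rewrite telescope_sumr//.
apply: (@le_trans _ _ (4 * C * N x `^ e * 2)).
  rewrite ler_wpM2l ?mulr_ge0 ?powR_ge0// -[leRHS]mulr1 ler_wpM2l//.
  apply: (@le_trans _ _ (1 + y m)^-1).
    by rewrite gerBl invr_ge0 addr_ge0// ltW.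
  by rewrite invf_le1 ?lerDl ?ltr_wpDr// ltW.
have A : N x `^ e <= 2 `^ `|e| * (1 + N x) `^ e.
  have := @powR_sandwich R 2 (N x / (1 + N x)) e c12.
  rewrite ler_pdivlMr// ler_pdivrMr// powRM ?invr_ge0 ?(ltW T10)// powRV ?(ltW T10)//.
  rewrite ler_pdivrMr ?powR_gt0//; apply; apply/andP; split; lra.
have -> : 4 * C * N x `^ e * 2 = 8 * C * N x `^ e by ring.
by rewrite -[leRHS]mulrA ler_wpM2l// mulr_ge0.
Qed.

Definition rmultiplier j f :=
  smooth f /\ forall s, exists C : R, forall x, `|iter_partial s f x| <= C * (1 + N x) `^ (j - wlen s).

Lemma piece_sum_multiplier j Phi : flat_bounded Phi -> rmultiplier j (fsum (piece j Phi)).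
Proof.
move=> fP; have gP := geometric_piece j fP; split; first exact: smooth_fsum.
move=> s; have [C HC] := piece_sum_bound (j - wlen s) (flat_bounded_partial s fP).
exists C => x; rewrite iter_partial_fsum//.
rewrite (_ : fsum _ = fsum (piece (j - wlen s) (fun k => iter_partial s (Phi k)))); first exact: HC.
congr fsum; apply/funext => k; apply: iter_partial_piece => {}k.
by case: fP => sP _; exact: sbounded_smooth.
Qed.

(* The dilates [shell k (dilation a (2^-1 ^+ k) x)] are a telescoping partition of
   unity, so that [localized] inverts the summation of [piece]s. *)
Definition shell (k : nat) x : R :=
  if k is 0 then cutoff x else cutoff x - cutoff (dilation a 2 x).

Definition localized j f (k : nat) x :=
  shell k x * ((2 `^ (- j)) ^+ k * f (dilation a (2 ^+ k) x)).

Lemma rschwartz_shell k : rschwartz (shell k).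
Proof.
have rc := @cutoff_rschwartz R n.+1.
case: k => [//|k]; apply: (sboundedD rc); apply: sboundedN.
rewrite dilationE; apply: rschwartz_affine => // i; exact: scaling_neq0.
Qed.

Lemma shell_eq0 : exists2 c : R, 0 < c &
  forall k x, (2 < `|x|) || ((0 < k)%N && (`|x| < c)) -> shell k x = 0.
Proof.
(* Below this radius [x] and its dilate by 2 both lie where the cutoff is 1, so their difference
   vanishes. The dimension is n + 1, hence n + 2. *)
have c0 : 0 < n.+2%:R^-1 / (1 + `|scaling a 2|) by rewrite divr_gt0// ltr_wpDr.
exists (n.+2%:R^-1 / (1 + `|scaling a 2|)) => // k x /orP[x2|/andP[k0]].
  have E : cutoff x = 0 by rewrite cutoff_eq0// ltW.
  case: k => [//|k]; rewrite /= E cutoff_eq0 ?subrr//.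
  have := norm_dilation_ge a1 x (ler1n R 2); nra.
rewrite ltr_pdivlMr ?ltr_wpDr// mulrDr mulr1 => H.
case: k k0 => [//|k] _ /=; rewrite !cutoff_eq1 ?subrr//.
  apply: (le_trans (norm_dilation_bound _ _ _)); rewrite mulrC.
  by apply: le_trans (ltW H); rewrite lerDr.
by apply: le_trans (ltW H); rewrite lerDl mulr_ge0.
Qed.

Lemma iter_partial_localized j f k s x : smooth f ->
  iter_partial s (fun x => (2 `^ (- j)) ^+ k * f (dilation a (2 ^+ k) x)) x =
  (2 `^ (wlen s - j)) ^+ k * iter_partial s f (dilation a (2 ^+ k) x).
Proof.
move=> sf; rewrite iter_partialZ; last exact: smooth_dilation.
rewrite iter_partial_dilation ?exprn_gt0// mulrA; congr (_ * _).
rewrite -[2 ^+ k]powR_mulrn// powRAC powR_mulrn ?powR_ge0// -exprMn -gt0_powRD//.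
by rewrite addrC.
Qed.

(** On the support of a shell with k >= 1, [N x] lies between positive constants, so [1 + N] at the
    dilate of [x] by 2^k is comparable to 2^k. The rescaled symbol and all its derivatives are
    therefore bounded there uniformly in k. *)
Lemma flat_localized j f : rmultiplier j f -> flat_bounded (localized j f).
Proof.
move=> [sf bf].
have sg k : smooth (fun x => (2 `^ (- j)) ^+ k * f (dilation a (2 ^+ k) x)).
  by apply: smoothZ; exact: smooth_dilation.
have sr k : smooth (shell k) by apply: rschwartz_smooth; exact: rschwartz_shell.
have [c c0 Hc] := shell_eq0.
have [m [M [m0 M0 Hm HM]]] := norm_gauge a1 N0 cN NE NZ.
(* Off this region the shells vanish locally. For k >= 1 it has a hole around 0, which also gives
   flatness. *)
pose P (k : nat) x := (`|x| <= 2) && ((k == 0%N) || (c <= `|x|)).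
have br : bounded_on shell P (fun _ _ => 1).
  move=> s; have [C C0 HC] := sbounded_bound 0 s (rschwartz_shell 0).
  have [D D0 HD] := sbounded_bound 0 s (rschwartz_shell 1).
  exists (C + D) => k x _; rewrite mulr1.
  move: (HC tt x) (HD tt x); rewrite /weight expr0 invr1 !mulr1.
  case: k => [|k] H1 H2; [apply: (le_trans H1)|apply: (le_trans H2)].
    by rewrite lerDl.
  by rewrite lerDr.
have bg : bounded_on (fun k x => (2 `^ (- j)) ^+ k * f (dilation a (2 ^+ k) x)) P (fun _ _ => 1).
  move=> s; have [C HC] := bf s.
  (* Chosen so that (1 + 2^k N x) / 2^k lies between 1/q and q: the first two terms come from N x <=
     M (1 + 2), the last from the lower bound of [norm_gauge] outside the hole. *)
  pose q := 1 + 3 * M + (m * Num.min 1 c)^-1.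
  have mc0 : 0 < m * Num.min 1 c by rewrite mulr_gt0// lt_min ltr01.
  exists (`|C| * q `^ `|j - wlen s|) => k x /andP[x2 kx]; rewrite mulr1.
  have k20 : 0 < (2 : R) ^+ k by rewrite exprn_gt0.
  have k21 : 1 <= (2 : R) ^+ k by rewrite exprn_ege1// ler1n.
  rewrite iter_partial_localized// normrM ger0_norm ?exprn_ge0 ?powR_ge0//.
  apply: (@le_trans _ _ ((2 `^ (wlen s - j)) ^+ k * (`|C| * (1 + 2 ^+ k * N x) `^ (j - wlen s)))).
    rewrite ler_wpM2l ?exprn_ge0 ?powR_ge0//; apply: (le_trans (HC _)).
    by rewrite NZ// ler_wpM2r ?powR_ge0 ?ler_norm.
  rewrite mulrCA ler_wpM2l//.
  have -> : (2 `^ (wlen s - j)) ^+ k * (1 + 2 ^+ k * N x) `^ (j - wlen s) =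
     ((1 + 2 ^+ k * N x) / 2 ^+ k) `^ (j - wlen s).
    rewrite powRM ?addr_ge0 ?mulr_ge0 ?invr_ge0 ?(ltW k20)//.
    by rewrite mulrC -exprVn powR_half opprB.
  have q1 : 1 <= q by rewrite /q -addrA lerDl addr_ge0 ?invr_ge0 ?(ltW mc0)// mulr_ge0// ltW.
  apply: powR_sandwich => //; apply/andP; split.
    rewrite invf_ple ?posrE ?(lt_le_trans _ q1)//; last first.
      by rewrite divr_gt0// ltr_wpDr// mulr_ge0// ltW.
    rewrite invf_div ler_pdivrMr; last by rewrite ltr_wpDr// mulr_ge0// ltW.
    case/orP: kx => [/eqP ->|cx].
      by rewrite expr0 mul1r mulr_ege1// lerDl.
    have : m * Num.min 1 c <= N x.
      by apply: le_trans (Hm x); rewrite ler_pM2l// le_min ge_min lexx /= ge_min cx orbT.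
    move=> H.
    have qN : 1 <= q * N x.
      rewrite -(mulVf (negbT (gt_eqF mc0))) ler_pM ?invr_ge0 ?(ltW mc0)//.
      by rewrite /q lerDr addr_ge0// mulr_ge0// ltW.
    rewrite mulrDr mulr1 mulrCA; apply: ler_wpDl; first exact: le_trans q1.
    by rewrite ler_peMr// ltW.
  rewrite ler_pdivrMr//; have := HM x.
  have qM : 1 + 3 * M <= q by rewrite /q lerDl invr_ge0 ltW.
  move: (N0 x) (normr_ge0 x); move: (N x) (`|x|) x2 => u v; move: (2 ^+ k) k21 k20 => w; clear -M0 qM.
  move=> w1 w0 v2 u0 v0 uM.
  have : u <= 3 * M by nra.
  nra.
have sl k : smooth (localized j f k) by apply: smoothM.
have P0 k x s : ~~ P k x -> iter_partial s (localized j f k) x = 0.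
  move=> nP; apply: iter_partial_eq0.
  have op : open [set z : V | 2 < `|z|] .
    exact: open_norm_gt.
  have op' : open [set z : V | `|z| < c] .
    exact: open_norm_lt.
  move: nP; rewrite /P negb_and negb_or -!ltNge => /orP[x2|/andP[k0 xc]].
    have : \near x, 2 < `|x| by exact: open_nbhs_nbhs.
    by apply: filterS => y y2; rewrite /localized Hc ?mul0r// y2.
  have : \near x, `|x| < c by exact: open_nbhs_nbhs.
  by apply: filterS => y yc; rewrite /localized Hc ?mul0r// yc lt0n k0 orbT.
have bl : bounded_on (localized j f) P (fun _ _ => 1 * 1) by apply: bounded_onM.
split; last first.
  by move=> k s; apply: P0; rewrite /P normr0 /= ler0n /= -ltNge.
split => // L s; have [|C C0 HC] := bounded_on_nonneg s _ bl; first by move=> *; rewrite mulr1.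
exists (C * 3 ^+ L) => k x _; case: (boolP (P k x)) => [Px|/P0 ->]; last first.
  by rewrite normr0 mulr_ge0 ?weight_ge0// mulr_ge0// exprn_ge0.
apply: (le_trans (HC k x Px)); rewrite !mulr1 -mulrA ler_peMr//.
rewrite ler_pdivlMr ?exprn_gt0 ?ltr_wpDr// mul1r lerXn2r ?nnegrE ?addr_ge0//.
by case/andP: Px => x2 _; rewrite (_ : 3 = 1 + 2)// lerD2l.
Qed.

Lemma localized_partial_sum j f m x :
  \sum_(k < m.+1) piece j (localized j f) k x = cutoff (dilation a (2^-1 ^+ m) x) * f x.
Proof.
have E k : piece j (localized j f) k x = shell k (dilation a (2^-1 ^+ k) x) * f x.
  rewrite /piece /localized exprVn -{2}[2 ^+ k]invrK dilationK ?invr_gt0 ?exprn_gt0//.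
  by rewrite mulrCA [X in _ * X]mulrA -exprMn -gt0_powRD// subrr powRr0 expr1n mul1r.
elim: m => [|m IH].
  by rewrite big_ord_recr big_ord0 /= add0r E expr0 dilation1.
have D : dilation a 2 (dilation a (2^-1 ^+ m.+1) x) = dilation a (2^-1 ^+ m) x.
  by rewrite dilationM ?ler0n ?(ltW (half_gt0 _))// exprS mulrA divff ?mul1r// pnatr_eq0.
rewrite big_ord_recr IH E /= D; move: (cutoff _) (cutoff _) (f x) => u v w.
by rewrite -mulrDl addrC subrK.
Qed.

(** At a fixed point the partial sums are eventually constant, since the dilates by 2^-m enter the
    region where the cutoff is 1. *)
Lemma fsum_localized j f : rmultiplier j f -> fsum (piece j (localized j f)) = f.
Proof.
move=> mf; apply/funext => x; have [L [C [C0 HC]]] := piece_growth j (flat_localized mf).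
have := geo_cvgn (fun k => HC k x); rewrite -cvg_shiftS => H.
apply: (cvg_unique _ H) => //; apply: cvg_near_cst.
have : (2^-1 ^+ m * `|x|) @[m --> \oo] --> (0 : R).
  have := @cvg_geometric R `|x| 2^-1; rewrite ger0_norm ?invr_ge0// invf_lt1// ltr1n => /(_ isT).
  by apply: cvg_trans; apply: near_eq_cvg; near=> m; rewrite /= mulrC.
have n0 : 0 < n.+2%:R^-1 :> R by rewrite invr_gt0.
move=> /cvgrPdist_le/(_ _ n0); apply: filterS => m; rewrite sub0r normrN => Hm.
rewrite [LHS]localized_partial_sum cutoff_eq1 ?mul1r//.
apply: le_trans (le_trans (ler_norm _) Hm).
by apply: norm_dilation_le => //; rewrite half_gt0 half_le1.
Unshelve. all: by end_near. Qed.

End symbols.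

(** * Complex-valued Schwartz functions and tempered functionals *)

Local Open Scope complex_scope.

Section complex_schwartz.
Variables (R : realType) (d : nat).
Local Notation V := 'rV[R]_d.
Local Notation re f := (@complex.Re R \o f).
Local Notation im f := (@complex.Im R \o f).
Implicit Types (f g psi : V -> R[i]) (x y : V) (al be : multiindex d).

Lemma ReD (x y : R[i]) : complex.Re (x + y) = complex.Re x + complex.Re y.
Proof. by case: x; case: y. Qed.

Lemma ImD (x y : R[i]) : complex.Im (x + y) = complex.Im x + complex.Im y.
Proof. by case: x; case: y. Qed.

Lemma ReB (x y : R[i]) : complex.Re (x - y) = complex.Re x - complex.Re y.
Proof. by case: x; case: y. Qed.

Lemma ImB (x y : R[i]) : complex.Im (x - y) = complex.Im x - complex.Im y.
Proof. by case: x; case: y. Qed.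

Lemma ReM (x y : R[i]) :
  complex.Re (x * y) = complex.Re x * complex.Re y - complex.Im x * complex.Im y.
Proof. by case: x; case: y. Qed.

Lemma ImM (x y : R[i]) :
  complex.Im (x * y) = complex.Re x * complex.Im y + complex.Im x * complex.Re y.
Proof. by case: x => a b; case: y => c e. Qed.

Lemma eq_complex_parts (x y : R[i]) :
  complex.Re x = complex.Re y -> complex.Im x = complex.Im y -> x = y.
Proof. by case: x => a b; case: y => c e /= -> ->. Qed.

Lemma normc_ge0 (z : R[i]) : 0 <= normc z.
Proof. by case: z => a b; exact: sqrtr_ge0. Qed.

Lemma Re_le_normc (z : R[i]) : `|complex.Re z| <= normc z.
Proof.
case: z => a b /=; rewrite -(sqrtr_sqr a); apply: ler_wsqrtr.
by rewrite lerDl sqr_ge0.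
Qed.

Lemma Im_le_normc (z : R[i]) : `|complex.Im z| <= normc z.
Proof.
case: z => a b /=; rewrite -(sqrtr_sqr b); apply: ler_wsqrtr.
by rewrite lerDr sqr_ge0.
Qed.

Lemma normc_le (z : R[i]) : normc z <= `|complex.Re z| + `|complex.Im z|.
Proof.
case: z => a b /=; rewrite -[leRHS]ger0_norm ?addr_ge0// -sqrtr_sqr; apply: ler_wsqrtr.
rewrite sqrrD !real_normK ?num_real// lerD2r lerDl mulrn_wge0// mulr_ge0//.
Qed.

Lemma normc_real (a : R) : normc a%:C = `|a|.
Proof. by rewrite /= expr0n /= addr0 sqrtr_sqr. Qed.

Definition csbounded (I : Type) (F : I -> V -> R[i]) :=
  sbounded (fun i => re (F i)) /\ sbounded (fun i => im (F i)).

Lemma csbounded_pull (I J : Type) (F : I -> V -> R[i]) (h : J -> I) :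
  csbounded F -> csbounded (fun j => F (h j)).
Proof. by move=> [Fr Fi]; split; [exact: (sbounded_pull h Fr)|exact: (sbounded_pull h Fi)]. Qed.

Lemma monomial_bound al : exists L : nat, forall x, `|monomial al x| <= (1 + `|x|) ^+ L.
Proof.
exists (\sum_(i < d) al i)%N => x; rewrite /monomial normr_prod expr_sum.
apply: ler_prod => i _; rewrite normr_ge0 normrX lerXn2r ?nnegrE ?addr_ge0//.
by rewrite (le_trans (le_coord_norm x i))// lerDr.
Qed.

Lemma schwartz_norm_ub al be f x :
  ((`|monomial al x| * normc (mpartial_C be f x))%:E <= schwartz_norm al be f)%E.
Proof. by apply: ereal_sup_ubound; exists x. Qed.

Lemma schwartz_norm_le al be f (B : R) :
  (forall x, `|monomial al x| * normc (mpartial_C be f x) <= B) ->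
  (schwartz_norm al be f <= B%:E)%E.
Proof. by move=> H; apply: ge_ereal_sup => _ [x _ <-]; rewrite lee_fin. Qed.

Lemma schwartz_norm_ge0 al be f : (0 <= schwartz_norm al be f)%E.
Proof.
apply: le_trans (schwartz_norm_ub al be f 0).
by rewrite lee_fin mulr_ge0// normc_ge0.
Qed.

Lemma scaled_bound (I : Type) (G : I -> V -> R) (w : I -> R) L s : (forall i, 0 < w i) ->
  sbounded (fun i x => (w i)^-1 * G i x) ->
  exists2 C : R, 0 <= C & forall i x, `|iter_partial s (G i) x| <= C * w i * weight L x.
Proof.
move=> w0 sG; have [C C0 HC] := sbounded_bound L s sG; exists C => // i x.
have sGi : smooth (G i).
  rewrite (_ : G i = fun x => w i * ((w i)^-1 * G i x)).
    by apply: smoothZ; exact: (sbounded_smooth i sG).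
  by apply/funext => z; rewrite mulVKf ?gt_eqF.
have := HC i x; rewrite iter_partialZ// normrM gtr0_norm ?invr_gt0//.
by rewrite mulrC ler_pdivrMr// mulrAC.
Qed.

(* Dividing by [w] covers both bounded and geometrically small families. *)
Lemma scaled_schwartz_norm (I : Type) (F : I -> V -> R[i]) (w : I -> R) al be :
  (forall i, 0 < w i) -> sbounded (fun i x => (w i)^-1 * re (F i) x) ->
  sbounded (fun i x => (w i)^-1 * im (F i) x) ->
  exists2 C : R, 0 <= C & forall i, (schwartz_norm al be (F i) <= (C * w i)%:E)%E.
Proof.
move=> w0 Fr Fi; have [L HL] := monomial_bound al.
pose s := flatten [seq nseq (be i) i | i <- enum 'I_d].
have [C C0 HC] := scaled_bound L s w0 Fr.
have [D D0 HD] := scaled_bound L s w0 Fi.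
exists (C + D) => [|i]; first exact: addr_ge0.
apply: schwartz_norm_le => x.
have W := expr_weight L x.
rewrite -[leRHS]mulr1 -W mulrCA; apply: ler_pM => //; first exact: normc_ge0.
apply: (le_trans (normc_le _)); rewrite mulrDl mulrDl.
by apply: lerD; [exact: HC|exact: HD].
Qed.

Lemma csbounded_norm (I : Type) (F : I -> V -> R[i]) al be : csbounded F ->
  exists2 C : R, 0 <= C & forall i, (schwartz_norm al be (F i) <= C%:E)%E.
Proof.
move=> [Fr Fi]; have [|||C C0 H] := @scaled_schwartz_norm I F (fun=> 1) al be => //.
- by under eq_fun do under eq_fun do rewrite invr1 mul1r.
- by under eq_fun do under eq_fun do rewrite invr1 mul1r.
by exists C => // i; rewrite -[C]mulr1; exact: H.
Qed.

(** The norms for the monomial 1 and for pure powers of single coordinates are enough to recover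
    every weight, by [weight_of_monomials]. *)
Lemma csboundedP (I : Type) (F : I -> V -> R[i]) : (forall i, smooth_on_C setT (F i)) ->
  (forall al be, exists C : R, forall i, (schwartz_norm al be (F i) <= C%:E)%E) -> csbounded F.
Proof.
move=> sF nF.
have X (p : R[i] -> R) : (forall z, `|p z| <= normc z) ->
    (forall i, smooth (p \o F i)) ->
    (forall i s x, `|iter_partial s (p \o F i) x| <= normc (mpartial_C (multi s) (F i) x)) ->
    sbounded (fun i => p \o F i).
  move=> pn sp H; split => // M s.
  have B al : exists C : R, forall i x, `|monomial al x| * `|iter_partial s (p \o F i) x| <= C.
    have [C HC] := nF al (multi s); exists C => i x; rewrite -lee_fin.
    apply: le_trans (HC i); apply: le_trans (schwartz_norm_ub _ _ _ x).
    by rewrite lee_fin ler_wpM2l.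
  have [A HA] := B [ffun=> 0%N].
  pose al (k : 'I_d) : multiindex d := [ffun i => if i == k then M.+1 else 0%N].
  have [D HD] : exists D : R, forall k i x,
      `|monomial (al k) x| * `|iter_partial s (p \o F i) x| <= D.
    apply: (finite_choice (P := fun k D => forall i x, _ <= D)) => [k C C' CC HC i x|k].
      exact: le_trans (HC i x) CC.
    exact: B.
  exists (2 ^+ M.+1 * (A + d%:R * `|D|)) => i x _.
  apply: (@le_trans _ _ (2 ^+ M.+1 * (A + d%:R * `|D|) * weight M.+1 x)).
    apply: weight_of_monomials.
      have := HA i x; rewrite /monomial big1 ?normr1 ?mul1r// => k _.
      by rewrite ffunE expr0.
    move=> k; have := le_trans (HD k i x) (ler_norm D); rewrite /monomial (bigD1 k)//= big1 => [|l lk].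
      by rewrite ffunE eqxx mulr1 normrX.
    by rewrite ffunE (negbTE lk) expr0.
  have P : 0 <= 2 ^+ M.+1 * (A + d%:R * `|D|).
    by rewrite mulr_ge0 ?exprn_ge0// addr_ge0 ?mulr_ge0//; apply: le_trans (HA i x); rewrite mulr_ge0.
  by rewrite ler_wpM2l// le_weight.
split; apply: X => //.
- exact: Re_le_normc.
- by move=> i; apply/smoothP; case: (sF i).
- move=> i s x; apply: (le_trans _ (Re_le_normc _)) => /=.
  by rewrite mpartialE//; apply/smoothP; case: (sF i).
- exact: Im_le_normc.
- by move=> i; apply/smoothP; case: (sF i).
- move=> i s x; apply: (le_trans _ (Im_le_normc _)) => /=.
  by rewrite mpartialE//; apply/smoothP; case: (sF i).
Qed.

Definition cschwartz f := csbounded (fun _ : unit => f).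

Lemma csbounded_smooth (I : Type) (F : I -> V -> R[i]) i : csbounded F -> smooth_on_C setT (F i).
Proof. by move=> [Fr Fi]; split; apply/smoothP; [exact: (sbounded_smooth i Fr)|exact: (sbounded_smooth i Fi)]. Qed.

Lemma schwartzP f : schwartz f <-> cschwartz f.
Proof.
split=> [[sf nf]|cf].
  apply: csboundedP => // al be; exists (fine (schwartz_norm al be f)) => _.
  rewrite fineK// ge0_fin_numE ?schwartz_norm_ge0//; exact: nf.
split; first exact: (csbounded_smooth tt cf).
move=> al be; have [C C0 H] := csbounded_norm al be cf.
exact: le_lt_trans (H tt) (ltry _).
Qed.

Lemma csbounded_schwartz (I : Type) (F : I -> V -> R[i]) i : csbounded F -> schwartz (F i).
Proof. by move=> cF; apply/schwartzP; exact: (csbounded_pull (fun=> i) cF). Qed.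

Lemma schwartz_boundedP (phi : nat -> V -> R[i]) : schwartz_bounded phi <-> csbounded phi.
Proof.
split=> [[sp np]|cp]; first by apply: csboundedP => // k; case: (sp k).
split=> [k|al be]; first exact: csbounded_schwartz.
by have [C _ H] := csbounded_norm al be cp; exists C.
Qed.


Lemma csbounded_linear (I : Type) (F H : I -> V -> R[i]) (c : R[i]) :
  csbounded F -> csbounded H -> csbounded (fun i x => c * F i x + H i x).
Proof.
move=> [Fr Fi] [Hr Hi]; split.
  rewrite (_ : (fun i => _) = fun i x =>
    complex.Re c * re (F i) x + - (complex.Im c * im (F i) x) + re (H i) x).
    by apply: sboundedD => //; apply: sboundedD; [|apply: sboundedN]; exact: sboundedZ.
  by apply/funext => i; apply/funext => x; rewrite /= ReD ReM.
rewrite (_ : (fun i => _) = fun i x =>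
  complex.Re c * im (F i) x + complex.Im c * re (F i) x + im (H i) x).
  by apply: sboundedD => //; apply: sboundedD; exact: sboundedZ.
by apply/funext => i; apply/funext => x; rewrite /= ImD ImM.
Qed.

(** Continuity and polynomial growth: the functions for which [dist_of] is shown to be a tempered
    distribution. *)
Definition tame (u : V -> R) :=
  continuous u /\ exists (L : nat) (C : R), 0 <= C /\ forall x, `|u x| <= C * (1 + `|x|) ^+ L.

Definition ctame f := tame (re f) /\ tame (im f).

Lemma rschwartz_tame (u : V -> R) : rschwartz u -> tame u.
Proof.
move=> ru; split; first exact: rschwartz_continuous.
have [C C0 H] := rschwartz_bound 0 ru; exists 0%N, C; split => // x.
by apply: (le_trans (H x)); rewrite /weight expr0 invr1.
Qed.

Lemma tame_bound (I : Type) (u : V -> R) (g : I -> V -> R) : tame u -> sbounded g ->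
  exists2 C : R, 0 <= C & forall i x, `|u x * g i x| <= C * weight (2 * d) x.
Proof.
move=> [cu [L [C [C0 HC]]]] sg; have [D D0 HD] := sbounded_bound (2 * d + L) [::] sg.
exists (C * D) => [|i x]; first exact: mulr_ge0.
rewrite normrM; apply: le_trans (ler_pM _ _ (HC x) (HD i x)) _ => //.
have W := expr_weight L x.
by rewrite weightD mulrACA [_ * (weight _ _ * _)]mulrCA W mulr1.
Qed.

Lemma tame_continuous (u g : V -> R) : tame u -> rschwartz g -> continuous (fun x => u x * g x).
Proof. by move=> [cu _] rg; apply: continuous_mul => //; exact: rschwartz_continuous. Qed.

Lemma rint_tame (u g : V -> R) : tame u -> rschwartz g -> rint (fun x => u x * g x).
Proof.
move=> tu rg; have [C C0 H] := tame_bound tu rg.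
by apply: (@rint_weight _ _ _ (2 * d) C) => //; [exact: tame_continuous|exact: (H tt)].
Qed.

Lemma tame_integral_bound (I : Type) (u : V -> R) (g : I -> V -> R) : tame u -> sbounded g ->
  exists B : R, forall i, `|real_integral (fun x => u x * g i x)| <= B.
Proof.
move=> tu sg; have [C C0 H] := tame_bound tu sg.
exists (C * weight_mass R d) => i; apply: (@real_integral_weight _ _ _ (2 * d)) => //.
by apply: tame_continuous => //; exact: sbounded_rschwartz sg.
Qed.

Lemma cschwartz_parts f : cschwartz f -> rschwartz (re f) /\ rschwartz (im f).
Proof. by []. Qed.

Lemma Re_dist_of f psi : ctame f -> cschwartz psi -> complex.Re (dist_of f psi) =
  real_integral (fun x => re f x * re psi x) - real_integral (fun x => im f x * im psi x).
Proof.
move=> [fr fi] [pr pi]; rewrite -real_integralB; try exact: rint_tame.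
by congr real_integral; apply/funext => x; rewrite /= ReM.
Qed.

Lemma Im_dist_of f psi : ctame f -> cschwartz psi -> complex.Im (dist_of f psi) =
  real_integral (fun x => re f x * im psi x) + real_integral (fun x => im f x * re psi x).
Proof.
move=> [fr fi] [pr pi]; rewrite -real_integralD; try exact: rint_tame.
by congr real_integral; apply/funext => x; rewrite /= ImM.
Qed.

Lemma real_integral_linear (u g k h : V -> R) (a b : R) : tame u -> rschwartz g -> rschwartz k ->
  rschwartz h -> real_integral (fun x => u x * (a * g x + b * k x + h x)) =
  a * real_integral (fun x => u x * g x) + b * real_integral (fun x => u x * k x) +
  real_integral (fun x => u x * h x).
Proof.
move=> tu rg rk rh; rewrite -!real_integralZ ?rint_tame// -!real_integralD.
- by congr real_integral; apply/funext => x; rewrite !mulrDr mulrCA [u x * (b * _)]mulrCA.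
- by apply: rintD; apply: rintZ; exact: rint_tame.
- exact: rint_tame.
- by apply: rintZ; exact: rint_tame.
- by apply: rintZ; exact: rint_tame.
Qed.

Lemma dist_of_linear f (c : R[i]) g psi : ctame f -> cschwartz g -> cschwartz psi ->
  dist_of f (fun x => c * g x + psi x) = c * dist_of f g + dist_of f psi.
Proof.
move=> tf cg cp; have cgp := csbounded_linear c cg cp.
have [fr fi] := tf; have [gr gi] := cg; have [pr pi] := cp.
have rE : re (fun x => c * g x + psi x) =
    fun x => complex.Re c * re g x + - complex.Im c * im g x + re psi x.
  by apply/funext => x; rewrite /= ReD ReM mulNr.
have iE : im (fun x => c * g x + psi x) =
    fun x => complex.Re c * im g x + complex.Im c * re g x + im psi x.
  by apply/funext => x; rewrite /= ImD ImM.
apply: eq_complex_parts.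
  rewrite ReD ReM !Re_dist_of// Im_dist_of// rE iE !real_integral_linear//.
  by ring.
rewrite ImD ImM !Im_dist_of// Re_dist_of// rE iE !real_integral_linear//.
by ring.
Qed.

Lemma dist_of_bounded (I : Type) f (F : I -> V -> R[i]) : ctame f -> csbounded F ->
  exists B : R, forall i, normc (dist_of f (F i)) <= B.
Proof.
move=> tf cF; have [fr fi] := tf; have [Fr Fi] := cF.
have [B1 H1] := tame_integral_bound fr Fr; have [B2 H2] := tame_integral_bound fi Fi.
have [B3 H3] := tame_integral_bound fr Fi; have [B4 H4] := tame_integral_bound fi Fr.
exists (B1 + B2 + (B3 + B4)) => i; apply: (le_trans (normc_le _)).
have ci : cschwartz (F i) by exact: (csbounded_pull (fun=> i) cF).
rewrite Re_dist_of// Im_dist_of//; apply: lerD.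
  by apply: (le_trans (ler_normB _ _)); apply: lerD; [exact: H1|exact: H2].
by apply: (le_trans (ler_normD _ _)); apply: lerD; [exact: H3|exact: H4].
Qed.

(** [inv_fourier g x] is by definition [dist_of] of this character at [g], so the facts on [dist_of]
    give linearity and the real and imaginary parts of the transform. *)
Lemma ctame_cis x : ctame (fun xi => cis (- (2 * pi * dotp x xi))).
Proof.
have T b : tame (fun xi => trig b (dotp x xi)).
  split; first exact: (smooth_continuous (smooth_trig b x)).
  by exists 0%N, 1; split => // y; rewrite expr0 mulr1 norm_trig.
split; first by rewrite (_ : re _ = fun xi => trig false (dotp x xi))//;
  apply/funext => y; rewrite /trig /= cosN.
have [c [L [C [C0 HC]]]] := T true.
rewrite (_ : im _ = fun xi => - trig true (dotp x xi)); last first.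
  by apply/funext => y; rewrite /trig /= sinN.
split; first by move=> y; apply: (continuousN (f := fun xi => trig true (dotp x xi))); exact: c.
by exists L, C; split => // y; rewrite normrN.
Qed.

Lemma inv_fourier_linear (c : R[i]) g psi : cschwartz g -> cschwartz psi ->
  inv_fourier (fun x => c * g x + psi x) = (fun x => c * inv_fourier g x + inv_fourier psi x).
Proof.
move=> cg cp; apply/funext => x.
exact: (dist_of_linear c (ctame_cis x) cg cp).
Qed.

Lemma Re_inv_fourier g : cschwartz g ->
  re (inv_fourier g) = (fun x => ft false (re g) x + ft true (im g) x).
Proof.
move=> cg; apply/funext => x; have [gr gi] := cg.
rewrite [LHS](Re_dist_of (ctame_cis x) cg) !ftE -mulN1r -real_integralZ; last first.
  exact: (rint_tame (ctame_cis x).2 gi).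
congr (_ + _); congr real_integral; apply/funext => y /=; rewrite /trig ?cosN ?sinN//.
by rewrite mulN1r mulNr opprK.
Qed.

Lemma Im_inv_fourier g : cschwartz g ->
  im (inv_fourier g) = (fun x => ft false (im g) x - ft true (re g) x).
Proof.
move=> cg; apply/funext => x; have [gr gi] := cg.
rewrite [LHS](Im_dist_of (ctame_cis x) cg) !ftE -[X in _ = _ + X]mulN1r -real_integralZ; last exact: rint_rtrig.
congr (_ + _); congr real_integral; apply/funext => y /=; rewrite /trig ?cosN ?sinN//.
by rewrite mulN1r mulNr.
Qed.

Lemma csbounded_inv_fourier (I : Type) (F : I -> V -> R[i]) : csbounded F ->
  csbounded (fun i => inv_fourier (F i)).
Proof.
move=> cF; have [Fr Fi] := cF.
have ci i : cschwartz (F i) by exact: (csbounded_pull (fun=> i) cF).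
split.
  under eq_fun do rewrite Re_inv_fourier//.
  by apply: sboundedD; exact: sbounded_ft.
under eq_fun do rewrite Im_inv_fourier//.
by apply: sboundedD; [|apply: sboundedN]; exact: sbounded_ft.
Qed.

Lemma cschwartz_tame f : cschwartz f -> ctame f.
Proof. by move=> [fr fi]; split; exact: rschwartz_tame. Qed.

Lemma dist_of_fourier f g : cschwartz f -> cschwartz g ->
  dist_of (inv_fourier f) g = dist_of f (inv_fourier g).
Proof.
move=> cf cg; have cFf := csbounded_inv_fourier cf; have cFg := csbounded_inv_fourier cg.
have [fr fi] := cschwartz_parts cf; have [gr gi] := cschwartz_parts cg.
have tff := cschwartz_tame cFf; have tf := cschwartz_tame cf.
(* [D] and [D'] move the transforms off the first factor by [ft_swap], [A] and [A'] expand the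
   second factor; both sides become the same combination of real integrals. *)
have D u v b w b' : rschwartz u -> rschwartz v -> rschwartz w ->
   real_integral (fun x => (ft b u x + ft b' w x) * v x) =
   real_integral (fun x => u x * ft b v x) + real_integral (fun x => w x * ft b' v x).
  move=> ru rv rw; rewrite (ft_swap b ru rv) (ft_swap b' rw rv) -real_integralD.
  - by congr real_integral; apply/funext => x; rewrite mulrDl mulrC [_ * v x]mulrC.
  - by apply: rschwartz_rint; apply: rschwartzM => //; exact: rschwartz_ft.
  - by apply: rschwartz_rint; apply: rschwartzM => //; exact: rschwartz_ft.
have D' u v b w b' : rschwartz u -> rschwartz v -> rschwartz w ->
   real_integral (fun x => (ft b u x - ft b' w x) * v x) =
   real_integral (fun x => u x * ft b v x) - real_integral (fun x => w x * ft b' v x).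
  move=> ru rv rw; rewrite (ft_swap b ru rv) (ft_swap b' rw rv) -real_integralB.
  - by congr real_integral; apply/funext => x; rewrite mulrBl mulrC [_ * v x]mulrC.
  - by apply: rschwartz_rint; apply: rschwartzM => //; exact: rschwartz_ft.
  - by apply: rschwartz_rint; apply: rschwartzM => //; exact: rschwartz_ft.
have A u v w b b' : rschwartz u -> rschwartz v -> rschwartz w ->
   real_integral (fun x => u x * (ft b v x + ft b' w x)) =
   real_integral (fun x => u x * ft b v x) + real_integral (fun x => u x * ft b' w x).
  move=> ru rv rw; rewrite -real_integralD.
  - by congr real_integral; apply/funext => x; rewrite mulrDr.
  - by apply: rschwartz_rint; apply: rschwartzM => //; exact: rschwartz_ft.
  - by apply: rschwartz_rint; apply: rschwartzM => //; exact: rschwartz_ft.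
have A' u v w b b' : rschwartz u -> rschwartz v -> rschwartz w ->
   real_integral (fun x => u x * (ft b v x - ft b' w x)) =
   real_integral (fun x => u x * ft b v x) - real_integral (fun x => u x * ft b' w x).
  move=> ru rv rw; rewrite -real_integralB.
  - by congr real_integral; apply/funext => x; rewrite mulrBr.
  - by apply: rschwartz_rint; apply: rschwartzM => //; exact: rschwartz_ft.
  - by apply: rschwartz_rint; apply: rschwartzM => //; exact: rschwartz_ft.
apply: eq_complex_parts.
  rewrite !Re_dist_of// !Re_inv_fourier// !Im_inv_fourier// D// D'// A// A'//.
  by ring.
rewrite !Im_dist_of// !Re_inv_fourier// !Im_inv_fourier// D// D'// A// A'//.
by ring.
Qed.

End complex_schwartz.

Section tempered_functionals.
Variables (R : realType) (d : nat).
Local Notation V := 'rV[R]_d.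
Local Notation re f := (@complex.Re R \o f).
Local Notation im f := (@complex.Im R \o f).
Implicit Types (f g psi : V -> R[i]) (x y : V) (al be : multiindex d) (K L : functional R d).

Lemma schwartz_norm_scale al be f (c : R) : 0 < c -> smooth_on_C setT f ->
  (schwartz_norm al be (fun x => (c%:C * f x)%R) <= c%:E * schwartz_norm al be f)%E.
Proof.
move=> c0 [/smoothP fr /smoothP fi]; apply: ge_ereal_sup => _ [x _ <-].
have rE : re (fun x => c%:C * f x) = fun x => c * re f x.
  by apply/funext => y; rewrite /= ReM mul0r subr0.
have iE : im (fun x => c%:C * f x) = fun x => c * im f x.
  by apply/funext => y; rewrite /= ImM mul0r addr0.
have -> : mpartial_C be (fun x => c%:C * f x) x = c%:C * mpartial_C be f x.
  rewrite /mpartial_C rE iE /mpartial !iter_partialZ//.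
  by apply: eq_complex_parts; rewrite ?ReM ?ImM /= mul0r ?subr0 ?addr0.
rewrite ComplexField.Normc.normcM normc_real (gtr0_norm c0) mulrCA EFinM.
rewrite lee_pmul2l//; exact: schwartz_norm_ub.
Qed.

Lemma schwartz_norm_fin al be f : schwartz f -> schwartz_norm al be f \is a fin_num.
Proof. by move=> [_ sf]; rewrite ge0_fin_numE ?schwartz_norm_ge0//; exact: sf. Qed.

Lemma tempered_csbounded (I : Type) K (F : I -> V -> R[i]) : tempered K -> csbounded F ->
  exists B : R, forall i, normc (K (F i)) <= B.
Proof.
move=> [_ [C [s HC]]] cF.
have /choice[c Hc] : forall p : multiindex d * multiindex d,
    exists C : R, forall i, (schwartz_norm p.1 p.2 (F i) <= C%:E)%E.
  by move=> p; have [D _ HD] := csbounded_norm p.1 p.2 cF; exists D.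
exists (`|C| * \sum_(p <- s) c p) => i; rewrite -lee_fin.
have sFi : schwartz (F i) by exact: csbounded_schwartz.
apply: (le_trans (HC _ sFi)); rewrite EFinM.
apply: (@le_trans _ _ (`|C|%:E * \sum_(p <- s) schwartz_norm p.1 p.2 (F i))%E).
  rewrite lee_wpmul2r//; last by rewrite lee_fin ler_norm.
  by apply: sume_ge0 => p _; exact: schwartz_norm_ge0.
rewrite lee_wpmul2l ?lee_fin// -sumEFin; apply: lee_sum => p _; exact: Hc.
Qed.

(* A functional violating the Schwartz-norm estimate for every constant and every
   finite set of norms is unbounded on a suitably rescaled sequence. *)
Lemma temperedP K :
  (forall (c : R[i]) f g, schwartz f -> schwartz g ->
     K (fun x => c * f x + g x) = c * K f + K g) ->
  (forall F : nat -> V -> R[i], csbounded F -> exists B : R, forall k, normc (K (F k)) <= B) ->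
  tempered K.
Proof.
move=> linK bK; split => //; apply: contrapT => H.
pose P := (multiindex d * multiindex d)%type.
(* The pairs of multiindices with code below m: each pair belongs to all but finitely many of these
   lists. *)
pose s m : seq P := pmap unpickle (iota 0 m).
have /choice[f Hf] : forall m : nat, exists f, schwartz f /\
    (m.+1%:R%:E * \sum_(p <- s m) schwartz_norm p.1 p.2 f < (normc (K f))%:E)%E.
  move=> m; apply: contrapT => nf; apply: H; exists m.+1%:R, (s m) => f sf.
  by rewrite leNgt; apply/negP => lt; apply: nf; exists f.
have sf m : schwartz (f m) by case: (Hf m).
pose sg m : R := fine (\sum_(p <- s m) schwartz_norm p.1 p.2 (f m))%E.
have sgE m : (\sum_(p <- s m) schwartz_norm p.1 p.2 (f m) = (sg m)%:E)%E.
  by rewrite fineK//; apply/sum_fin_numP => p _ _; exact: schwartz_norm_fin.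
have sg0 m : 0 <= sg m.
  by rewrite fine_ge0//; apply: sume_ge0 => p _; exact: schwartz_norm_ge0.
have ltK m : m.+1%:R * sg m < normc (K (f m)).
  by have [_] := Hf m; rewrite sgE -EFinM lte_fin.
have K0 m : 0 < normc (K (f m)) by apply: le_lt_trans (ltK m); rewrite mulr_ge0.
(* After this rescaling [K] has modulus m + 1 on [psi m], while the norms with code below m are at
   most 1. *)
pose l m : R := m.+1%:R / normc (K (f m)).
have l0 m : 0 < l m by rewrite divr_gt0.
pose psi m : V -> R[i] := fun x => (l m)%:C * f m x.
have spsi m : schwartz (psi m).
  have /schwartzP cf := sf m; apply/schwartzP.
  (* Linearity is stated for combinations [c * f + g], so the multiple by l is written as (l - 1) f
     + f. *)
  have := csbounded_linear ((l m)%:C - 1) cf cf.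
  rewrite (_ : (fun i => _) = fun=> psi m)//; apply/funext => _; apply/funext => x.
  by rewrite mulrBl mul1r subrK.
have nK m : normc (K (psi m)) = m.+1%:R.
  have -> : psi m = fun x => ((l m)%:C - 1) * f m x + f m x.
    by apply/funext => x; rewrite mulrBl mul1r subrK.
  rewrite linK// mulrBl mul1r subrK ComplexField.Normc.normcM normc_real gtr0_norm//.
  by rewrite divfK// gt_eqF.
have le1 m (p : P) : (pickle p < m)%N -> (schwartz_norm p.1 p.2 (psi m) <= 1)%E.
  move=> pm; have ps : p \in s m.
    by rewrite mem_pmap; apply/mapP; exists (pickle p); rewrite ?mem_iota ?pickleK.
  apply: (le_trans (schwartz_norm_scale _ _ (l0 m) (proj1 (sf m)))).
  apply: (@le_trans _ _ ((l m)%:E * (sg m)%:E)%E).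
    rewrite lee_wpmul2l ?lee_fin ?(ltW (l0 m))//.
    rewrite -(sgE m) (big_rem _ ps)/= leeDl//.
    by apply: sume_ge0 => q _; exact: schwartz_norm_ge0.
  by rewrite -EFinM lee_fin mulrAC ler_pdivrMr// mul1r ltW.
have cpsi : csbounded psi.
  apply: csboundedP => [m|al be]; first by case: (spsi m).
  pose q m := fine (schwartz_norm al be (psi m)).
  have q0 m : 0 <= q m by rewrite fine_ge0// schwartz_norm_ge0.
  (* Only the finitely many m up to the code of the pair can escape the bound 1; the sum covers
     them. *)
  exists (1 + \sum_(m < (pickle (al, be)).+1) q m) => m.
  have [pm|mp] := ltnP (pickle (al, be)) m.
    apply: (le_trans (le1 m (al, be) pm)).
    by rewrite lee_fin lerDl sumr_ge0.
  have -> : schwartz_norm al be (psi m) = (q m)%:E by rewrite fineK// schwartz_norm_fin.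
  rewrite lee_fin (bigD1 (Ordinal (mp : m < _.+1)%N))//= addrCA lerDl addr_ge0// sumr_ge0//.
have [B HB] := bK _ cpsi.
have := HB (Num.bound `|B|); rewrite nK leNgt => /negP; apply.
apply: (le_lt_trans (ler_norm B)); apply: (lt_trans (archi_boundP (normr_ge0 B))).
by rewrite ltr_nat.
Qed.

Lemma csbounded0 (I : Type) : csbounded (fun (_ : I) (_ : V) => 0 : R[i]).
Proof.
have b0 : sbounded (fun (_ : I) (_ : V) => 0 : R).
  split=> [_|M s]; first exact: smooth_cst.
  exists 0 => _ x _; case: s => [|i s]; first by rewrite normr0 mul0r.
  by rewrite iter_partial_cst// normr0 mul0r.
by split.
Qed.

Lemma tempered0 K : tempered K -> K (fun=> 0) = 0.
Proof.
move=> [linK _]; have /schwartzP s0 : cschwartz (fun _ : V => 0 : R[i]) by exact: csbounded0.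
have := linK 1 _ _ s0 s0; rewrite !mul1r addr0.
by move=> /eqP; rewrite -subr_eq0 opprD addrA subrr sub0r oppr_eq0 => /eqP.
Qed.

Lemma tempered_dist_of f : ctame f -> tempered (dist_of f).
Proof.
move=> tf; apply: temperedP => [c g psi /schwartzP cg /schwartzP cp|F cF].
  exact: dist_of_linear.
exact: dist_of_bounded.
Qed.

Lemma tempered_inv_fourier K : tempered K -> tempered (inv_fourier_dist K).
Proof.
move=> tK; have [linK _] := tK; apply: temperedP => [c g psi /schwartzP cg /schwartzP cp|F cF].
  rewrite /inv_fourier_dist inv_fourier_linear// linK//.
    by apply/schwartzP; exact: (csbounded_inv_fourier cg).
  by apply/schwartzP; exact: (csbounded_inv_fourier cp).
by apply: (tempered_csbounded tK); exact: csbounded_inv_fourier.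
Qed.

Definition bounded_derivatives (u : V -> R) :=
  smooth u /\ forall s, exists C : R, forall x, `|iter_partial s u x| <= C.

Definition cbounded_derivatives f := bounded_derivatives (re f) /\ bounded_derivatives (im f).

Lemma sbounded_mul (I : Type) (u : V -> R) (F : I -> V -> R) : bounded_derivatives u ->
  sbounded F -> sbounded (fun i x => u x * F i x).
Proof.
move=> [su bu] sF; under eq_fun do under eq_fun do rewrite mulrC.
apply: (sboundedM (m := 0)) => // s; have [C HC] := bu s; exists C => i x _.
by rewrite expr0 mulr1.
Qed.

Lemma csbounded_mul (I : Type) f (F : I -> V -> R[i]) : cbounded_derivatives f ->
  csbounded F -> csbounded (fun i x => f x * F i x).
Proof.
move=> [fr fi] [Fr Fi]; split.
  rewrite (_ : (fun i => _) = fun i x => re f x * re (F i) x + - (im f x * im (F i) x)).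
    by apply: sboundedD; [|apply: sboundedN]; exact: sbounded_mul.
  by apply/funext => i; apply/funext => x; rewrite /= ReM.
rewrite (_ : (fun i => _) = fun i x => re f x * im (F i) x + im f x * re (F i) x).
  by apply: sboundedD; exact: sbounded_mul.
by apply/funext => i; apply/funext => x; rewrite /= ImM.
Qed.

Lemma tempered_mul f K : cbounded_derivatives f -> tempered K -> tempered (dist_mul f K).
Proof.
move=> bf tK; have [linK _] := tK; apply: temperedP => [c g psi /schwartzP cg /schwartzP cp|F cF].
  rewrite /dist_mul (_ : (fun x => _) = fun x => c * (f x * g x) + f x * psi x).
    by rewrite linK//; apply/schwartzP; apply: (csbounded_mul (I := unit)).
  by apply/funext => x; rewrite mulrDr mulrCA.
by apply: (tempered_csbounded tK); exact: csbounded_mul.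
Qed.

Definition tame_series (h : nat -> V -> R) :=
  [/\ forall k, continuous (h k), continuous (fsum h) &
    exists (L : nat) (C : R), 0 <= C /\ forall k x, `|h k x| <= C * (1 + `|x|) ^+ L * 2^-1 ^+ k].

Lemma tame_series_term h k : tame_series h -> tame (h k).
Proof.
move=> [ch _ [L [C [C0 H]]]]; split => //; exists L, C; split => // x.
apply: (le_trans (H k x)); rewrite ler_piMr ?mulr_ge0 ?exprn_ge0 ?addr_ge0//.
by rewrite exprn_ile1 ?invr_ge0// invf_le1// ler1n.
Qed.

Lemma tame_series_sum h : tame_series h -> tame (fsum h).
Proof.
move=> [_ cf [L [C [C0 H]]]]; split => //; exists L, (2 * C); split=> [|x]; first exact: mulr_ge0.
by rewrite -mulrA; apply: geo_le => k; exact: H.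
Qed.

(** The tail after m terms is O(2^-m) times a fixed power of 1 + |x|, which the decay of [g]
    absorbs; the integrals converge at an explicit rate. *)
Lemma tame_series_integral h (g : V -> R) : tame_series h -> rschwartz g ->
  (\sum_(k < m) real_integral (fun x => h k x * g x)) @[m --> \oo] -->
  real_integral (fun x => fsum h x * g x).
Proof.
move=> th rg; have ts := tame_series_sum th; have tt k := tame_series_term k th.
have [_ _ [L [C [C0 H]]]] := th.
have [D D0 HD] := rschwartz_bound (2 * d + L) rg.
have E m : `|real_integral (fun x => fsum h x * g x) - \sum_(k < m) real_integral (fun x => h k x * g x)|
    <= 2 * C * D * weight_mass R d * 2^-1 ^+ m.
  have S p : rint (fun x => (\sum_(k < p) h k x) * g x) /\
      \sum_(k < p) real_integral (fun x => h k x * g x) =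
      real_integral (fun x => (\sum_(k < p) h k x) * g x).
    elim: p => [|p [ri IH]].
      split; last by rewrite big_ord0; under eq_fun do rewrite big_ord0; 
        rewrite (_ : (fun=> _) = fun x => 0 * g x) ?real_integralZ ?mul0r//; exact: rschwartz_rint.
      by under eq_fun do rewrite big_ord0; exact: rintZ (rschwartz_rint rg).
    have E : (fun x => (\sum_(k < p.+1) h k x) * g x) =
        fun x => (\sum_(k < p) h k x) * g x + h p x * g x.
      by apply/funext => x; rewrite big_ord_recr mulrDl.
    rewrite E; split; first by apply: rintD => //; exact: rint_tame.
    by rewrite big_ord_recr/= IH real_integralD//; exact: rint_tame.
  have [ri ->] := S m; rewrite -real_integralB//; last exact: rint_tame.
  rewrite mulrAC.
  apply: (@real_integral_weight _ _ _ (2 * d)) => //.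
  - apply: continuous_sub; first exact: tame_continuous.
    apply: continuous_mul; last exact: rschwartz_continuous.
    elim: m {ri S} => [|m IH]; first by under eq_fun do rewrite big_ord0; exact: cst_continuous.
    by under eq_fun do rewrite big_ord_recr; apply: continuous_add => //; case: (tt m).
  - by rewrite !mulr_ge0// exprn_ge0// invr_ge0.
  move=> x; rewrite -mulrBl normrM.
  apply: le_trans (ler_pM _ _ (geo_tail m (fun k => H k x)) (HD x)) _ => //.
  have W := expr_weight L x.
  rewrite weightD; move: W; move: (_ ^+ L) (weight L x) (weight (2 * d) x) (2^-1 ^+ m) => p q r u W.
  rewrite (_ : 2 * (C * p) * u * (D * (r * q)) = 2 * C * D * u * r * (p * q)); last by ring.
  by rewrite W mulr1.
apply/cvgrPdist_le => e e0.
have := @cvg_geometric R (2 * C * D * weight_mass R d) 2^-1.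
rewrite ger0_norm ?invr_ge0// invf_lt1// ltr1n => /(_ isT)/cvgrPdist_le/(_ e e0).
apply: filterS => m; rewrite sub0r normrN => Hm; apply: (le_trans (E m)).
exact: le_trans (ler_norm _) Hm.
Qed.

Definition ctame_series (h : nat -> V -> R[i]) :=
  tame_series (fun k => re (h k)) /\ tame_series (fun k => im (h k)).

Definition csum (h : nat -> V -> R[i]) : V -> R[i] :=
  fun x => fsum (fun k => re (h k)) x +i* fsum (fun k => im (h k)) x.

Lemma ctame_csum h : ctame_series h -> ctame (csum h).
Proof. by move=> [hr hi]; split; exact: tame_series_sum. Qed.

Lemma Re_sum (I : Type) (r : seq I) (F : I -> R[i]) :
  complex.Re (\sum_(i <- r) F i) = \sum_(i <- r) complex.Re (F i).
Proof.
by elim: r => [|i r IH]; rewrite ?big_nil// !big_cons ReD IH.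
Qed.

Lemma Im_sum (I : Type) (r : seq I) (F : I -> R[i]) :
  complex.Im (\sum_(i <- r) F i) = \sum_(i <- r) complex.Im (F i).
Proof.
by elim: r => [|i r IH]; rewrite ?big_nil// !big_cons ImD IH.
Qed.

Lemma dist_series_csum h : ctame_series h -> dist_series h (dist_of (csum h)).
Proof.
move=> ch psi /schwartzP cp; have [hr hi] := ch; have [pr pi] := cschwartz_parts cp.
have th k : ctame (h k) by split; [exact: tame_series_term hr|exact: tame_series_term hi].
have tc := ctame_csum ch.
have C1 := tame_series_integral hr pr; have C2 := tame_series_integral hi pi.
have C3 := tame_series_integral hr pi; have C4 := tame_series_integral hi pr.
have Cr : (complex.Re (\sum_(k < m) dist_of (h k) psi)) @[m --> \oo] --> complex.Re (dist_of (csum h) psi).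
  rewrite Re_dist_of// (_ : (fun m => _) = fun m =>
    \sum_(k < m) real_integral (fun x => re (h k) x * re psi x) -
    \sum_(k < m) real_integral (fun x => im (h k) x * im psi x)).
    exact: cvgB C1 C2.
  by apply/funext => m; rewrite Re_sum -sumrB; apply: eq_bigr => k _; rewrite Re_dist_of.
have Ci : (complex.Im (\sum_(k < m) dist_of (h k) psi)) @[m --> \oo] --> complex.Im (dist_of (csum h) psi).
  rewrite Im_dist_of// (_ : (fun m => _) = fun m =>
    \sum_(k < m) real_integral (fun x => re (h k) x * im psi x) +
    \sum_(k < m) real_integral (fun x => im (h k) x * re psi x)).
    exact: cvgD C3 C4.
  by apply/funext => m; rewrite Im_sum -big_split; apply: eq_bigr => k _; rewrite Im_dist_of.
apply/cvgrPdist_le => e e0; have e20 : 0 < e / 2 by rewrite divr_gt0.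
move/cvgrPdist_le : Cr => /(_ _ e20) Cr; move/cvgrPdist_le : Ci => /(_ _ e20) Ci.
near=> m; rewrite sub0r normrN ger0_norm ?normc_ge0//.
apply: (le_trans (normc_le _)); rewrite (splitr e); apply: lerD.
  by rewrite ReB distrC; near: m.
by rewrite ImB distrC; near: m.
Unshelve. all: by end_near. Qed.

Lemma dist_cvg_unique T K L : dist_cvg T K -> dist_cvg T L -> eq_dist K L.
Proof.
move=> TK TL psi sp; apply/eqP; rewrite -subr_eq0; apply/eqP/ComplexField.Normc.eq0_normc.
apply/eqP; rewrite eq_le normc_ge0 andbT; apply/ler_addgt0Pr => e e0; rewrite add0r.
have e20 : 0 < e / 2 by rewrite divr_gt0.
have /cvgrPdist_le/(_ _ e20) H1 := TK psi sp; have /cvgrPdist_le/(_ _ e20) H2 := TL psi sp.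
have [m _ /(_ m (leqnn _))[{}H1 {}H2]] := filterI H1 H2.
rewrite -[K psi](subrK (T m psi)) -addrA (splitr e).
apply: (le_trans (le_normcD _ _)); apply: lerD.
  by move: H1; rewrite sub0r normrN ger0_norm ?normc_ge0// -normcN opprB.
by move: H2; rewrite sub0r normrN ger0_norm ?normc_ge0.
Qed.

End tempered_functionals.

(** * Moments and dyadic pieces under the Fourier transform *)

Section moments.
Variables (R : realType) (d : nat).
Local Notation V := 'rV[R]_d.
Implicit Types (f g : V -> R) (x y : V) (l : seq 'I_d).

Lemma multi_flatten (al : multiindex d) :
  multi (flatten [seq nseq (al k) k | k <- enum 'I_d]) = al.
Proof. by apply/ffunP => i; rewrite ffunE count_flatten_nseq. Qed.

Lemma monomial_multi l x : monomial (multi l) x = \prod_(k <- l) x 0 k.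
Proof.
rewrite /monomial; elim: l => [|k l IH].
  by rewrite big_nil big1// => i _; rewrite ffunE expr0.
rewrite big_cons -IH (bigD1 k)//= [in RHS](bigD1 k)//= mulrA; congr (_ * _).
  by rewrite !ffunE /= eqxx add1n exprS.
by apply: eq_bigr => i ik; rewrite !ffunE /= eq_sym (negbTE ik).
Qed.

Lemma rschwartz_monomial f l : rschwartz f -> rschwartz (fun x => (\prod_(k <- l) x 0 k) * f x).
Proof.
move=> rf; elim: l => [|k l IH].
  by under eq_fun do rewrite big_nil mul1r.
have := sbounded_coord k IH; rewrite /rschwartz.
congr sbounded; apply/funext => _; apply/funext => x.
by rewrite big_cons mulrC mulrA.
Qed.

(** Each coordinate factor is traded for a derivative of [f] by [coord_ft], with a change of parity.
    The integral of the last transform is 0 or a multiple of a derivative of [f] at 0. *)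
Lemma moment_ft b f l : rschwartz f -> (forall s, iter_partial s f 0 = 0) ->
  real_integral (fun x => (\prod_(k <- l) x 0 k) * ft b f x) = 0.
Proof.
move=> + +; elim: l b f => [|k l IH] b f rf f0.
  under eq_fun do rewrite big_nil mul1r.
  by case: b; [exact: integral_ft_sin|rewrite integral_ft_cos// -[f 0]/(iter_partial [::] f 0) f0 mulr0].
have rp : rschwartz (partial k f) by exact: sbounded_partial.
rewrite (_ : (fun x => _) = fun x => tsign R b / (2 * pi) *
    ((\prod_(i <- l) x 0 i) * ft (~~ b) (partial k f) x)).
  rewrite real_integralZ; last first.
    by apply: rschwartz_rint; apply: rschwartz_monomial; exact: rschwartz_ft.
  by rewrite IH ?mulr0// => s; rewrite -iter_partial_rcons f0.
apply/funext => x; rewrite big_cons mulrAC coord_ft//.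
by rewrite -[LHS]mulrA; congr (_ * _); exact: mulrC.
Qed.

(** Dual to [moment_ft]: each derivative becomes a coordinate factor under the integral, and at 0
    the kernel is the constant 1 or 0. *)
Lemma flat_ft b f s : rschwartz f ->
  (forall l, real_integral (fun x => (\prod_(k <- l) x 0 k) * f x) = 0) ->
  iter_partial s (ft b f) 0 = 0.
Proof.
move=> + +; elim/last_ind: s b f => [|s i IH] b f rf f0.
  rewrite /= ftE; have := f0 [::]; under eq_fun do rewrite big_nil mul1r.
  have D y : dotp (0 : V) y = 0 by rewrite /dotp big1// => k _; rewrite mxE mul0r.
  under [in X in _ -> X]eq_fun do rewrite D /trig mulr0 sin0 cos0.
  case: b => // H; last by under eq_fun do rewrite mul1r.
  by rewrite real_integralZ ?mul0r//; exact: rschwartz_rint.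
rewrite iter_partial_rcons partial_ft//; apply: IH.
  by apply: sboundedZ; exact: sbounded_coord.
move=> l; rewrite (_ : (fun x => _) = fun x => 2 * pi * tsign R b * ((\prod_(k <- i :: l) x 0 k) * f x)).
  by rewrite real_integralZ ?f0 ?mulr0//; apply: rschwartz_rint; exact: rschwartz_monomial.
apply/funext => x; rewrite big_cons; move: (\prod_(k <- l) _) (f x) (x 0 i) (2 * pi * _) => p q r u.
by ring.
Qed.

End moments.

Section pieces.
Variables (R : realType) (n : nat) (a : 'I_n.+1 -> R).
Hypothesis a1 : forall i, 1 <= a i.
Local Notation V := 'rV[R]_n.+1.
Local Notation Q := (\sum_(i < n.+1) a i).
Local Notation re f := (@complex.Re R \o f).
Local Notation im f := (@complex.Im R \o f).

Let half_gt0 k : 0 < (2^-1 : R) ^+ k.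
Proof. by rewrite exprn_gt0// invr_gt0. Qed.

Lemma rschwartz_piece j (Phi : nat -> V -> R) k : rschwartz (Phi k) -> rschwartz (piece a j Phi k).
Proof.
move=> rP; apply: sboundedZ; rewrite dilationE; apply: rschwartz_affine => // i.
exact: scaling_neq0.
Qed.

(** The dilation by 2^-k has Jacobian 2^(-Qk); this is where the exponent j becomes j + Q. *)
Lemma ft_piece b j (Phi : nat -> V -> R) k x : rschwartz (Phi k) ->
  ft b (piece a j Phi k) x = (2 `^ (j + Q)) ^+ k * ft b (Phi k) (dilation a (2 ^+ k) x).
Proof.
move=> rP; have c0 i : scaling a (2^-1 ^+ k) 0 i != 0 by exact: scaling_neq0.
rewrite /piece dilationE ftZ; last exact: rschwartz_affine.
rewrite ft_affine// inv_scaling// -exprVn invrK -dilationE mulrA; congr (_ * _).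
rewrite gt0_powRD// exprMn; congr (_ * _).
rewrite (eq_bigr (fun i => (scaling a (2^-1 ^+ k) 0 i)^-1)) => [|i _].
  rewrite prodfV prod_scaling// -[wlen _ _]/Q powR_half powRN exprVn invrK//.
by rewrite [in LHS]mxE ger0_norm ?powR_ge0// mxE.
Qed.

End pieces.

Section complex_pieces.
Variables (R : realType) (n : nat) (G : homogeneous_group R n).
Local Notation V := 'rV[R]_n.+1.
Local Notation a := (hg_exponent G).
Local Notation re f := (@complex.Re R \o f).
Local Notation im f := (@complex.Im R \o f).

Lemma hg_exponent_ge1 i : 1 <= a i.
Proof. by rewrite -(hg_exponent0 G); exact: hg_exponent_le. Qed.

Let a1 := hg_exponent_ge1.

Definition cflat (Phi : nat -> V -> R[i]) :=
  flat_bounded (fun k => re (Phi k)) /\ flat_bounded (fun k => im (Phi k)).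

Definition cpiece j (Phi : nat -> V -> R[i]) (k : nat) : V -> R[i] :=
  fun x => ((2 `^ j) ^+ k)%:C * Phi k (dilation a (2^-1 ^+ k) x).

Lemma Re_cpiece j Phi k : re (cpiece j Phi k) = piece a j (fun k => re (Phi k)) k.
Proof. by apply/funext => x; rewrite /= ReM mul0r subr0. Qed.

Lemma Im_cpiece j Phi k : im (cpiece j Phi k) = piece a j (fun k => im (Phi k)) k.
Proof. by apply/funext => x; rewrite /= ImM mul0r addr0. Qed.

Lemma cflat_csbounded Phi : cflat Phi -> csbounded Phi.
Proof. by move=> [[sr _] [si _]]. Qed.

Lemma cschwartz_cpiece j Phi k : csbounded Phi -> cschwartz (cpiece j Phi k).
Proof.
move=> [Pr Pi]; split.
  by rewrite Re_cpiece; apply: rschwartz_piece => //; exact: (sbounded_rschwartz k Pr).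
by rewrite Im_cpiece; apply: rschwartz_piece => //; exact: (sbounded_rschwartz k Pi).
Qed.

Lemma dyadic_piece_inv_fourier j Phi k : csbounded Phi ->
  dyadic_piece G j (fun k => inv_fourier (Phi k)) k = inv_fourier (cpiece j Phi k).
Proof.
move=> cP; have [Pr Pi] := cP; have ck := cschwartz_cpiece j k cP.
have rr : rschwartz (re (Phi k)) by exact: (sbounded_rschwartz k Pr).
have ri : rschwartz (im (Phi k)) by exact: (sbounded_rschwartz k Pi).
have cPk : cschwartz (Phi k) by exact: (csbounded_pull (fun=> k) cP).
have E : 2 `^ ((j + homogeneous_dim G) * k%:R) = (2 `^ (j + \sum_(i < n.+1) a i)) ^+ k.
  by rewrite powRrM powR_mulrn// powR_ge0.
apply/funext => x; apply: eq_complex_parts.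
  rewrite -[RHS]/((re (inv_fourier (cpiece j Phi k))) x) Re_inv_fourier// Re_cpiece Im_cpiece.
  rewrite !ft_piece// /dyadic_piece ReM mul0r subr0 E -mulrDr; congr (_ * _).
  by rewrite -[LHS]/((re (inv_fourier (Phi k))) _) Re_inv_fourier.
rewrite -[RHS]/((im (inv_fourier (cpiece j Phi k))) x) Im_inv_fourier// Re_cpiece Im_cpiece.
rewrite !ft_piece// /dyadic_piece ImM mul0r addr0 E -mulrBr; congr (_ * _).
by rewrite -[LHS]/((im (inv_fourier (Phi k))) _) Im_inv_fourier.
Qed.

Lemma ctame_series_cpiece j Phi : cflat Phi -> ctame_series (cpiece j Phi).
Proof.
have X (P : nat -> V -> R) : flat_bounded P -> tame_series (piece a j P).
  move=> fP; have gP := geometric_piece a1 j fP; split; last exact: piece_growth.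
    by move=> k; apply: smooth_continuous; case: gP.
  by apply: smooth_continuous; exact: smooth_fsum.
move=> [fr fi]; split.
  by under eq_fun do rewrite Re_cpiece; exact: X.
by under eq_fun do rewrite Im_cpiece; exact: X.
Qed.

Lemma Re_csum_cpiece j Phi :
  re (csum (cpiece j Phi)) = fsum (piece a j (fun k => re (Phi k))).
Proof. by rewrite -(_ : (fun k => re (cpiece j Phi k)) = piece a j (fun k => re (Phi k)))//;
  apply/funext => k; exact: Re_cpiece. Qed.

Lemma Im_csum_cpiece j Phi :
  im (csum (cpiece j Phi)) = fsum (piece a j (fun k => im (Phi k))).
Proof. by rewrite -(_ : (fun k => im (cpiece j Phi k)) = piece a j (fun k => im (Phi k)))//;
  apply/funext => k; exact: Im_cpiece. Qed.

(** Testing a dyadic piece on [psi] is testing the corresponding [cpiece] on [inv_fourier psi], so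
    convergence is inherited from the series of symbols. *)
Lemma dist_series_dyadic j Phi : cflat Phi ->
  dist_series (dyadic_piece G j (fun k => inv_fourier (Phi k)))
    (inv_fourier_dist (dist_of (csum (cpiece j Phi)))).
Proof.
move=> fP psi sp; have /schwartzP cp := sp; have cP := cflat_csbounded fP.
have cF : cschwartz (inv_fourier psi) by exact: (csbounded_inv_fourier cp).
have := dist_series_csum (ctame_series_cpiece j fP) (proj2 (schwartzP _) cF).
apply: cvg_trans; apply: near_eq_cvg; apply: nearW => m.
congr (normc (_ - _)); apply: eq_bigr => k _.
by rewrite dyadic_piece_inv_fourier// dist_of_fourier//; exact: cschwartz_cpiece.
Qed.

Lemma weighted_length_multi s : weighted_length G (multi s) = wlen a s.
Proof.
rewrite /weighted_length /wlen; elim: s => [|k s IH].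
  by rewrite big_nil big1// => i _; rewrite ffunE mulr0.
rewrite big_cons -IH (bigD1 k)//= [in RHS](bigD1 k)//= addrA; congr (_ + _).
  by rewrite !ffunE /= eqxx add1n -natr1 mulrDr mulr1 addrC.
by apply: eq_bigr => i ik; rewrite !ffunE /= eq_sym (negbTE ik).
Qed.

Lemma multiplierP N j J : multiplier G N j J <->
  rmultiplier a N j (re J) /\ rmultiplier a N j (im J).
Proof.
have N0 xi e : 0 <= (1 + N xi) `^ e by exact: powR_ge0.
split=> [[[/smoothP sr /smoothP si] H]|[[sr Hr] [si Hi]]].
  split; (split => // s); have [C C0 HC] := H (multi s); exists C => x;
    rewrite -weighted_length_multi; apply: le_trans (HC x); rewrite -mpartialE//.
    exact: (Re_le_normc (mpartial_C (multi s) J x)).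
  exact: (Im_le_normc (mpartial_C (multi s) J x)).
split; first by split; exact/smoothP.
move=> al; pose s := flatten [seq nseq (al i) i | i <- enum 'I_n.+1].
have -> : weighted_length G al = wlen a s by rewrite -weighted_length_multi multi_flatten.
have [C HC] := Hr s; have [D HD] := Hi s.
(* The added 1 makes the constant positive, as [multiplier] demands. *)
exists (`|C| + `|D| + 1) => [|x]; first by rewrite ltr_wpDl// addr_ge0.
apply: (le_trans (normc_le _)).
apply: (@le_trans _ _ ((`|C| + `|D|) * (1 + N x) `^ (j - wlen a s))).
  rewrite mulrDl; apply: lerD.
    by apply: (le_trans (HC x)); rewrite ler_wpM2r// ler_norm.
  by apply: (le_trans (HD x)); rewrite ler_wpM2r// ler_norm.
by rewrite ler_wpM2r// lerDl.
Qed.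

Section gauge.
Variable N : V -> R.
Hypothesis hN : homogeneous_norm G N.

Lemma multiplier_csum j Phi : cflat Phi -> multiplier G N j (csum (cpiece j Phi)).
Proof.
have [N0 [cN _] NE _ NZ] := hN.
move=> [fr fi]; apply/multiplierP; rewrite Re_csum_cpiece Im_csum_cpiece.
by split; exact: piece_sum_multiplier.
Qed.

Lemma multiplier_decomposition j J : multiplier G N j J ->
  exists2 Phi, cflat Phi & csum (cpiece j Phi) = J.
Proof.
have [N0 [cN _] NE _ NZ] := hN.
move=> /multiplierP[mr mi].
exists (fun k x => localized a j (re J) k x +i* localized a j (im J) k x).
  by split; exact: (flat_localized a1 N0 cN NE NZ).
apply/funext => x; apply: eq_complex_parts.
  rewrite -[LHS]/(re (csum _) x) Re_csum_cpiece.
  exact: (congr1 (fun f => f x) (fsum_localized a1 N0 cN NE NZ mr)).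
rewrite -[LHS]/(im (csum _) x) Im_csum_cpiece.
exact: (congr1 (fun f => f x) (fsum_localized a1 N0 cN NE NZ mi)).
Qed.

End gauge.

Lemma integral_monomial (al : multiindex n.+1) (f : V -> R[i]) : cschwartz f ->
  integral_C (fun x => (monomial al x)%:C * f x) = 0 <->
  real_integral (fun x => monomial al x * re f x) = 0 /\
  real_integral (fun x => monomial al x * im f x) = 0.
Proof.
move=> cf; rewrite /integral_C.
rewrite (_ : re _ = fun x => monomial al x * re f x); last first.
  by apply/funext => x; rewrite /= ReM mul0r subr0.
rewrite (_ : im _ = fun x => monomial al x * im f x); last first.
  by apply/funext => x; rewrite /= ImM mul0r addr0.
by split=> [[-> ->]|[-> ->]].
Qed.

Lemma admissible_inv_fourier Phi : cflat Phi -> admissible (fun k => inv_fourier (Phi k)).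
Proof.
move=> fP; have cP := cflat_csbounded fP; have cF := csbounded_inv_fourier cP.
split; first exact/schwartz_boundedP.
case=> [//|k] _; split; first exact: (csbounded_schwartz k.+1 cF).
move=> al; have ck : cschwartz (Phi k.+1) by exact: (csbounded_pull (fun=> k.+1) cP).
apply/integral_monomial; first exact: (csbounded_pull (fun=> k.+1) cF).
have [rr ri] := cschwartz_parts ck; have [[_ fr] [_ fi]] := fP.
rewrite -(multi_flatten al); set l := flatten _.
have M b (f : V -> R) : rschwartz f -> (forall s, iter_partial s f 0 = 0) ->
    real_integral (fun x => monomial (multi l) x * ft b f x) = 0.
  by move=> rf f0; under eq_fun do rewrite monomial_multi; exact: moment_ft.
have I b (f : V -> R) : rschwartz f -> rint (fun x => monomial (multi l) x * ft b f x).
  move=> rf; under eq_fun do rewrite monomial_multi.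
  by apply: rschwartz_rint; apply: rschwartz_monomial; exact: rschwartz_ft.
rewrite Re_inv_fourier// Im_inv_fourier//; split.
  under eq_fun do rewrite mulrDr.
  by rewrite real_integralD ?M ?addr0//; exact: I.
under eq_fun do rewrite mulrBr.
by rewrite real_integralB ?M ?subr0//; exact: I.
Qed.

(** The transform with the conjugate kernel exp(2 pi i x.y), divided by [fourier_constant]: the
    inverse of [inv_fourier], by [cfourierK]. *)
Definition cfourier (phi : nat -> V -> R[i]) (k : nat) : V -> R[i] := fun x =>
  ((fourier_constant R n.+1)^-1 * (ft false (re (phi k)) x - ft true (im (phi k)) x)) +i*
  ((fourier_constant R n.+1)^-1 * (ft false (im (phi k)) x + ft true (re (phi k)) x)).

Lemma cflat_cfourier phi : admissible phi -> cflat (cfourier phi).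
Proof.
move=> [/schwartz_boundedP cphi m0]; have [pr pi] := cphi.
have Z b (p : R[i] -> R) k s : (forall k, rschwartz (p \o phi k)) ->
    (forall al, real_integral (fun x => monomial al x * (p \o phi k.+1) x) = 0) ->
    iter_partial s (ft b (p \o phi k.+1)) 0 = 0.
  move=> rp rm; apply: flat_ft => // l.
  by under eq_fun do rewrite -monomial_multi.
have rr k : rschwartz (re (phi k)) by exact: (sbounded_rschwartz k pr).
have ri k : rschwartz (im (phi k)) by exact: (sbounded_rschwartz k pi).
have mr k al : real_integral (fun x => monomial al x * re (phi k.+1) x) = 0 /\
    real_integral (fun x => monomial al x * im (phi k.+1) x) = 0.
  apply/integral_monomial; first exact: (csbounded_pull (fun=> k.+1) cphi).
  by have [_] := m0 k.+1 isT; apply.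
have mre k al := (mr k al).1; have mim k al := (mr k al).2.
have sf b (p : nat -> V -> R) : (forall k, rschwartz (p k)) -> forall k, smooth (ft b (p k)).
  by move=> rp k; exact: smooth_ft.
split; split.
- by apply: sboundedZ; apply: sboundedD; [|apply: sboundedN]; exact: sbounded_ft.
- move=> k s; rewrite [in LHS]/comp /= iter_partialZ; last by apply: smoothB; exact: smooth_ft.
  rewrite iter_partialB; try exact: smooth_ft.
  by rewrite (Z false (@complex.Re R))// (Z true (@complex.Im R))// subrr mulr0.
- by apply: sboundedZ; apply: sboundedD; exact: sbounded_ft.
move=> k s; rewrite [in LHS]/comp /= iter_partialZ; last by apply: smoothD; exact: smooth_ft.
rewrite iter_partialD; try exact: smooth_ft.
by rewrite (Z false (@complex.Im R))// (Z true (@complex.Re R))// addr0 mulr0.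
Qed.

Lemma cfourierK phi k : admissible phi -> inv_fourier (cfourier phi k) = phi k.
Proof.
move=> ap; have cF := cflat_csbounded (cflat_cfourier ap).
have cFk : cschwartz (cfourier phi k) by exact: (csbounded_pull (fun=> k) cF).
have [/schwartz_boundedP[pr pi] _] := ap.
have rr : rschwartz (re (phi k)) by exact: (sbounded_rschwartz k pr).
have ri : rschwartz (im (phi k)) by exact: (sbounded_rschwartz k pi).
have c0 := fourier_constant_neq0 R n.+1.
have rE : re (cfourier phi k) = fun x => (fourier_constant R n.+1)^-1 *
    (ft false (re (phi k)) x + (-1) * ft true (im (phi k)) x).
  by apply/funext => x; rewrite mulN1r.
have iE : im (cfourier phi k) = fun x => (fourier_constant R n.+1)^-1 *
    (ft false (im (phi k)) x + 1 * ft true (re (phi k)) x).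
  by apply/funext => x; rewrite mul1r.
have L b (u v : V -> R) (c e : R) : rschwartz u -> rschwartz v ->
    ft b (fun x => c * (u x + e * v x)) = fun x => c * (ft b u x + e * ft b v x).
  move=> ru rv; rewrite ftZ ?ftD ?ftZ//; first exact: sboundedZ.
  by apply: sboundedD => //; exact: sboundedZ.
apply/funext => x; apply: eq_complex_parts.
  rewrite -[LHS]/(re (inv_fourier (cfourier phi k)) x) Re_inv_fourier// rE iE.
  rewrite !L; try exact: rschwartz_ft.
  apply: (mulfI c0); rewrite -[in RHS]/(re (phi k) x) -(fourier_inversion x rr).
  rewrite (fourier_inversion_cross x ri); field => //.
rewrite -[LHS]/(im (inv_fourier (cfourier phi k)) x) Im_inv_fourier// rE iE.
rewrite !L; try exact: rschwartz_ft.
apply: (mulfI c0); rewrite -[in RHS]/(im (phi k) x) -(fourier_inversion x ri).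
rewrite (fourier_inversion_cross x rr); field => //.
Qed.

End complex_pieces.

(** * Absolutely convergent series of Schwartz functions *)

Section small_families.
Variables (R : realType) (d : nat).
Local Notation V := 'rV[R]_d.
Local Notation re f := (@complex.Re R \o f).
Local Notation im f := (@complex.Im R \o f).
Implicit Types (x y : V).

Let half_gt0 k : 0 < (2^-1 : R) ^+ k.
Proof. by rewrite exprn_gt0// invr_gt0. Qed.

(** Decay like 2^-k in every Schwartz norm, phrased as boundedness of the rescaled family so that
    the lemmas on [sbounded] apply. *)
Definition small (h : nat -> V -> R) := sbounded (fun k x => (2^-1 ^+ k)^-1 * h k x).

Lemma small_bound h M s : small h ->
  exists2 C : R, 0 <= C & forall k x, `|iter_partial s (h k) x| <= C * weight M x * 2^-1 ^+ k.
Proof.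
move=> sh; have [C C0 H] := scaled_bound M s half_gt0 sh; exists C => // k x.
by rewrite mulrAC.
Qed.

Lemma small_smooth h k : small h -> smooth (h k).
Proof.
move=> [sh _]; rewrite (_ : h k = fun x => 2^-1 ^+ k * ((2^-1 ^+ k)^-1 * h k x)).
  exact: smoothZ.
by apply/funext => x; rewrite mulVKf// gt_eqF.
Qed.

Lemma small_geometric h : small h -> geometric_family h.
Proof.
move=> sh; split=> [k|s B]; first exact: small_smooth.
have [C C0 H] := small_bound 0 s sh; exists C => k x _.
by apply: (le_trans (H k x)); rewrite /weight expr0 invr1 mulr1.
Qed.

Lemma small_tail h : small h -> small (fun m x => \sum_(k < m) h k x - fsum h x).
Proof.
move=> sh; have gh := small_geometric sh.
have sm m : smooth (fun x => \sum_(k < m) h k x - fsum h x).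
  apply: smoothB; last exact: smooth_fsum.
  by apply: smooth_sum => k; exact: small_smooth.
split=> [m|M s]; first exact: smoothZ.
have [C C0 H] := small_bound M s sh; exists (2 * C) => m x _.
rewrite iter_partialZ// iter_partialB; last 2 first.
- by apply: smooth_sum => k; exact: small_smooth.
- exact: smooth_fsum.
rewrite iter_partial_sum => [|k]; last exact: small_smooth.
rewrite iter_partial_fsum// normrM gtr0_norm ?invr_gt0// distrC ler_pdivrMl//.
apply: (le_trans (geo_tail m (fun k => H k x))).
by rewrite mulrA mulrC.
Qed.

(** Up to sign the sum is the tail at m = 0, so [small_tail] already contains this. *)
Lemma small_fsum h : small h -> rschwartz (fsum h).
Proof.
move=> sh; have /(sbounded_pull (fun _ : unit => 0%N)) := small_tail sh.
move=> /sboundedN; congr sbounded; apply/funext => _; apply/funext => x.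
by rewrite expr0 invr1 mul1r big_ord0 sub0r opprK.
Qed.

Lemma small_tame_series h : small h -> tame_series h.
Proof.
move=> sh; split=> [k||]; first exact: smooth_continuous (small_smooth k sh).
  exact: smooth_continuous (smooth_fsum (small_geometric sh)).
have [C C0 H] := small_bound 0 [::] sh; exists 0%N, C; split => // k x.
by apply: (le_trans (H k x)); rewrite /weight !expr0 invr1.
Qed.

Lemma smallD h h' : small h -> small h' -> small (fun k x => h k x + h' k x).
Proof.
move=> sh sh'; have := sboundedD sh sh'; congr sbounded.
by apply/funext => k; apply/funext => x; rewrite mulrDr.
Qed.

Lemma smallN h : small h -> small (fun k x => - h k x).
Proof.
move=> sh; have := sboundedN sh; congr sbounded.
by apply/funext => k; apply/funext => x; rewrite mulrN.
Qed.

Lemma small_rschwartz h k : small h -> rschwartz (h k).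
Proof.
move=> sh; have := sboundedZ (2^-1 ^+ k) (sbounded_pull (fun _ : unit => k) sh).
by congr sbounded; apply/funext => _; apply/funext => x; rewrite mulVKf// gt_eqF.
Qed.

Definition csmall (h : nat -> V -> R[i]) := small (fun k => re (h k)) /\ small (fun k => im (h k)).

Lemma csmall_schwartz h k : csmall h -> schwartz (h k).
Proof.
move=> [hr hi]; apply/schwartzP; split.
  exact: (@small_rschwartz (fun k => re (h k)) k hr).
exact: (@small_rschwartz (fun k => im (h k)) k hi).
Qed.

Lemma schwartz_csum h : csmall h -> schwartz (csum h).
Proof.
move=> [hr hi]; apply/schwartzP; split.
  exact: (small_fsum hr).
exact: (small_fsum hi).
Qed.

Lemma csmall_norm h al be : csmall h ->
  exists2 C : R, 0 <= C & forall k, (schwartz_norm al be (h k) <= (C * 2^-1 ^+ k)%:E)%E.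
Proof. by move=> [hr hi]; apply: scaled_schwartz_norm. Qed.

Lemma csmall_tail h : csmall h -> csmall (fun m x => \sum_(k < m) h k x - csum h x).
Proof.
move=> [hr hi]; split.
  have := small_tail hr; congr small; apply/funext => m; apply/funext => x.
  by rewrite /= ReB Re_sum.
have := small_tail hi; congr small; apply/funext => m; apply/funext => x.
by rewrite /= ImB Im_sum.
Qed.

Lemma csmall_ctame_series h : csmall h -> ctame_series h.
Proof. by move=> [hr hi]; split; exact: small_tame_series. Qed.

Lemma schwartz_abs_series_csum h (T : functional R d) : csmall h ->
  eq_dist T (dist_of (csum h)) -> schwartz_abs_series h T.
Proof.
move=> sh Th; split=> [k|al be|]; first exact: csmall_schwartz.
  have [C C0 H] := csmall_norm al be sh.
  apply: (@le_lt_trans _ _ (2 * C)%:E); last exact: ltry.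
  (* The bound C 2^-k is rewritten with denominators 2^(k+1), the form in which [epsilon_trick0]
     sums the geometric series. *)
  apply: (@le_trans _ _ (\sum_(0 <= k <oo) (2 * C / (2 ^ k.+1)%:R)%:E)%E); last first.
    by apply: epsilon_trick0; rewrite mulr_ge0.
  apply: lee_nneseries => [k _ _|k _]; first exact: schwartz_norm_ge0.
  apply: (le_trans (H k)); rewrite lee_fin natrX exprS invfM mulrA [2 * C]mulrC mulfK//.
  by rewrite exprVn.
exists (csum h); split => //; first exact: schwartz_csum.
move=> al be; have [C C0 H] := csmall_norm al be (csmall_tail sh).
apply: (@squeeze_cvge _ _ _ _ (fun=> 0%E) _ (fun m => (C * 2^-1 ^+ m)%:E)).
- by apply: nearW => m; rewrite schwartz_norm_ge0 H.
- exact: cvg_cst.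
apply: cvg_EFin; first by apply: nearW.
have := @cvg_geometric R C 2^-1.
by rewrite ger0_norm ?invr_ge0// invf_lt1// ltr1n; apply.
Qed.

Lemma bounded_derivatives1 : bounded_derivatives (fun _ : V => 1 : R).
Proof.
split; first exact: smooth_cst.
move=> s; exists 1 => x; case: s => [|i s]; first by rewrite /= normr1.
by rewrite iter_partial_cst// normr0.
Qed.

Lemma bounded_derivativesB (u v : V -> R) : bounded_derivatives u -> bounded_derivatives v ->
  bounded_derivatives (fun x => u x - v x).
Proof.
move=> [su bu] [sv bv]; split; first exact: smoothB.
move=> s; have [C HC] := bu s; have [D HD] := bv s; exists (C + D) => x.
by rewrite iter_partialB//; apply: (le_trans (ler_normB _ _)); apply: lerD.
Qed.

Lemma rschwartz_bounded_derivatives (u : V -> R) : rschwartz u -> bounded_derivatives u.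
Proof.
move=> ru; split; first exact: rschwartz_smooth.
move=> s; have [C C0 H] := sbounded_bound 0 s ru; exists C => x.
by apply: (le_trans (H tt x)); rewrite /weight expr0 invr1 mulr1.
Qed.

Lemma test_function_bound (f : V -> R[i]) : test_function f ->
  exists r : R, forall x, r < `|x| -> f x = 0.
Proof.
move=> [_ cf]; have [M [_ HM]] := compact_bounded cf.
exists (M + 1) => x xM; apply: contraPP (xM) => /eqP fx; apply/negP; rewrite -leNgt.
by apply: (HM (M + 1)); [rewrite ltrDl|exact: subset_closure].
Qed.

Lemma test_function_schwartz (f : V -> R[i]) : test_function f -> schwartz f.
Proof.
move=> tf; have [r Hr] := test_function_bound tf; have [[/smoothP sr /smoothP si] _] := tf.
apply/schwartzP; split.
  by apply: (@compact_support_rschwartz _ _ (re f) r) => // x /Hr; rewrite /= => ->.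
by apply: (@compact_support_rschwartz _ _ (im f) r) => // x /Hr; rewrite /= => ->.
Qed.

Lemma schwartz_cbounded_derivatives (f : V -> R[i]) : schwartz f ->
  cbounded_derivatives f /\ cbounded_derivatives (fun x => 1 - f x).
Proof.
move=> /schwartzP[fr fi]; split.
  by split; apply: rschwartz_bounded_derivatives.
split.
  have := bounded_derivativesB bounded_derivatives1 (rschwartz_bounded_derivatives fr).
  by congr bounded_derivatives; apply/funext => x; rewrite /= ReB.
(* The imaginary part of 1 - f is written as (1 - 1) - Im f. *)
have := bounded_derivativesB (bounded_derivativesB bounded_derivatives1 bounded_derivatives1)
  (rschwartz_bounded_derivatives fi).
by congr bounded_derivatives; apply/funext => x; rewrite /= ImB subrr.
Qed.

End small_families.

(** * Decay of the dyadic pieces away from the origin *)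

Section off_origin.
Variables (R : realType) (n : nat) (a : 'I_n.+1 -> R).
Hypothesis a1 : forall i, 1 <= a i.
Local Notation V := 'rV[R]_n.+1.

Lemma small_off_origin e (phi : nat -> V -> R) (u : V -> R) (r : R) : 0 < r ->
  sbounded phi -> bounded_derivatives u -> (forall x : V, `|x| < r -> u x = 0) ->
  small (fun k x => u x * ((2 `^ e) ^+ k * phi k (dilation a (2 ^+ k) x))).
Proof.
move=> r0 sp [su bu] u0.
have sphi k : smooth (phi k) by exact: (sbounded_smooth k sp).
pose F k x := (2^-1 ^+ k)^-1 * ((2 `^ e) ^+ k * phi k (dilation a (2 ^+ k) x)).
have sF k : smooth (F k) by do 2 apply: smoothZ; exact: smooth_dilation.
have E : (fun k x => (2^-1 ^+ k)^-1 * (u x * ((2 `^ e) ^+ k * phi k (dilation a (2 ^+ k) x)))) =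
    fun k x => u x * F k x.
  by apply/funext => k; apply/funext => x; rewrite mulrCA.
rewrite /small E; split=> [k|M]; first exact: smoothM.
pose P (k : nat) (x : V) := r <= `|x|.
have P0 k x s : ~~ P k x -> iter_partial s (fun x => u x * F k x) x = 0.
  rewrite /P -ltNge => xr; apply: iter_partial_eq0.
  have op : open [set z : V | `|z| < r].
    exact: open_norm_lt.
  have : \near x, `|x| < r by exact: open_nbhs_nbhs.
  by apply: filterS => y yr; rewrite u0// mul0r.
have bF : bounded_on F P (fun _ => weight M).
  (* Derivatives of order s contribute 2^(k wlen s) to the prefactor 2^(ek); the additional 1 yields
     the factor 2^-k that [small] requires. *)
  move=> s; have [L eL] := exists_nat_ge (e + wlen a s + 1).
  (* M orders of decay supply the weight at [x]. The other L are spent on the dilate, whose norm is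
     at least 2^k r, and gain r^-L 2^(-kL). *)
  have [C C0 HC] := sbounded_bound (M + L) s sp.
  exists (C * r ^- L) => k x Px.
  have k20 : 0 < (2 : R) ^+ k by rewrite exprn_gt0.
  have k21 : 1 <= (2 : R) ^+ k by rewrite exprn_ege1// ler1n.
  have nx : 2 ^+ k * `|x| <= `|dilation a (2 ^+ k) x| by exact: norm_dilation_ge.
  rewrite /F iter_partialZ; last by apply: smoothZ; exact: smooth_dilation.
  rewrite iter_partialZ; last exact: smooth_dilation.
  have p2 : ((2 : R) ^+ k) `^ wlen a s = (2 `^ wlen a s) ^+ k.
    by rewrite -[X in X `^ _]powR_mulrn// powRAC powR_mulrn ?powR_ge0.
  rewrite iter_partial_dilation// p2.
  have -> : (2^-1 ^+ k)^-1 * ((2 `^ e) ^+ k * ((2 `^ wlen a s) ^+ k *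
      iter_partial s (phi k) (dilation a (2 ^+ k) x))) =
      ((2^-1 ^+ k)^-1 * (2 `^ (e + wlen a s)) ^+ k) * iter_partial s (phi k) (dilation a (2 ^+ k) x).
    by rewrite gt0_powRD// exprMn !mulrA.
  rewrite normrM ger0_norm; last first.
    by rewrite mulr_ge0 ?invr_ge0 ?exprn_ge0 ?powR_ge0// invr_ge0.
  apply: (@le_trans _ _ ((2^-1 ^+ k)^-1 * (2 `^ (e + wlen a s)) ^+ k *
      (C * (weight M x * (r ^- L * (2^-1 ^+ k) ^+ L))))).
    rewrite ler_wpM2l//.
    apply: (le_trans (HC _ _)); rewrite ler_wpM2l// weightD.
    apply: ler_pM; rewrite ?weight_ge0//.
      rewrite lef_pV2 ?posrE ?exprn_gt0 ?ltr_wpDr// lerXn2r ?nnegrE ?addr_ge0// lerD2l.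
      by apply: le_trans nx; rewrite ler_peMl.
    rewrite exprVn exprVn -invfM -exprMn lef_pV2 ?posrE ?exprn_gt0 ?ltr_wpDr ?mulr_gt0//.
    rewrite lerXn2r ?nnegrE ?addr_ge0 ?mulr_ge0 ?(ltW r0) ?(ltW k20)//.
    apply: (@le_trans _ _ (2 ^+ k * `|x|)); last by apply: (le_trans nx); rewrite lerDr.
    by rewrite mulrC ler_pM2l.
  have := pow2_half k eL; move: (weight M x) (weight_ge0 M x) => w w0.
  have h0 : 0 < (2^-1 : R) ^+ k by rewrite exprn_gt0// invr_gt0.
  move: ((2^-1 : R) ^+ k) h0 ((2 `^ (e + wlen a s)) ^+ k) => v v0 q H.
  have -> : v^-1 * q * (C * (w * (r ^- L * v ^+ L))) = (C * r ^- L * w) * (v^-1 * (q * v ^+ L)) by ring.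
  rewrite -[leRHS]mulr1 ler_wpM2l ?mulr_ge0 ?invr_ge0 ?exprn_ge0 ?(ltW r0)//.
  by rewrite ler_pdivrMl// mulr1.
have bu' : bounded_on (fun _ : nat => u) P (fun _ _ => 1).
  by move=> s; have [C HC] := bu s; exists C => k x _; rewrite mulr1.
have := @bounded_onM _ _ nat (fun=> u) F P (fun _ _ => 1) (fun _ => weight M) (fun=> su) sF
  (fun _ _ _ => ler01) (fun _ _ _ => weight_ge0 M _) bu' bF.
move=> bb s; have [|C C0 HC] := bounded_on_nonneg s _ bb.
  by move=> k x _; rewrite mul1r weight_ge0.
exists C => k x _; case: (boolP (P k x)) => [Px|/P0 ->].
  by have := HC k x Px; rewrite mul1r.
by rewrite normr0 mulr_ge0// weight_ge0.
Qed.

End off_origin.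

(** * The characterization *)

Section characterization.
Variables (R : realType) (n : nat) (G : homogeneous_group R n).
Local Notation V := 'rV[R]_n.+1.
Local Notation a := (hg_exponent G).
Local Notation re f := (@complex.Re R \o f).
Local Notation im f := (@complex.Im R \o f).
Implicit Types (K : functional R n.+1) (j : R).

Let a1 := @hg_exponent_ge1 R n G.

Lemma csmall_dyadic j phi (f : V -> R[i]) (r : R) : 0 < r -> schwartz_bounded phi ->
  cbounded_derivatives f -> (forall x : V, `|x| < r -> f x = 0) ->
  csmall (fun k x => f x * dyadic_piece G j phi k x).
Proof.
move=> r0 /schwartz_boundedP[pr pi] [fr fi] f0.
have E k : (2 `^ ((j + homogeneous_dim G) * k%:R)) = (2 `^ (j + homogeneous_dim G)) ^+ k.
  by rewrite powRrM powR_mulrn// powR_ge0.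
have S (p : nat -> V -> R) (u : V -> R) : sbounded p -> bounded_derivatives u ->
    (forall x : V, `|x| < r -> u x = 0) ->
    small (fun k x => u x * (2 `^ ((j + homogeneous_dim G) * k%:R) * p k (delta G (2 ^+ k) x))).
  move=> sp bu u0; have := small_off_origin a1 (j + homogeneous_dim G) r0 sp bu u0.
  by congr small; apply/funext => k; apply/funext => x; rewrite E.
have fr0 (x : V) : `|x| < r -> re f x = 0 by move=> /f0; rewrite /= => ->.
have fi0 (x : V) : `|x| < r -> im f x = 0 by move=> /f0; rewrite /= => ->.
split.
  have := smallD (S _ _ pr fr fr0) (smallN (S _ _ pi fi fi0)).
  congr small; apply/funext => k; apply/funext => x.
  by rewrite /dyadic_piece /= ReM ReM ImM !mul0r subr0 addr0.
have := smallD (S _ _ pi fr fr0) (S _ _ pr fi fi0).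
congr small; apply/funext => k; apply/funext => x.
by rewrite /dyadic_piece /= ImM ReM ImM !mul0r subr0 addr0.
Qed.

Lemma dist_series_mul (f : V -> R[i]) h K : cbounded_derivatives f -> dist_series h K ->
  dist_series (fun k x => f x * h k x) (dist_mul f K).
Proof.
move=> bf hK psi /schwartzP cp.
have sfp : schwartz (fun x => f x * psi x) by apply/schwartzP; exact: (csbounded_mul bf cp).
have := hK _ sfp; apply: cvg_trans; apply: near_eq_cvg; apply: nearW => m.
congr (normc (_ - _)); apply: eq_bigr => k _; congr integral_C; apply/funext => x.
by rewrite mulrCA mulrA.
Qed.

(** The products [f] times the pieces sum to [f K] by duality, and to their pointwise sum because
    they are geometrically small; limits of distributions are unique. *)
Lemma dist_mul_dyadic j phi K (f : V -> R[i]) (r : R) : 0 < r -> schwartz_bounded phi ->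
  cbounded_derivatives f -> (forall x : V, `|x| < r -> f x = 0) ->
  dist_series (dyadic_piece G j phi) K ->
  eq_dist (dist_mul f K) (dist_of (csum (fun k x => f x * dyadic_piece G j phi k x))).
Proof.
move=> r0 sp bf f0 sK; apply: dist_cvg_unique (dist_series_mul bf sK) _.
by apply: dist_series_csum; apply: csmall_ctame_series; exact: csmall_dyadic sp bf f0.
Qed.

Variable N : V -> R.
Hypothesis hN : homogeneous_norm G N.

Lemma multiplier_check_series j phi : admissible phi ->
  exists2 K : functional R n.+1, multiplier_check G N j K & dist_series (dyadic_piece G j phi) K.
Proof.
move=> ap; have fP := cflat_cfourier ap.
pose J := csum (cpiece G j (cfourier phi)).
exists (inv_fourier_dist (dist_of J)).
  split; last by exists J => //; exact: (multiplier_csum hN).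
  by apply: tempered_inv_fourier; apply: tempered_dist_of; apply: ctame_csum; exact: ctame_series_cpiece.
have := dist_series_dyadic G j fP.
by rewrite (_ : (fun k => _) = phi)//; apply/funext => k; exact: cfourierK.
Qed.

Lemma multiplier_check_dyadic j K : multiplier_check G N j K ->
  exists2 phi, admissible phi & dist_series (dyadic_piece G j phi) K.
Proof.
move=> [tK [J mJ KJ]]; have [Phi fP PJ] := multiplier_decomposition hN mJ.
exists (fun k => inv_fourier (Phi k)); first exact: admissible_inv_fourier.
by move=> psi sp; rewrite KJ// -PJ; exact: dist_series_dyadic.
Qed.

Lemma multiplier_checkP j K : tempered K ->
  (multiplier_check G N j K <->
   exists2 phi, admissible phi & dist_series (dyadic_piece G j phi) K).
Proof.
move=> tK; split=> [|[phi ap sK]]; first exact: multiplier_check_dyadic.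
have [L [_ [J mJ LJ]] sL] := multiplier_check_series j ap.
split => //; exists J => // psi sp; rewrite -LJ//.
exact: (dist_cvg_unique sK sL).
Qed.

(** The parameter is the inverse of the radius: [bump c] vanishes where [|x| >= 2 / c], so a large
    [c] reaches points close to the origin. *)
Definition bump (c : R) : V -> R[i] := fun x => (cutoff (c *: x))%:C.

Lemma cschwartz_bump (c : R) : 0 < c -> cschwartz (bump c).
Proof.
move=> c0; split; last first.
  by have [_] := csbounded0 R n.+1 unit; congr sbounded.
have -> : re (bump c) = fun x => cutoff (affine (const_mx c) 0 x).
  apply/funext => x /=; congr cutoff; apply/rowP => i; by rewrite !mxE addr0.
apply: rschwartz_affine; first by move=> i; rewrite mxE gt_eqF.
exact: cutoff_rschwartz.
Qed.

Lemma bump_eq0 (c : R) (x : V) : 0 < c -> 2 <= c * `|x| -> bump c x = 0.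
Proof. by move=> c0 cx; rewrite /bump cutoff_eq0// normrZ gtr0_norm. Qed.

Lemma bump_eq1 (c : R) (x : V) : 0 < c -> c * `|x| <= n.+2%:R^-1 -> bump c x = 1.
Proof. by move=> c0 cx; rewrite /bump cutoff_eq1// normrZ gtr0_norm. Qed.

Lemma off_bump (c : R) : 0 < c -> [/\ cbounded_derivatives (bump c),
  cbounded_derivatives (fun x => 1 - bump c x) &
  exists2 r : R, 0 < r & forall x : V, `|x| < r -> 1 - bump c x = 0].
Proof.
move=> c0; have /schwartzP/schwartz_cbounded_derivatives[b1 b2] := cschwartz_bump c0.
split => //; exists (n.+2%:R^-1 / c) => [|x]; first by rewrite divr_gt0// invr_gt0.
by rewrite ltr_pdivlMr// => xr; rewrite bump_eq1 ?subrr// mulrC ltW.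
Qed.

Lemma multiplier_check_compact j K : multiplier_check G N j K ->
  exists E g, [/\ compactly_supported E, schwartz g & eq_dist K (fun psi => E psi + dist_of g psi)].
Proof.
move=> mK; have [tK _] := mK; have [linK _] := tK.
have [phi [sp ap] sK] := multiplier_check_dyadic mK.
have [b1 b2 [r r0 br]] := off_bump (ltr01 : 0 < 1 :> R).
(* The splitting K = bump K + (1 - bump) K: the first term lives in the ball of radius 2, the second
   is a Schwartz function by [dist_mul_dyadic]. *)
exists (dist_mul (bump 1) K), (csum (fun k x => (1 - bump 1 x) * dyadic_piece G j phi k x)).
have tE := tempered_mul b1 tK.
split; last 2 first.
- exact: schwartz_csum (csmall_dyadic j r0 sp b2 br).
- move=> psi spsi; rewrite -(dist_mul_dyadic r0 sp b2 br sK)//.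
  have cp : cschwartz psi by apply/schwartzP.
  have s1 : schwartz (fun x => bump 1 x * psi x) by apply/schwartzP; exact: (csbounded_mul b1 cp).
  have s2 : schwartz (fun x => (1 - bump 1 x) * psi x) by apply/schwartzP; exact: (csbounded_mul b2 cp).
  have := linK 1 _ _ s1 s2; rewrite mul1r /dist_mul => <-; congr K; apply/funext => x.
  by rewrite mul1r mulrBl mul1r addrC subrK.
split => //; apply: bounded_closed_compact.
  exists 2; split; first exact: num_real.
  move=> M M2 x; apply: contraPP => /negP; rewrite -ltNge => xM.
  apply; exists [set y : V | 2 < `|y|]; split.
    split; last exact: lt_trans M2 xM.
    exact: open_norm_gt.
  move=> psi tpsi psi2; rewrite /dist_mul -[RHS](tempered0 tK); congr K; apply/funext => y.
  have [y2|y2] := ltP 2 `|y|; first by rewrite bump_eq0 ?mul0r// mul1r ltW.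
  apply/eqP; rewrite mulf_eq0; apply/orP; right; apply: contraTT y2 => py; rewrite -ltNge.
  by apply: psi2; exact: subset_closure.
rewrite -[X in closed X]setCK; apply: open_closedC.
rewrite openE => x /contrapT[U [[oU Ux] HU]].
have : nbhs x U by exact: open_nbhs_nbhs.
by apply: filterS => y Uy; apply; exists U.
Qed.

Lemma smooth_on_near (f : V -> R) (U : set V) :
  (forall x, U x -> exists2 g, smooth g & \near x, f x = g x) -> smooth_on U f.
Proof.
move=> H s x Ux; have [h sh fh] := H x Ux; have fs := near_eq_iter_partial s fh.
have sth := smooth_iter_partial s sh.
have hs : \near x, iter_partial s h x = iter_partial s f x by apply: filterS fs => y ->.
split=> [|i].
  have c : {for x, continuous (iter_partial s h)} by exact: smooth_continuous.
  change (iter_partial s f @ x --> iter_partial s f x).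
  rewrite (nbhs_singleton fs); apply: cvg_trans c; exact: (@near_eq_cvg _ _ (nbhs x) (nbhs_filter x) _ _ hs).
by apply: near_eq_derivable hs _; exact: smooth_derivable.
Qed.

Lemma multiplier_check_smooth j K : multiplier_check G N j K -> smooth_away_from_origin K.
Proof.
move=> mK; have [tK _] := mK; have [phi [sp ap] sK] := multiplier_check_dyadic mK.
pose h c k x := (1 - bump c x) * dyadic_piece G j phi k x.
have sh c : 0 < c -> csmall (h c).
  by move=> c0; have [_ b2 [r r0 br]] := off_bump c0; exact: csmall_dyadic br.
have hE c (x : V) : 0 < c -> 2 <= c * `|x| -> csum (h c) x = csum (dyadic_piece G j phi) x.
  move=> c0 cx; apply: eq_complex_parts; congr gsum; apply/funext => k;
    by rewrite /h /= bump_eq0// subr0 mul1r.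
(* The pointwise sum of the pieces. At the origin the series may diverge, and the value is then a
   default; neither claim involves that point. *)
exists (csum (dyadic_piece G j phi)); split.
  (* With c = 3 / |x| the bump vanishes where [|y| >= 2 / 3 * |x|], in particular near [x]; there
     the sum agrees with a Schwartz function. *)
  have nearE (x : V) : x != 0 -> 0 < 3 / `|x| /\
      \forall y \near x, csum (dyadic_piece G j phi) y = csum (h (3 / `|x|)) y.
    move=> x0; have nx : 0 < `|x| by rewrite normr_gt0.
    have c0 : 0 < 3 / `|x| by rewrite divr_gt0.
    split => //.
    have op : open [set z : V | 2 / 3 * `|x| < `|z|].
      exact: open_norm_gt.
    have : \forall y \near x, 2 / 3 * `|x| < `|y|.
      by apply: open_nbhs_nbhs; split => //=; lra.
    apply: filterS => y /= xy; rewrite hE//.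
    by rewrite mulrAC ler_pdivlMr//; lra.
  split; apply: smooth_on_near => x /nearE[c0 xE].
    exists (re (csum (h (3 / `|x|)))); last by apply: filterS xE => y /(congr1 (@complex.Re R)).
    by have /schwartzP[/rschwartz_smooth] := schwartz_csum (sh _ c0).
  exists (im (csum (h (3 / `|x|)))); last by apply: filterS xE => y /(congr1 (@complex.Im R)).
  by have /schwartzP[_ /rschwartz_smooth] := schwartz_csum (sh _ c0).
move=> psi tpsi psi0.
have [e e0 He] : exists2 e : R, 0 < e & forall x : V, `|x| < e -> psi x = 0.
  have n0 : nbhs (0 : V) (~` tsupport psi).
    apply: open_nbhs_nbhs; split; first exact/closed_openC/closed_closure.
    by move=> /psi0; rewrite /= eqxx.
  have [e /= e0 He] := (nbhs_ballP _ _).1 n0; exists e => // x xe.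
  apply/eqP; apply: contrapT => /negP px.
  apply: (He x); last exact: subset_closure.
  by rewrite -ball_normE /= sub0r normrN.
(* This bump vanishes where [|x| >= e], hence wherever [psi] is nonzero, so [psi] is unchanged by
   the factor 1 - bump. *)
have c0 : 0 < 2 / e by rewrite divr_gt0.
have [_ b2 [r r0 br]] := off_bump c0.
have far (x : V) : psi x != 0 -> 2 <= 2 / e * `|x|.
  move=> px; rewrite mulrAC ler_pdivlMr// ler_pM2l// leNgt; apply/negP => /He px0.
  by rewrite px0 eqxx in px.
have psiE : psi = fun x => (1 - bump (2 / e) x) * psi x.
  apply/funext => x; have [->|/far xe] := eqVneq (psi x) 0; first by rewrite mulr0.
  by rewrite bump_eq0// subr0 mul1r.
rewrite {1}psiE [LHS](dist_mul_dyadic r0 sp b2 br sK); last exact: test_function_schwartz.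
congr integral_C; apply/funext => x.
have [->|/far xe] := eqVneq (psi x) 0; first by rewrite !mulr0.
by rewrite -[csum _ x in LHS]/(csum (h (2 / e)) x) hE.
Qed.

End characterization.

Theorem proposition15 (R : realType) (n : nat) (G : homogeneous_group R n)
    (N : 'rV[R]_n.+1 -> R) (hN : homogeneous_norm G N) (j : R) :
  [/\ forall K : functional R n.+1, tempered K ->
        (multiplier_check G N j K <->
         exists2 phi, admissible phi & dist_series (dyadic_piece G j phi) K),
      forall phi, admissible phi ->
        exists2 K : functional R n.+1, multiplier_check G N j K &
          dist_series (dyadic_piece G j phi) K,
      forall K : functional R n.+1, multiplier_check G N j K ->
        exists E g, [/\ compactly_supported E, schwartz g &
          eq_dist K (fun psi => E psi + dist_of g psi)],
      forall K : functional R n.+1, multiplier_check G N j K ->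
        smooth_away_from_origin K &
      forall (K : functional R n.+1) phi (zeta : 'rV[R]_n.+1 -> R[i]),
        multiplier_check G N j K -> admissible phi ->
        dist_series (dyadic_piece G j phi) K ->
        test_function zeta -> (\forall x \near (0 : 'rV[R]_n.+1), zeta x = 1) ->
        schwartz_abs_series
          (fun k x => (1 - zeta x) * dyadic_piece G j phi k x)
          (dist_mul (fun x => 1 - zeta x) K)].
Proof.
split.
- by move=> K; exact: multiplier_checkP.
- by move=> phi; exact: multiplier_check_series.
- exact: multiplier_check_compact.
- exact: multiplier_check_smooth.
move=> K phi zeta _ [sp _] sK tz z1.
have [_ bz] := schwartz_cbounded_derivatives (test_function_schwartz tz).
have [r /= r0 Hr] := (nbhs_ballP _ _).1 z1.
have z0 (x : 'rV[R]_n.+1) : `|x| < r -> 1 - zeta x = 0.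
  by move=> xr; rewrite Hr ?subrr// -ball_normE /= sub0r normrN.
apply: schwartz_abs_series_csum; first exact: csmall_dyadic r0 sp bz z0.
exact: dist_mul_dyadic r0 sp bz z0 sK.
Qed.
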